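(* Let $n>1$ be an integer. For every nonempty open connected subset $\omega$ of the sphere $b\mathbb{B}^{n}$ there exists a real analytic injective complex tangential immersion $f\colon \mathbb{R}\hookrightarrow \omega$ such that the cluster set of each of the sets $f(\mathbb{R}_+)$ and $f(\mathbb{R}_-)$ equals $\overline\omega$. This holds in particular for $\omega=b\mathbb{B}^n$.
   Context: $\mathbb{B}^n$ is the open unit ball of $\mathbb{C}^n$ and $b\mathbb{B}^n$ is its boundary, the unit sphere $S^{2n-1}$. Let $\xi$ be the contact structure on $b\mathbb{B}^n$ given by the distribution of complex tangent hyperplanes, i.e. $\xi_p=T_p(b\mathbb{B}^n)\cap \mathrm{i}\,T_p(b\mathbb{B}^n)$ for $p\in b\mathbb{B}^n$. A smooth curve $f\colon\mathbb{R}\to b\mathbb{B}^n$ is complex tangential (or $\xi$-Legendrian) if $\dot f(t)\in\xi_{f(t)}$ for every $t\in\mathbb{R}$. Write $\mathbb{R}_+=\{t\in\mathbb{R}:t\ge0\}$ and $\mathbb{R}_-=\{t\in\mathbb{R}:t\le0\}$. The cluster set of $f(\mathbb{R}_\pm)$ is the set of all limits of sequences $f(t_j)$ with $t_j\to\pm\infty$. *)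

(* Defs.v *)
From HB Require Import structures.
From mathcomp Require Import all_boot all_order all_algebra.
From mathcomp Require Import all_classical all_reals all_analysis.
From mathcomp Require Import complex.

Set Implicit Arguments.
Unset Strict Implicit.
Unset Printing Implicit Defensive.

Import Order.TTheory GRing.Theory Num.Theory.
Import numFieldNormedType.Exports.

Local Open Scope classical_set_scope.
Local Open Scope ring_scope.
Local Open Scope complex_scope.

(* MathComp-Analysis gives the regular module K^o of a numFieldType K its
   modulus topology, but R[i] itself carries none; transport it, so that
   'rV[R[i]]_n gets the product topology. *)
HB.instance Definition _ (R : realType) := NormedModule.copy R[i] R[i]^o.

(* [dotmx u v] is the Hermitian product of u and v, i.e. the sum of the
   u_j * conj(v_j); its real part is the Euclidean product on C^n = R^(2n). *)

Definition sphere (R : realType) (n : nat) : set 'rV[R[i]]_n :=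
  [set z | dotmx z z = 1].

Definition open_in_sphere (R : realType) (n : nat)
    (omega : set 'rV[R[i]]_n) : Prop :=
  exists2 U : set 'rV[R[i]]_n, open U & omega = @sphere R n `&` U.

(* The kernel at p of the differential of the squared Euclidean norm. *)
Definition tangent_sphere (R : realType) (n : nat) (p : 'rV[R[i]]_n) :
    set 'rV[R[i]]_n :=
  [set v | complex.Re (dotmx v p) = 0].

Definition contact_hyperplane (R : realType) (n : nat) (p : 'rV[R[i]]_n) :
    set 'rV[R[i]]_n :=
  tangent_sphere p `&` [set 'i *: v | v in tangent_sphere p].

Definition re_comp (R : realType) (n : nat) (f : R -> 'rV[R[i]]_n) (j : 'I_n) :
    R -> R :=
  fun t => complex.Re (f t 0 j).

Definition im_comp (R : realType) (n : nat) (f : R -> 'rV[R[i]]_n) (j : 'I_n) :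
    R -> R :=
  fun t => complex.Im (f t 0 j).

Definition real_analytic (R : realType) (g : R -> R) : Prop :=
  forall x0 : R, exists a : nat -> R,
    \forall x \near x0, pseries a (x - x0) @ \oo --> g x.

(* As the sphere is a closed real analytic submanifold of C^n, analyticity of
   a curve in it may be tested on the 2n real coordinates of C^n. *)
Definition real_analytic_curve (R : realType) (n : nat)
    (f : R -> 'rV[R[i]]_n) : Prop :=
  forall j : 'I_n, real_analytic (re_comp f j) /\ real_analytic (im_comp f j).

(* [derive1] is total: this is the derivative of f only when the coordinates of
   f are derivable. *)
Definition velocity (R : realType) (n : nat) (f : R -> 'rV[R[i]]_n) (t : R) :
    'rV[R[i]]_n :=
  \row_j (derive1 (re_comp f j) t +i* derive1 (im_comp f j) t).

Definition immersive (R : realType) (n : nat) (f : R -> 'rV[R[i]]_n) : Prop :=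
  forall t : R, velocity f t != 0.

Definition complex_tangential (R : realType) (n : nat)
    (f : R -> 'rV[R[i]]_n) : Prop :=
  forall t : R, contact_hyperplane (f t) (velocity f t).

Definition cluster_set_pinfty (R : realType) (n : nat)
    (f : R -> 'rV[R[i]]_n) : set 'rV[R[i]]_n :=
  [set p | exists t : nat -> R, t @ \oo --> +oo /\ f \o t @ \oo --> p].

Definition cluster_set_ninfty (R : realType) (n : nat)
    (f : R -> 'rV[R[i]]_n) : set 'rV[R[i]]_n :=
  [set p | exists t : nat -> R, t @ \oo --> -oo /\ f \o t @ \oo --> p].

(* The closure is taken in C^n, where the sphere is closed, so it is also the
   closure in the sphere. *)
Definition dense_legendrian_line (R : realType) (n : nat)
    (omega : set 'rV[R[i]]_n) (f : R -> 'rV[R[i]]_n) : Prop :=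
  [/\ forall t : R, omega (f t),
      real_analytic_curve f,
      injective f /\ immersive f,
      complex_tangential f &
      cluster_set_pinfty f = closure omega /\
      cluster_set_ninfty f = closure omega].

(* Main.v *)
(** Off one of its points the sphere is carried by the Cayley transform onto
    the Heisenberg group R^(2m+1) with the contact form ds - y dx, so that
    omega, minus a point, becomes an open set W.  The line is a limit of
    polynomial Legendrian curves that is uniform on every complex disc: each
    curve is a correction of the previous one, tiny on the disc already treated.
    The main correction switches the velocity off outside this disc by means of
    polynomials in t^2M that are almost 0 on a disc |t| <= r and almost 1 for
    r + e <= |t| <= b, and prolongs the curve along straight horizontal segments
    of W, chains of which connect any two points of W.  Letting both ends visit
    every rational point of W gives the cluster sets.  Immersion, and
    injectivity as the separation of pairs of disjoint rational intervals, are
    obtained by small perturbations found by a pigeonhole argument; being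
    quantitative, they survive the later corrections. *)

Require Import Defs.
From mathcomp Require Import all_boot all_order all_algebra.
From mathcomp Require Import all_classical all_reals all_analysis.
From mathcomp Require Import complex.
From mathcomp Require Import ring lra.
From mathcomp Require polyrcf.
Set Implicit Arguments.
Unset Strict Implicit.
Unset Printing Implicit Defensive.
Import Order.TTheory GRing.Theory Num.Theory.
Import numFieldNormedType.Exports.
Local Open Scope classical_set_scope.
Local Open Scope ring_scope.

(** * Majorant norm of real polynomials, primitives and mean value estimates *)

Section PolyNorm.
Context (R : realType).
Implicit Types (p q : {poly R}) (r t c : R).

(** Analyticity forbids cutoff functions, and approximation on real intervals is not enough, since a
    limit of polynomials uniform there need not be analytic. Hence the majorant norm [nrm r]: it
    dominates the supremum on the complex disc of radius r, is submultiplicative, and lets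
    everything be done with real polynomials. The even power t^2M in the cutoff is tiny on the
    complex disc and nonnegative on the real line, so it switches both ends of the curve at once;
    the end that is not being steered has to be kept still. Only x and y are corrected freely. The
    coordinate s is an integral of them, so every correction displaces it and end points are reached
    only approximately; reachability is therefore stated with a tolerance at the start. The whole
    sphere is treated apart: connectedness passes through the chart when omega misses the pole,
    whereas the sphere without its pole is the whole group, where explicit segments join any two
    points. *)

Definition nrm r p : R := \sum_(i < size p) `|p`_i| * r ^+ i.

Lemma nrm_widen n r p :
  (size p <= n)%N -> nrm r p = \sum_(i < n) `|p`_i| * r ^+ i.
Proof.
move=> le_pn; rewrite /nrm (big_ord_widen _ (fun i => `|p`_i| * r ^+ i) le_pn).
rewrite big_mkcond; apply: eq_bigr => i _; case: ltnP => // le_pi.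
by rewrite nth_default // normr0 mul0r.
Qed.

Lemma nrm_ge0 r p : 0 <= r -> 0 <= nrm r p.
Proof. by move=> r0; apply: sumr_ge0 => i _; rewrite mulr_ge0 ?exprn_ge0. Qed.

Lemma nrm0 r : nrm r 0 = 0.
Proof. by rewrite /nrm size_poly0 big_ord0. Qed.

Lemma nrmD r p q : 0 <= r -> nrm r (p + q) <= nrm r p + nrm r q.
Proof.
move=> r0; set n := maxn (size p) (size q).
rewrite (nrm_widen r (size_polyD p q)) -/n.
rewrite (@nrm_widen n r p) ?leq_maxl // (@nrm_widen n r q) ?leq_maxr //.
rewrite -big_split; apply: ler_sum => i _; rewrite coefD /= -mulrDl.
by rewrite ler_wpM2r ?exprn_ge0 ?ler_normD.
Qed.

Lemma nrmN r p : nrm r (- p) = nrm r p.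
Proof. by rewrite /nrm size_polyN; apply: eq_bigr => i _; rewrite coefN normrN. Qed.

Lemma nrmB r p q : 0 <= r -> nrm r (p - q) <= nrm r p + nrm r q.
Proof. by move=> r0; rewrite -(nrmN r q) nrmD. Qed.

Lemma nrm_dist r p q : nrm r (p - q) = nrm r (q - p).
Proof. by rewrite -opprB nrmN. Qed.

Lemma nrmZ r c p : nrm r (c *: p) = `|c| * nrm r p.
Proof.
rewrite (nrm_widen r (size_scale_leq c p)) /nrm mulr_sumr.
by apply: eq_bigr => i _; rewrite coefZ normrM mulrA.
Qed.

Lemma nrmC r c : nrm r c%:P = `|c|.
Proof.
by rewrite (@nrm_widen 1%N) ?size_polyC_leq1 // big_ord1 coefC mulr1.
Qed.

Lemma nrm1 r : nrm r 1 = 1.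
Proof. by rewrite -[1]/(1%:P) nrmC normr1. Qed.

Lemma nrmXM r p : nrm r ('X * p) = r * nrm r p.
Proof.
have le : (size ('X * p)%R <= (size p).+1)%N.
  by rewrite mulrC; have [->|p0] := eqVneq p 0;
    rewrite ?mul0r ?size_poly0 ?size_mulX.
rewrite (nrm_widen r le) big_ord_recl coefXM /= normr0 mul0r add0r mulr_sumr.
by apply: eq_bigr => i _; rewrite coefXM /= exprS mulrCA.
Qed.

Lemma nrmX r : nrm r 'X = r.
Proof. by rewrite -['X]mulr1 nrmXM nrm1 mulr1. Qed.

Lemma nrmM r p q : 0 <= r -> nrm r (p * q) <= nrm r p * nrm r q.
Proof.
move=> r0; elim/poly_ind: p => [|p c IH]; first by rewrite mul0r nrm0 mul0r.
have -> : nrm r (p * 'X + c%:P) = nrm r p * r + `|c|.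
  have le : (size (p * 'X + c%:P)%R <= (size p).+1)%N.
    by rewrite size_MXaddC; case: ifP.
  rewrite (nrm_widen r le) big_ord_recl mulr1 coefD coefMX coefC /= add0r addrC.
  congr (_ + _); rewrite mulr_suml; apply: eq_bigr => i _.
  by rewrite coefD coefMX coefC /= addr0 exprSr mulrA.
rewrite mulrDl; apply: le_trans (nrmD _ _ r0) _.
rewrite mul_polyC nrmZ mulrDl lerD2r -mulrA mulrCA nrmXM mulrAC [leRHS]mulrC.
by rewrite ler_wpM2l.
Qed.

Lemma nrmXn r p n : 0 <= r -> nrm r (p ^+ n) <= nrm r p ^+ n.
Proof.
move=> r0; elim: n => [|n IH]; first by rewrite nrm1.
rewrite !exprS; apply: le_trans (nrmM _ _ r0) _.
by rewrite ler_wpM2l ?nrm_ge0.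
Qed.

Lemma nrm_sum r (I : Type) (s : seq I) (P : pred I) (F : I -> {poly R}) :
  0 <= r -> nrm r (\sum_(i <- s | P i) F i) <= \sum_(i <- s | P i) nrm r (F i).
Proof.
move=> r0; apply: (big_ind2 (fun p (c : R) => nrm r p <= c)) => //.
  by rewrite nrm0.
by move=> p c q d pc qd; apply: le_trans (nrmD _ _ r0) _; rewrite lerD.
Qed.

Lemma nrm_le r1 r2 p : 0 <= r1 -> r1 <= r2 -> nrm r1 p <= nrm r2 p.
Proof.
move=> r0 r12; apply: ler_sum => i _.
by rewrite ler_wpM2l ?lerXn2r ?nnegrE // (le_trans r0).
Qed.

Lemma horner_nrm r p t : `|t| <= r -> `|p.[t]| <= nrm r p.
Proof.
move=> tr; rewrite horner_coef; apply: le_trans (ler_norm_sum _ _ _) _.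
apply: ler_sum => i _; rewrite normrM normrX ler_wpM2l //.
by rewrite lerXn2r ?nnegrE // (le_trans _ tr).
Qed.

Lemma horner_sum_poly (I : Type) (s : seq I) (P : pred I) (F : I -> {poly R}) t :
  (\sum_(i <- s | P i) F i).[t] = \sum_(i <- s | P i) (F i).[t].
Proof. exact: (raddf_sum (horner_eval t)). Qed.

(* Bernoulli: [i r^(i-1) <= (r+1)^i]. *)
Lemma nrm_deriv r p : 0 <= r -> nrm r p^`() <= nrm (r + 1) p.
Proof.
move=> r0; case: (posnP (size p)) => [/eqP|p0].
  by rewrite size_poly_eq0 => /eqP ->; rewrite deriv0 !nrm0.
have le : (size p^`() <= (size p).-1)%N by rewrite size_poly.
rewrite (nrm_widen r le) /nrm.
case: (size p) p0 {le} => // n _; rewrite [leRHS]big_ord_recl ler_wpDl ?mulr_ge0 //.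
apply: ler_sum => i _; rewrite coef_deriv lift0 /=.
rewrite -mulr_natr normrM -mulrA ler_wpM2l // ger0_norm //.
elim: (i : nat) => [|k IH]; first by rewrite !expr0 expr1; lra.
have rk : 0 <= r ^+ k.+1 by exact: exprn_ge0.
rewrite [r ^+ k.+1]exprS [leRHS]exprS mulrCA.
have -> : k.+2%:R = k.+1%:R + 1 :> R by rewrite -natr1.
have h1 : r * (k.+1%:R * r ^+ k) <= r * (r + 1) ^+ k.+1 by rewrite ler_wpM2l.
have h2 : r ^+ k.+1 <= (r + 1) ^+ k.+1.
  by rewrite lerXn2r ?nnegrE; lra.
rewrite exprS in h2; nra.
Qed.

(** The coefficient of index 0 is a quotient by 0, hence 0: this is the primitive that vanishes at
    0. *)
Definition prim p : {poly R} := \poly_(i < (size p).+1) (p`_i.-1 / i%:R).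

Lemma prim_widen n p i : (i <= n)%N -> (prim p)`_i = p`_i.-1 / i%:R.
Proof.
move=> _; rewrite coef_poly; case: ltnP => // h.
by rewrite nth_default ?mul0r // -ltnS (leq_trans h) //; case: i h.
Qed.

Lemma deriv_prim p : (prim p)^`() = p.
Proof.
apply/polyP => i; rewrite coef_deriv (@prim_widen i.+1) //=.
by rewrite -[LHS]mulr_natr mulfVK // pnatr_eq0.
Qed.

Lemma prim_at0 p : (prim p).[0] = 0.
Proof. by rewrite horner_coef0 (@prim_widen 0) // invr0 mulr0. Qed.

Lemma nrm_prim r p : 0 <= r -> nrm r (prim p) <= r * nrm r p.
Proof.
move=> r0; have le : (size (prim p) <= (size p).+1)%N by exact: size_poly.
rewrite (nrm_widen r le) big_ord_recl (@prim_widen 0) // invr0 mulr0 normr0.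
rewrite mul0r add0r /nrm mulr_sumr; apply: ler_sum => i _.
rewrite (@prim_widen (lift ord0 i)) // lift0 /= normrM exprS mulrCA.
rewrite ler_wpM2l // ler_wpM2r ?exprn_ge0 // ler_piMr //.
by rewrite normfV ger0_norm // invf_le1 ?ltr0n // ler1n.
Qed.

Lemma deriv_eq0 p : p^`() = 0 -> p = (p.[0])%:P.
Proof.
move=> p'0; apply/polyP => -[|i]; rewrite coefC /= ?horner_coef0 //.
have /polyP/(_ i) := p'0; rewrite coef_deriv coef0 => /eqP.
by rewrite mulrn_eq0 /= => /eqP.
Qed.

Lemma deriv_inj0 p q : p^`() = q^`() -> p.[0] = q.[0] -> p = q.
Proof.
move=> h h0; apply/eqP; rewrite -subr_eq0; apply/eqP.
by rewrite [LHS]deriv_eq0 ?derivB ?h ?subrr // hornerD hornerN h0 subrr.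
Qed.

Lemma primB p q : prim (p - q) = prim p - prim q.
Proof.
apply: deriv_inj0; first by rewrite derivB !deriv_prim.
by rewrite hornerD hornerN !prim_at0 subr0.
Qed.

Lemma poly_MVT p u v :
  exists2 c, Num.min u v <= c <= Num.max u v & p.[v] - p.[u] = p^`().[c] * (v - u).
Proof.
wlog uv : u v / u <= v => [H|].
  have [uv|/ltW uv] := leP u v; first by have [c] := H _ _ uv; rewrite !(min_l, max_r) //; exists c.
  have [c] := H _ _ uv; rewrite min_l // max_r // => hc e; exists c => //.
  by rewrite -opprB e -mulrN opprB.
rewrite min_l // max_r //; have [->|ne] := eqVneq u v.
  by exists v; rewrite ?lexx // !subrr mulr0.
have lt : u < v by rewrite lt_neqAle ne.
have [c hc e] := polyrcf.poly_mvt p lt.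
exists c => //; move: hc; rewrite in_itv /= => /andP[/ltW -> /ltW ->] //.
Qed.

Lemma poly_lip p u v K :
  (forall c, Num.min u v <= c <= Num.max u v -> `|p^`().[c]| <= K) ->
  `|p.[v] - p.[u]| <= K * `|v - u|.
Proof.
by move=> h; have [c hc ->] := poly_MVT p u v; rewrite normrM ler_wpM2r ?h.
Qed.

Lemma poly_incr_ge p u v K : u <= v ->
  (forall c, u <= c <= v -> K <= p^`().[c]) -> K * (v - u) <= p.[v] - p.[u].
Proof.
move=> uv h; have [c] := poly_MVT p u v; rewrite min_l // max_r // => hc ->.
by rewrite ler_wpM2r ?subr_ge0 ?h.
Qed.

Lemma poly_lip_nrm r p u v : `|u| <= r -> `|v| <= r ->
  `|p.[v] - p.[u]| <= nrm r p^`() * `|v - u|.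
Proof.
move=> ur vr; apply: poly_lip => c hc; apply: horner_nrm.
move: ur vr hc; rewrite !ler_norml /Order.min /Order.max.
by case: ifP => _; lra.
Qed.

(** Subtract the tangent at t and use the Lipschitz bound twice. The constant depends on p only
    through [nrm r] of its second derivative, so the estimate passes to limits. *)
Lemma poly_taylor2 r p t h : `|t| <= r -> `|t + h| <= r ->
  `|p.[t + h] - p.[t] - h * p^`().[t]| <= nrm r p^`()^`() * h ^+ 2.
Proof.
move=> tr thr; pose q := p - p^`().[t] *: 'X.
have -> : p.[t + h] - p.[t] - h * p^`().[t] = q.[t + h] - q.[t].
  by rewrite /q !hornerE; ring.
have K0 : 0 <= nrm r p^`()^`() by rewrite nrm_ge0 // (le_trans _ tr).
have -> : h ^+ 2 = `|h| * `|h| by rewrite -normrM -expr2 ger0_norm ?sqr_ge0.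
rewrite mulrA; have -> : `|h| = `|t + h - t| :> R by rewrite addrC addKr.
apply: poly_lip => c hc.
rewrite /q derivB derivZ derivX hornerD hornerN hornerZ hornerC mulr1.
have cr : `|c| <= r.
  by move: tr thr hc; rewrite !ler_norml /Order.min /Order.max; case: ifP => _; lra.
apply: le_trans (poly_lip_nrm _ tr cr) _; rewrite ler_wpM2l //.
move: hc; rewrite /Order.min /Order.max; case: ltP => ht hc.
  by rewrite !ger0_norm; lra.
by rewrite !ler0_norm; lra.
Qed.

(** Expanding at c costs the radius an amount |c|; this gives analyticity of an entire limit at
    every real point. *)
Lemma nrm_shift r c p : 0 <= r -> nrm r (p \Po ('X + c%:P)) <= nrm (r + `|c|) p.
Proof.
move=> r0; rewrite comp_polyE; apply: le_trans (nrm_sum _ _ _ r0) _.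
apply: ler_sum => i _; rewrite nrmZ ler_wpM2l //.
apply: le_trans (nrmXn _ _ r0) _; rewrite lerXn2r ?nnegrE ?nrm_ge0 ?addr_ge0 //.
by apply: le_trans (nrmD _ _ r0) _; rewrite nrmX nrmC.
Qed.

End PolyNorm.

(** * Polynomials that imitate cutoff functions *)

Section CutoffPolynomials.
Context (R : realType).
Implicit Types (r b t : R) (E : {poly R}).

Lemma small_expr (q e : R) : 0 <= q < 1 -> 0 < e -> exists n, q ^+ n <= e.
Proof.
move=> /andP[q0 q1] e0; have q1' : `|q| < 1 by rewrite ger0_norm.
have /cvgrPdist_le /(_ _ e0)[n _ /(_ n (leqnn n))] := cvg_expr q1'.
by rewrite /= sub0r normrN normrX ger0_norm // => h; exists n.
Qed.

(** In the regime where n u is small, 1 - (1 - u)^n is about n u; the factor 2 absorbs the higher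
    terms in the induction. *)
Lemma nrm_one_minus_pow r (u : {poly R}) n : 0 <= r ->
  2 * n%:R * nrm r u <= 1 -> nrm r (1 - (1 - u) ^+ n) <= 2 * n%:R * nrm r u.
Proof.
move=> r0; have a0 := nrm_ge0 u r0; elim: n => [|n IH] h.
  by rewrite expr0 subrr nrm0 mulr0 mul0r.
rewrite -natr1 in h *.
have {}IH := IH ltac:(nra).
have -> : 1 - (1 - u) ^+ n.+1 = (1 - (1 - u) ^+ n) * (1 - u) + u.
  by rewrite exprSr; ring.
apply: le_trans (nrmD _ _ r0) _.
have h1 := nrmM (1 - (1 - u) ^+ n) (1 - u) r0.
have h2 : nrm r (1 - u) <= 1 + nrm r u by rewrite -{1}(nrm1 r) nrmB.
have h3 := nrm_ge0 (1 - (1 - u) ^+ n) r0.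
have h4 := nrm_ge0 (1 - u) r0.
have h5 : nrm r (1 - (1 - u) ^+ n) * nrm r (1 - u) <=
  2 * n%:R * nrm r u * (1 + nrm r u) by exact: ler_pM.
nra.
Qed.

(** By induction, as (1 - v)(1 + (n + 1) v) <= 1 + n v. It makes (1 - v)^n small as soon as n v is
    large. *)
Lemma one_minus_pow_le (v : R) n : 0 <= v <= 1 -> (1 - v) ^+ n * (1 + n%:R * v) <= 1.
Proof.
move=> /andP[v0 v1]; elim: n => [|n IH]; first by rewrite expr0; lra.
apply: le_trans IH; rewrite exprSr -mulrA ler_wpM2l ?exprn_ge0 ?subr_ge0 //.
rewrite -natr1; have : 0 <= n%:R :> R by []. nra.
Qed.

(* The polynomial is [1 - (1 - (X / b) ^ 2M) ^ N], with [N] of the order of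
   [(b / t) ^ 2M] for some [t] between [r] and [rho]. *)
Lemma step_poly r rho b e : 0 < r -> r < rho -> rho <= b -> 0 < e ->
  exists E : {poly R}, [/\ nrm r E <= e,
    forall t, `|t| <= b -> 0 <= E.[t] <= 1,
    forall t, rho <= `|t| -> `|t| <= b -> 1 - e <= E.[t] &
    E \Po (- 'X) = E].
Proof.
move=> r0 rrho rhob e0; pose s := (r + rho) / 2.
have s0 : 0 < s by rewrite /s; lra.
have rs : r < s by rewrite /s; lra.
have srho : s < rho by rewrite /s; lra.
have b0 : 0 < b by lra.
pose e' := Num.min (e / 4) (1 / 4).
have e'0 : 0 < e' by rewrite lt_min; apply/andP; split; lra.
have [e'e e'1] : e' <= e / 4 /\ e' <= 1 / 4 by split; rewrite ge_min lexx ?orbT.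
have [M1 hM1] : exists n, (r / s) ^+ n <= e'.
  by apply: small_expr => //; rewrite divr_ge0 ?ltW //= ltr_pdivrMr // mul1r.
have [M2 hM2] : exists n, (s / rho) ^+ n <= e'.
  apply: small_expr => //; rewrite divr_ge0 ?ltW //= ?ltr_pdivrMr ?mul1r //; lra.
pose M := (M1 + M2)%N.
have low q n k : 0 <= q -> q <= 1 -> (n <= k)%N -> q ^+ n <= e' -> q ^+ k <= e'.
  by move=> q0 q1 nk; apply: le_trans; rewrite ler_wiXn2l.
have rho0 : 0 < rho by lra.
have {}hM1 : (r / s) ^+ (2 * M) <= e'.
  apply: (low (r / s) M1) => //; first by rewrite divr_ge0 ?ltW.
    by rewrite ler_pdivrMr // mul1r ltW.
  by rewrite mul2n -addnn /M -!addnA leq_addr.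
have {}hM2 : (s / rho) ^+ (2 * M) <= e'.
  apply: (low (s / rho) M2) => //; first by rewrite divr_ge0 ?ltW.
    by rewrite ler_pdivrMr // mul1r ltW.
  by rewrite mul2n -addnn /M -addnA addnC -!addnA leq_addr.
set K := (2 * M)%N in hM1 hM2.
have B1 : 1 <= (b / s) ^+ K by rewrite exprn_ege1 // ler_pdivlMr // mul1r; lra.
(* With u = (t / b)^K, the product N u is at most 2 (r / s)^K <= 2 e' on the disc of radius r, and
   at least (rho / s)^K >= 1 / e' where |t| >= rho. *)
pose N := (Num.truncn ((b / s) ^+ K)).+1.
have /andP[N1 N2] : ((b / s) ^+ K <= N%:R) && (N%:R <= 2 * (b / s) ^+ K).
  have /Num.Theory.truncn_itv/andP[h1 h2] : 0 <= (b / s) ^+ K by lra.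
  by rewrite /N (ltW h2) -natr1; lra.
pose u : {poly R} := (b^-1 *: 'X) ^+ K.
have ut t : u.[t] = (t / b) ^+ K by rewrite /u horner_exp hornerZ hornerX mulrC.
have nu : nrm r u <= (r / b) ^+ K.
  apply: le_trans (nrmXn _ _ (ltW r0)) _.
  by rewrite nrmZ nrmX ger0_norm ?invr_ge0 ?(ltW b0) // (mulrC _ r).
have nu0 := nrm_ge0 u (ltW r0).
have Na : 2 * N%:R * nrm r u <= 4 * e'.
  have h : N%:R * nrm r u <= 2 * (b / s) ^+ K * (r / b) ^+ K.
    by apply: ler_pM => //; lra.
  have e1 : (b / s) ^+ K * (r / b) ^+ K = (r / s) ^+ K.
    rewrite -exprMn; congr (_ ^+ _); field.
    by rewrite !gt_eqF.
  rewrite -mulrA e1 in h; rewrite -mulrA; lra.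
have absK t : t ^+ K = `|t| ^+ K :> R.
  by rewrite /K !exprM; congr (_ ^+ _); rewrite real_normK ?num_real.
have u01 t : `|t| <= b -> 0 <= (t / b) ^+ K <= 1.
  move=> tb; rewrite absK exprn_ge0 //= exprn_ile1 // normrM normfV (gtr0_norm b0).
  by rewrite ler_pdivrMr // mul1r.
have Et t : (1 - (1 - u) ^+ N).[t] = 1 - (1 - (t / b) ^+ K) ^+ N.
  by rewrite hornerD hornerN horner_exp hornerD hornerN ut !hornerC.
exists (1 - (1 - u) ^+ N); split.
- by apply: le_trans (nrm_one_minus_pow (ltW r0) _) _; lra.
- move=> t /u01 /andP[v0 v1]; rewrite Et.
  set v := _ ^+ K in v0 v1 *.
  have h0 : 0 <= (1 - v) ^+ N by rewrite exprn_ge0; lra.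
  have h1 : (1 - v) ^+ N <= 1 by rewrite exprn_ile1 ?subr_ge0 // lerBlDr lerDl.
  by apply/andP; split; lra.
- move=> t rt tb; have /andP[v0 v1] := u01 t tb.
  rewrite Et.
  have vge : (rho / b) ^+ K <= (t / b) ^+ K.
    rewrite (absK (t / b)) lerXn2r ?nnegrE ?divr_ge0 ?(ltW rho0) ?(ltW b0) // normrM normfV (gtr0_norm b0).
    by rewrite ler_wpM2r // invr_ge0 ltW.
  set v := (t / b) ^+ K in v0 v1 vge *.
  have v01 : 0 <= v <= 1 by rewrite v0.
  have := one_minus_pow_le N v01.
  set w := _ ^+ N => hw.
  have w0 : 0 <= w by rewrite exprn_ge0 // subr_ge0.
  have e1 : (b / s) ^+ K * (rho / b) ^+ K * (s / rho) ^+ K = 1.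
    rewrite -!exprMn; have -> : b / s * (rho / b) * (s / rho) = 1.
      by field; rewrite !gt_eqF.
    by rewrite expr1n.
  have h2 : (b / s) ^+ K * (rho / b) ^+ K <= N%:R * v.
    by apply: ler_pM => //; apply: exprn_ge0; apply: divr_ge0; apply: ltW.
  set Z := (b / s) ^+ K * (rho / b) ^+ K in e1 h2.
  set y := (s / rho) ^+ K in hM2 e1.
  have y0 : 0 < y by apply: exprn_gt0; apply: divr_gt0.
  have wZ : w * Z <= 1 by apply: le_trans hw; rewrite ler_wpM2l //; lra.
  have : w <= y by rewrite -[w]mulr1 -e1 mulrA ler_piMl // ltW.
  lra.
- rewrite !(comp_polyB, comp_polyC, rmorphXn) /= comp_polyB comp_polyC.
  rewrite /u rmorphXn /= comp_polyZ comp_polyX scalerN.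
  by rewrite /K [in X in 1 - (1 - X) ^+ _]exprM sqrrN -exprM.
Qed.

(** A normalised power of t + b: this quantity reaches 2b at b but is at most b - r on [-b, -r], so
    a high power is negligible there. Used as the parameter of a motion, it steers the right end
    while the left end stands still. *)
Lemma pivot_poly r b e : 0 < r -> r < b -> 0 < e ->
  exists l : {poly R}, [/\ l.[r] = 0, l.[b] = 1,
    forall t, r <= t <= b -> 0 <= l.[t] <= 1 &
    forall t, - b <= t <= - r -> `|l.[t] - l.[- r]| <= e].
Proof.
move=> r0 rb e0; have b0 : 0 < b by lra.
pose q := (b + r) / (2 * b).
have q0 : 0 <= q by rewrite /q divr_ge0; lra.
have q1 : q < 1 by rewrite /q ltr_pdivrMr; lra.
have [K hK] : exists n, q ^+ n <= Num.min (1 / 2) (e / 2).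
  by apply: small_expr; rewrite ?q0 // lt_min; apply/andP; split; lra.
have [K1 K2] : q ^+ K <= 1 / 2 /\ q ^+ K <= e / 2.
  by move: hK; rewrite le_min => /andP.
have Q0 : 0 < (2 * b) ^+ K by rewrite exprn_gt0; lra.
have eq1 : (b + r) ^+ K = q ^+ K * (2 * b) ^+ K.
  by rewrite -exprMn; congr (_ ^+ _); rewrite /q; field; lra.
pose D := (2 * b) ^+ K - (b + r) ^+ K.
have D0 : (2 * b) ^+ K / 2 <= D by rewrite /D eq1; nra.
have D1 : 0 < D by lra.
pose l : {poly R} := D^-1 *: (('X + b%:P) ^+ K - ((b + r) ^+ K)%:P).
have lE t : l.[t] = ((t + b) ^+ K - (b + r) ^+ K) / D.
  by rewrite /l !hornerE mulrC.
exists l; split.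
- by rewrite lE (addrC r) subrr mul0r.
- by rewrite lE -mulr2n -mulr_natl divff // gt_eqF.
- move=> t /andP[rt tb]; rewrite lE divr_ge0 ?(ltW D1) //=; last first.
    by rewrite subr_ge0 lerXn2r ?nnegrE; lra.
  rewrite ler_pdivrMr // mul1r /D lerD2r lerXn2r ?nnegrE; lra.
- move=> t /andP[bt tr]; rewrite !lE -mulrBl opprB addrA subrK normrM normfV.
  rewrite (gtr0_norm D1) ler_pdivrMr //.
  have h1 : 0 <= (t + b) ^+ K by rewrite exprn_ge0; lra.
  have h2 : (t + b) ^+ K <= (- r + b) ^+ K by rewrite lerXn2r ?nnegrE; lra.
  have h3 : (- r + b) ^+ K <= (b + r) ^+ K by rewrite lerXn2r ?nnegrE; lra.
  rewrite distrC ger0_norm; last lra.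
  rewrite eq1 in h3; nra.
Qed.

End CutoffPolynomials.

(** * Transversality by pigeonhole *)

Section Transversality.
Context (R : realType).

(* Pigeonhole: a grid of N^3 parameters against M^2 boxes for the pair (t1, t2),
   with M proportional to N. *)
Lemma transversality (F : ('I_3 -> R) -> R -> R -> 'I_3 -> R)
    (d L u1 v1 u2 v2 : R) :
  0 < d -> 0 < L ->
  (forall c t1 t2 t1' t2' i, (forall j, 0 <= c j <= d) ->
     u1 <= t1 <= v1 -> u2 <= t2 <= v2 -> u1 <= t1' <= v1 -> u2 <= t2' <= v2 ->
     `|F c t1 t2 i - F c t1' t2' i| <= L * (`|t1 - t1'| + `|t2 - t2'|)) ->
  (forall c c' t1 t2 e, (forall j, 0 <= c j <= d) -> (forall j, 0 <= c' j <= d) ->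
     u1 <= t1 <= v1 -> u2 <= t2 <= v2 -> 0 <= e ->
     (forall i, `|F c t1 t2 i - F c' t1 t2 i| <= e) ->
     forall i, `|c i - c' i| <= L * e) ->
  exists c, (forall j, 0 <= c j <= d) /\
    exists2 e, 0 < e & forall t1 t2, u1 <= t1 <= v1 -> u2 <= t2 <= v2 ->
      exists i, e <= `|F c t1 t2 i|.
Proof.
move=> d0 L0 lip exp.
pose l := `|v1 - u1| + `|v2 - u2| + 1.
have l0 : 0 < l by rewrite /l ltr_wpDl ?addr_ge0.
pose k := (Num.truncn (4 * L ^+ 2 * l / d)).+1.
have L20 : 0 < L ^+ 2 by rewrite exprn_gt0.
have hk : 4 * L ^+ 2 * l < k%:R * d.
  rewrite -ltr_pdivrMr //.
  have /Num.Theory.truncn_itv/andP[] // : 0 <= 4 * L ^+ 2 * l / d.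
  by apply/ltW; rewrite divr_gt0 // !mulr_gt0.
(* Since M = k N, the inequality N^3 > M^2 needed for a collision is N > k^2. *)
pose N' := (k ^ 2)%N; pose N := N'.+1; pose M' := (k * N).-1; pose M := M'.+1.
have ME : M = (k * N)%N by rewrite /M prednK // muln_gt0.
have N0 : 0 < N%:R :> R by rewrite ltr0n.
have k0 : 0 < k%:R :> R by rewrite ltr0n.
have MR : M%:R = k%:R * N%:R :> R by rewrite ME natrM.
have M0 : 0 < M%:R :> R by rewrite MR mulr_gt0.
(* Two parameters sharing a box have values of F within 2 e + 2 L l / M of each other. After
   expansion by L this is d / (4 N) + 2 L^2 l / (k N), less than the mesh d / N of the grid by the
   choice of k. *)
pose e := d / (8 * L * N%:R).
have e0 : 0 < e by rewrite /e divr_gt0 // !mulr_gt0.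
pose cg (g : {ffun 'I_3 -> 'I_N}) (i : 'I_3) := d * (g i)%:R / N%:R.
have cgP g j : 0 <= cg g j <= d.
  rewrite divr_ge0 ?mulr_ge0 ?(ltW d0) //= ler_pdivrMr // ler_wpM2l ?(ltW d0) //.
  by rewrite ler_nat ltnW.
apply: contrapT => nex.
have bad g : exists t : R * R, [/\ u1 <= t.1 <= v1, u2 <= t.2 <= v2 &
    forall i, `|F (cg g) t.1 t.2 i| < e].
  apply: contrapT => nt; apply: nex; exists (cg g); split=> //.
  exists e => // t1 t2 h1 h2; apply: contrapT => ni; apply: nt.
  exists (t1, t2); split=> // i; rewrite ltNge; apply/negP => hi.
  by apply: ni; exists i.
have {bad}[T TP] := choice bad.
pose box (u t : R) : 'I_M := inord (Num.truncn ((t - u) * M%:R / l)).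
have boxP u v t t' : v - u < l -> u <= t <= v -> u <= t' <= v ->
    box u t = box u t' -> `|t - t'| <= l / M%:R.
  move=> vl /andP[h1 h2] /andP[h3 h4] /(congr1 val) /=.
  have pos s : u <= s -> 0 <= (s - u) * M%:R / l.
    by move=> us; rewrite divr_ge0 ?mulr_ge0 ?(ltW l0) // subr_ge0.
  have lt s : u <= s -> s <= v -> (Num.truncn ((s - u) * M%:R / l) < M)%N.
    move=> us sv; have /Num.Theory.truncn_itv/andP[ha _] := pos s us.
    rewrite -(ltr_nat R); apply: le_lt_trans ha _.
    by rewrite ltr_pdivrMr // mulrC ltr_pM2l //; lra.
  rewrite !inordK ?lt // => eqt.
  have /Num.Theory.truncn_itv/andP[a1 a2] := pos _ h1.
  have /Num.Theory.truncn_itv/andP[b1 b2] := pos _ h3.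
  rewrite eqt -natr1 in a1 a2; rewrite -natr1 in b2.
  rewrite ler_pdivlMr // mulrC.
  set n := (Num.truncn _)%:R in a1 a2 b1 b2.
  rewrite !(ler_pdivlMr, ltr_pdivrMr) // in a1 a2 b1 b2.
  have : - l <= M%:R * (t - t') <= l.
    by move: a1 a2 b1 b2; clear; move=> a1 a2 b1 b2; apply/andP; split; lra.
  by rewrite -ler_norml normrM (gtr0_norm M0).
pose B (g : {ffun 'I_3 -> 'I_N}) : 'I_M * 'I_M := (box u1 (T g).1, box u2 (T g).2).
have : ~ injective B.
  move/leq_card; rewrite card_prod card_ffun !card_ord ME leqNgt => /negP; apply.
  by rewrite mulnACA -[(N ^ 3)%N]/(N * (N * N))%N ltn_pmul2r.
apply=> g g' eqB; apply/eqP/negPn/negP => ne.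
have [i /eqP nei] : exists i, g i <> g' i.
  apply: contrapT => h; case/negP: ne; apply/eqP/ffunP => i.
  by apply: contrapT => hi; apply: h; exists i.
have [a1 a2 a3] := TP g; have [b1 b2 b3] := TP g'.
have vl1 : v1 - u1 < l.
  by apply: le_lt_trans (ler_norm _) _; rewrite /l -addrA ltrDl ltr_wpDl.
have vl2 : v2 - u2 < l.
  by apply: le_lt_trans (ler_norm _) _; rewrite /l addrAC addrC ltrDl ltr_wpDl.
have [eqB1 eqB2] : box u1 (T g).1 = box u1 (T g').1 /\ box u2 (T g).2 = box u2 (T g').2.
  by case: eqB.
have c1 := boxP _ _ _ _ vl1 a1 b1 eqB1.
have c2 := boxP _ _ _ _ vl2 a2 b2 eqB2.
pose E := 2 * e + L * (2 * (l / M%:R)).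
have E0 : 0 <= E.
  have h : 0 < l / M%:R by rewrite divr_gt0.
  by apply/ltW; rewrite /E; apply: addr_gt0; do ?[apply: mulr_gt0 => //].
have := exp (cg g) (cg g') (T g).1 (T g).2 E (cgP g) (cgP g') a1 a2 E0.
move=> /(_ _ i) h.
have {h} : `|cg g i - cg g' i| <= L * E.
  apply: h => j.
  have h := lip (cg g') _ _ _ _ j (cgP g') a1 a2 b1 b2.
  have h' : L * (`|(T g).1 - (T g').1| + `|(T g).2 - (T g').2|)
            <= L * (2 * (l / M%:R)).
    by rewrite ler_wpM2l ?(ltW L0) //; move: c1 c2; clear; lra.
  have := a3 j; have := b3 j; move: (le_trans h h').
  rewrite /E ler_norml !ltr_norml ler_norml => /andP[p1 p2] /andP[p3 p4] /andP[p5 p6].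
  by move: p1 p2 p3 p4 p5 p6; clear; move=> p1 p2 p3 p4 p5 p6; apply/andP; split; lra.
apply/negP; rewrite -ltNge.
have big : d / N%:R <= `|cg g i - cg g' i|.
  rewrite /cg -mulrBl -mulrBr normrM (normrM d) (gtr0_norm d0).
  rewrite normfV (gtr0_norm N0) ler_pM2r ?invr_gt0 // ler_peMr ?(ltW d0) //.
  move: nei; rewrite -val_eqE /= neq_ltn => /orP[] lt.
    by rewrite distrC -natrB ?(ltnW lt) // normr_nat ler1n subn_gt0.
  by rewrite -natrB ?(ltnW lt) // normr_nat ler1n subn_gt0.
apply: lt_le_trans big; rewrite ltr_pdivlMr //.
have -> : L * E * N%:R = d / 4 + 2 * L ^+ 2 * l / k%:R.
  by rewrite /E MR /e; field; rewrite !gt_eqF.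
have : 2 * L ^+ 2 * l / k%:R < d / 2.
  by rewrite ltr_pdivrMr //; move: hk; clear; lra.
by move: d0; clear; lra.
Qed.

End Transversality.

(** * Polynomial Legendrian curves and the effect of a switch of velocity *)

Section HeisenbergCurves.
Context (R : realType) (m : nat).

Definition heis : Type := ('rV[R]_m * 'rV[R]_m * R)%type.

Implicit Types (A B z : heis) (a b : 'rV[R]_m) (r t e : R).

Definition nearH e A B := [/\ forall j, `|A.1.1 0 j - B.1.1 0 j| <= e,
  forall j, `|A.1.2 0 j - B.1.2 0 j| <= e & `|A.2 - B.2| <= e].

Lemma nearHC e A B : nearH e A B -> nearH e B A.
Proof. by case=> h1 h2 h3; split=> [j|j|]; rewrite distrC. Qed.

Lemma nearH_trans e1 e2 A B z :
  nearH e1 A B -> nearH e2 B z -> nearH (e1 + e2) A z.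
Proof.
move=> [h1 h2 h3] [k1 k2 k3]; split=> [j|j|]; apply: le_trans (ler_distD _ _ _) _;
  apply: lerD; [exact: h1|exact: k1|exact: h2|exact: k2|exact: h3|exact: k3].
Qed.

Lemma nearH_le e1 e2 A B : e1 <= e2 -> nearH e1 A B -> nearH e2 A B.
Proof.
by move=> le [h1 h2 h3]; split=> [j|j|]; apply: le_trans le.
Qed.

Lemma nearH_refl e A : 0 <= e -> nearH e A A.
Proof. by move=> e0; split=> [j|j|]; rewrite subrr normr0. Qed.

Definition hdot a b : R := \sum_j a 0 j * b 0 j.

(* For [hdot a b = 0] this segment is tangent to the contact structure
   ds = y dx. *)
Definition hseg A a b t : heis :=
  (A.1.1 + t *: a, A.1.2 + t *: b, A.2 + t * hdot A.1.2 a).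

(** The coordinate s is stored only through its value at time 0 and recovered by integrating y dx,
    so that every [curve] is Legendrian by construction. *)
Record curve := Curve {
  cx : 'I_m -> {poly R}; cy : 'I_m -> {poly R}; cs0 : R }.

Definition cs (P : curve) : {poly R} :=
  (cs0 P)%:P + prim (\sum_j cy P j * (cx P j)^`()).

Definition ev (P : curve) t : heis :=
  (\row_j (cx P j).[t], \row_j (cy P j).[t], (cs P).[t]).

Lemma deriv_cs P : (cs P)^`() = \sum_j cy P j * (cx P j)^`().
Proof. by rewrite /cs derivD derivC add0r deriv_prim. Qed.

Lemma cs_at0 P : (cs P).[0] = cs0 P.
Proof. by rewrite /cs hornerD hornerC prim_at0 addr0. Qed.

Definition near_curve r e (P Q : curve) := [/\ forall j, nrm r (cx P j - cx Q j) <= e,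
  forall j, nrm r (cy P j - cy Q j) <= e & nrm r (cs P - cs Q) <= e].

Lemma near_ev r e P Q t : near_curve r e P Q -> `|t| <= r ->
  nearH e (ev P t) (ev Q t).
Proof.
move=> [h1 h2 h3] tr; split=> [j|j|]; rewrite ?mxE /= -hornerN -hornerD;
  apply: le_trans (horner_nrm _ tr) _; [exact: h1|exact: h2|exact: h3].
Qed.

Lemma near_curve_trans r1 r2 e1 e2 P Q T : 0 <= r1 -> r1 <= r2 ->
  near_curve r1 e1 P Q -> near_curve r2 e2 Q T -> near_curve r1 (e1 + e2) P T.
Proof.
move=> r0 r12 [h1 h2 h3] [k1 k2 k3].
have H p q s : nrm r1 (p - q) <= e1 -> nrm r2 (q - s) <= e2 ->
    nrm r1 (p - s) <= e1 + e2.
  move=> h k; have -> : p - s = (p - q) + (q - s) by rewrite addrA subrK.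
  by apply: le_trans (nrmD _ _ r0) _; rewrite lerD // (le_trans (nrm_le _ r0 r12)).
by split=> [j|j|]; [exact: H (h1 j) (k1 j)|exact: H (h2 j) (k2 j)|exact: H h3 k3].
Qed.

Lemma near_curve_refl r e P : 0 <= e -> near_curve r e P P.
Proof. by move=> e0; split=> [j|j|]; rewrite subrr nrm0. Qed.

Lemma curve_cont P r e : 0 <= r -> 0 < e -> exists2 d, 0 < d & forall Q,
  cs0 Q = cs0 P -> (forall j, nrm r (cx Q j - cx P j) <= d) ->
  (forall j, nrm r ((cx Q j)^`() - (cx P j)^`()) <= d) ->
  (forall j, nrm r (cy Q j - cy P j) <= d) -> near_curve r e P Q.
Proof.
move=> r0 e0.
pose C := \sum_j (nrm r (cx P j)^`() + nrm r (cy P j) + 1).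
have C0 : 0 <= C by apply: sumr_ge0 => j _; rewrite !addr_ge0 ?nrm_ge0.
have rC0 : 0 < r * C + 1 by rewrite ltr_wpDl ?mulr_ge0.
exists (Num.min 1 (Num.min e (e / (r * C + 1)))).
  by rewrite !lt_min ltr01 e0 divr_gt0.
move=> Q eq0; set d := Num.min _ _ => hx hdx hy.
have d1 : d <= 1 by rewrite /d ge_min lexx.
have de : d <= e by rewrite /d !ge_min lexx ?orbT.
have dC : d <= e / (r * C + 1) by rewrite /d !ge_min lexx ?orbT.
have d0 : 0 < d by rewrite /d !lt_min ltr01 e0 divr_gt0.
split=> [j|j|]; first by rewrite nrm_dist (le_trans (hx j)).
  by rewrite nrm_dist (le_trans (hy j)).
rewrite nrm_dist /cs eq0 opprD addrACA subrr add0r -primB.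
apply: le_trans (nrm_prim _ r0) _; rewrite -sumrB.
have : nrm r (\sum_j (cy Q j * (cx Q j)^`() - cy P j * (cx P j)^`())) <= d * C.
  apply: le_trans (nrm_sum _ _ _ r0) _; rewrite mulr_sumr; apply: ler_sum => j _.
  have -> : cy Q j * (cx Q j)^`() - cy P j * (cx P j)^`() =
    (cy Q j - cy P j) * (cx P j)^`() + (cy P j * ((cx Q j)^`() - (cx P j)^`())
      + (cy Q j - cy P j) * ((cx Q j)^`() - (cx P j)^`())) by ring.
  apply: le_trans (nrmD _ _ r0) _; rewrite -[X in d * X]addrA [leRHS]mulrDr lerD //.
    by apply: le_trans (nrmM _ _ r0) _; rewrite ler_wpM2r ?nrm_ge0.
  apply: le_trans (nrmD _ _ r0) _; rewrite [leRHS]mulrDr lerD //.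
    by apply: le_trans (nrmM _ _ r0) _; rewrite mulrC ler_wpM2r ?nrm_ge0.
  apply: le_trans (nrmM _ _ r0) _.
  by rewrite ler_pM ?nrm_ge0 // (le_trans (hdx j)).
rewrite ler_pdivlMr // in dC.
have := C0; nra.
Qed.

(** Time reversal. Since y x' changes sign along with the direction of integration, [cs] is
    reflected too, with the same value at 0. The left end thus becomes a right end. *)
Definition refl (P : curve) :=
  Curve (fun j => cx P j \Po (- 'X)) (fun j => cy P j \Po (- 'X)) (cs0 P).

Lemma deriv_compN (p : {poly R}) : (p \Po (- 'X))^`() = - (p^`() \Po (- 'X)).
Proof. by rewrite deriv_comp derivN derivX mulrN1. Qed.

Lemma horner_compN (p : {poly R}) t : (p \Po (- 'X)).[t] = p.[- t].
Proof. by rewrite horner_comp hornerN hornerX. Qed.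

Lemma nrm_compN r (p : {poly R}) : nrm r (p \Po (- 'X)) = nrm r p.
Proof.
have -> : p \Po (- 'X) = \poly_(i < size p) ((-1) ^+ i * p`_i).
  rewrite comp_polyE poly_def; apply: eq_bigr => i _.
  rewrite [(- 'X) ^+ i]exprNn -[X in _ *: (X * _)]signr_odd -[X in (X * _) *: _]signr_odd.
  by case: odd; rewrite ?expr0 ?expr1 ?mul1r ?mulN1r ?scaleNr ?scalerN.
rewrite (nrm_widen r (size_poly _ _)); apply: eq_bigr => i _.
by rewrite coef_poly ltn_ord normrM normrX normrN1 expr1n mul1r.
Qed.

Lemma cs_refl P : cs (refl P) = cs P \Po (- 'X).
Proof.
apply: deriv_inj0; last by rewrite horner_compN oppr0 !cs_at0.
rewrite deriv_cs deriv_compN deriv_cs raddf_sum /= -sumrN; apply: eq_bigr => j _.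
by rewrite deriv_compN comp_polyM mulrN.
Qed.

Lemma ev_refl P t : ev (refl P) t = ev P (- t).
Proof.
rewrite /ev cs_refl horner_compN; congr (_, _, _);
  by apply/rowP => j; rewrite !mxE horner_compN.
Qed.

Lemma near_refl r e P Q : near_curve r e P Q -> near_curve r e (refl P) (refl Q).
Proof.
by move=> [h1 h2 h3]; split=> [j|j|]; rewrite ?cs_refl /= -comp_polyB nrm_compN.
Qed.

Lemma near_refl_r r e P Q : near_curve r e (refl P) Q -> near_curve r e P (refl Q).
Proof.
have K (p : {poly R}) : (p \Po - 'X) \Po - 'X = p.
  by rewrite -comp_polyA rmorphN /= comp_polyX opprK comp_polyXr.
move=> [h1 h2 h3]; split=> [j|j|]; rewrite ?cs_refl -nrm_compN comp_polyB K;
  [exact: h1|exact: h2|rewrite -cs_refl; exact: h3].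
Qed.

(** The derivative is not small during the transition, but the transition lasts only e; afterwards
    the derivative itself is of order e. Both contributions to f are therefore of order e. *)
Lemma two_piece (f : {poly R}) (r b e K : R) : 0 < e -> r + e <= b -> 0 <= K ->
  `|f.[r]| <= K * e ->
  (forall t, r <= t <= r + e -> `|f^`().[t]| <= K) ->
  (forall t, r + e <= t <= b -> `|f^`().[t]| <= K * e) ->
  forall t, r <= t <= b -> `|f.[t]| <= K * (2 + (b - r)) * e.
Proof.
move=> e0 reb K0 h0 h1 h2 t /andP[rt tb].
have Ke : 0 <= K * e by rewrite mulr_ge0 // ltW.
have short s : r <= s -> s <= r + e -> `|f.[s]| <= 2 * (K * e).
  move=> rs sre; have -> : f.[s] = (f.[s] - f.[r]) + f.[r] by rewrite subrK.
  apply: le_trans (ler_normD _ _) _.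
  have : `|f.[s] - f.[r]| <= K * `|s - r|.
    by apply: poly_lip => c; rewrite min_l // max_r // => /andP[? ?]; apply: h1; lra.
  rewrite (ger0_norm (_ : 0 <= s - r)); last lra.
  by nra.
have [tre|/ltW ret] := leP t (r + e).
  have := short t rt tre; have : 0 <= K * e * (b - r) by apply: mulr_ge0 => //; lra.
  by nra.
have hs : `|f.[r + e]| <= 2 * (K * e) by apply: short; lra.
have -> : f.[t] = (f.[t] - f.[r + e]) + f.[r + e] by rewrite subrK.
apply: le_trans (ler_normD _ _) _.
have : `|f.[t] - f.[r + e]| <= K * e * `|t - (r + e)|.
  by apply: poly_lip => c; rewrite min_l // max_r // => /andP[? ?]; apply: h2; lra.
rewrite (ger0_norm (_ : 0 <= t - (r + e))); last lra.
have : K * e * (t - (r + e)) <= K * e * (b - r) by rewrite ler_wpM2l //; lra.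
lra.
Qed.

(* The velocity [x' (1 - E) + E mu' a] of a curve switches, at time [r], from the
   old velocity to a motion along [hseg] with parameter [mu]. *)
Lemma switch_estimate (x y : 'I_m -> {poly R}) (s mu : {poly R}) a b (r rb : R) :
  0 < r -> r < rb -> hdot b a = 0 -> mu.[r] = 0 ->
  exists2 K, 0 < K & forall (x1 y1 : 'I_m -> {poly R}) (s1 E : {poly R}) e,
  0 < e -> e <= 1 -> r + e <= rb ->
  (forall t, r <= t <= rb -> 0 <= E.[t] <= 1) ->
  (forall t, r + e <= t <= rb -> 1 - e <= E.[t]) ->
  (forall j, (x1 j)^`() = (x j)^`() * (1 - E) + E * mu^`() * (a 0 j)%:P) ->
  (forall j, (y1 j)^`() = (y j)^`() * (1 - E) + E * mu^`() * (b 0 j)%:P) ->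
  s1^`() = \sum_j y1 j * (x1 j)^`() ->
  nearH e (\row_j (x j).[r], \row_j (y j).[r], s.[r])
    (\row_j (x1 j).[r], \row_j (y1 j).[r], s1.[r]) ->
  forall t, r <= t <= rb ->
  nearH (K * e) (hseg (\row_j (x j).[r], \row_j (y j).[r], s.[r]) a b mu.[t])
    (\row_j (x1 j).[t], \row_j (y1 j).[t], s1.[t]).
Proof.
move=> r0 rrb ab0 mur.
have rb0 : 0 <= rb by lra.
pose B := 1 + \sum_j (nrm rb (x j)^`() + nrm rb (y j)^`() + nrm rb (y j)
  + nrm rb mu^`() * `|a 0 j| + nrm rb mu^`() * `|b 0 j| + nrm rb mu * `|b 0 j|).
have pos j : 0 <= nrm rb (x j)^`() + nrm rb (y j)^`() + nrm rb (y j)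
  + nrm rb mu^`() * `|a 0 j| + nrm rb mu^`() * `|b 0 j| + nrm rb mu * `|b 0 j|.
  by rewrite !addr_ge0 ?mulr_ge0 ?nrm_ge0.
have Bj j : 1 + (nrm rb (x j)^`() + nrm rb (y j)^`() + nrm rb (y j)
  + nrm rb mu^`() * `|a 0 j| + nrm rb mu^`() * `|b 0 j| + nrm rb mu * `|b 0 j|) <= B.
  by rewrite /B lerD2l (bigD1 j) //= lerDl sumr_ge0.
have B1 : 1 <= B by rewrite /B lerDl sumr_ge0.
pose K1 := 2 * B * (2 + (rb - r)).
have K10 : 0 <= K1 by rewrite /K1 !mulr_ge0; lra.
pose K2 := m%:R * (2 * B * K1 + 4 * B ^+ 2) + 1.
have B20 : 0 <= B ^+ 2 by rewrite sqr_ge0.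
have B1K : 0 <= B * K1 by rewrite mulr_ge0 //; lra.
have M0 : 0 <= m%:R * (2 * B * K1 + 4 * B ^+ 2).
  by apply: mulr_ge0 => //; lra.
pose K3 := K2 * (2 + (rb - r)).
have K30 : 0 < K3 by apply: mulr_gt0; rewrite /K2; lra.
exists (K1 + K3); first by lra.
move=> x1 y1 s1 E e e0 e1 reb E01 E1 hx1 hy1 hs1 [start1 start2 start3].
have inr t : r <= t <= rb -> `|t| <= rb.
  by move=> /andP[rt tb]; rewrite ger0_norm // (le_trans (ltW r0)).
have wide t : r + e <= t <= rb -> r <= t <= rb.
  by move=> /andP[ret ->]; rewrite andbT (le_trans _ ret) // lerDl ltW.
have short t : r <= t <= r + e -> r <= t <= rb.
  by move=> /andP[-> tre]; rewrite (le_trans tre).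
have subE t : 0 <= E.[t] <= 1 -> 0 <= 1 - E.[t] by rewrite subr_ge0 => /andP[].
have side (p p1 : {poly R}) (c : R) : p1^`() = p^`() * (1 - E) + E * mu^`() * c%:P ->
    nrm rb p^`() + nrm rb mu^`() * `|c| <= B -> `|p.[r] - p1.[r]| <= e ->
    [/\ forall t, r <= t <= rb -> `|(p1 - mu * c%:P)^`().[t]| <= 2 * B,
     forall t, r + e <= t <= rb -> `|(p1 - mu * c%:P)^`().[t]| <= 2 * B * e &
     forall t, r <= t <= rb -> `|p1.[t] - (p.[r] + mu.[t] * c)| <= K1 * e].
  move=> hp hB hstart.
  (* The derivative of the deviation from the ideal motion is 1 - E times a bounded factor: bounded
     during the transition, of order e after it. *)
  have dE t : (p1 - mu * c%:P)^`().[t] = (1 - E.[t]) * (p^`().[t] - mu^`().[t] * c).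
    by rewrite derivB hp derivM derivC mulr0 addr0 !hornerE; ring.
  have bnd t : r <= t <= rb -> `|p^`().[t] - mu^`().[t] * c| <= B.
    move=> ht; apply: le_trans (ler_normB _ _) (le_trans _ hB); rewrite lerD //.
      exact/horner_nrm/inr.
    by rewrite normrM ler_wpM2r //; exact/horner_nrm/inr.
  have d1 t : r <= t <= rb -> `|(p1 - mu * c%:P)^`().[t]| <= 2 * B.
    move=> ht; have hE := E01 t ht; rewrite dE normrM ger0_norm ?subE //.
    have := bnd t ht; have := normr_ge0 (p^`().[t] - mu^`().[t] * c).
    by case/andP: hE; move: B1; clear; nra.
  have d2 t : r + e <= t <= rb -> `|(p1 - mu * c%:P)^`().[t]| <= 2 * B * e.
    move=> ht'; have ht := wide t ht'.
    rewrite dE normrM ger0_norm ?subE ?E01 //; have h := E1 t ht'.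
    apply: le_trans (_ : e * B <= _).
      by apply: ler_pM; rewrite ?subE ?E01 ?bnd // lerBlDr addrC -lerBlDr.
    have : 0 <= B * e by rewrite mulr_ge0 ?(ltW e0) // (le_trans ler01).
    by clear; lra.
  split=> // t ht.
  have tp := @two_piece (p1 - mu * c%:P - (p.[r])%:P) r rb e (2 * B) e0 reb.
  have -> : p1.[t] - (p.[r] + mu.[t] * c) = (p1 - mu * c%:P - (p.[r])%:P).[t].
    by rewrite !hornerE; ring.
  apply: tp => //; first by lra.
  - have -> : (p1 - mu * c%:P - (p.[r])%:P).[r] = p1.[r] - p.[r].
      by rewrite !hornerE mur; ring.
    rewrite distrC; apply: le_trans hstart _; rewrite ler_peMl ?(ltW e0) //.
    by move: B1; clear; lra.
  - by move=> u hu; rewrite derivB derivC subr0; exact/d1/short.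
  - by move=> u hu; rewrite derivB derivC subr0; apply: d2.
have nn (p : {poly R}) : 0 <= nrm rb p by rewrite nrm_ge0.
have pp p (c : R) : 0 <= nrm rb p * `|c| by rewrite mulr_ge0 ?nrm_ge0.
have sx j : [/\ forall t, r <= t <= rb -> `|(x1 j - mu * (a 0 j)%:P)^`().[t]| <= 2 * B,
     forall t, r + e <= t <= rb -> `|(x1 j - mu * (a 0 j)%:P)^`().[t]| <= 2 * B * e &
     forall t, r <= t <= rb -> `|(x1 j).[t] - ((x j).[r] + mu.[t] * a 0 j)| <= K1 * e].
  apply: side; [exact: hx1| |by have := start1 j; rewrite !mxE].
  have := Bj j; have := nn (y j)^`(); have := nn (y j); have := pp mu^`() (b 0 j).
  by have := pp mu (b 0 j); clear; lra.
have sy j : [/\ forall t, r <= t <= rb -> `|(y1 j - mu * (b 0 j)%:P)^`().[t]| <= 2 * B,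
     forall t, r + e <= t <= rb -> `|(y1 j - mu * (b 0 j)%:P)^`().[t]| <= 2 * B * e &
     forall t, r <= t <= rb -> `|(y1 j).[t] - ((y j).[r] + mu.[t] * b 0 j)| <= K1 * e].
  apply: side; [exact: hy1| |by have := start2 j; rewrite !mxE].
  have := Bj j; have := nn (x j)^`(); have := nn (y j); have := pp mu^`() (a 0 j).
  by have := pp mu (b 0 j); clear; lra.
pose k := \sum_j (y j).[r] * a 0 j.
pose f := s1 - mu * k%:P - (s.[r])%:P.
have f'E t : f^`().[t] = \sum_j (((y1 j).[t] - ((y j).[r] + mu.[t] * b 0 j)) * (x1 j)^`().[t]
    + ((y j).[r] + mu.[t] * b 0 j) * (x1 j - mu * (a 0 j)%:P)^`().[t]).
  rewrite /f derivB derivC subr0 derivB hs1 hornerD hornerN horner_sum_poly.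
  rewrite derivM derivC mulr0 addr0 hornerM hornerC.
  (* As b is orthogonal to a, moving y by mu b does not change y . a, so along the ideal segment s
     has the constant rate k with respect to mu. *)
  have -> : mu^`().[t] * k = \sum_j ((y j).[r] + mu.[t] * b 0 j) * (mu^`().[t] * a 0 j).
    have -> : \sum_j ((y j).[r] + mu.[t] * b 0 j) * (mu^`().[t] * a 0 j) =
        mu^`().[t] * k + mu.[t] * mu^`().[t] * hdot b a.
      by rewrite /k /hdot !mulr_sumr -big_split; apply: eq_bigr => j _ /=; ring.
    by rewrite ab0 mulr0 addr0.
  rewrite -sumrB; apply: eq_bigr => j _; rewrite derivB derivM derivC mulr0 addr0 !hornerE /=.
  by ring.
(* To be used with c = 1 during the transition and c = e after it. *)
have term j t c : r <= t <= rb -> `|(x1 j - mu * (a 0 j)%:P)^`().[t]| <= 2 * B * c ->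
    e <= c -> c <= 1 ->
    `|((y1 j).[t] - ((y j).[r] + mu.[t] * b 0 j)) * (x1 j)^`().[t]
    + ((y j).[r] + mu.[t] * b 0 j) * (x1 j - mu * (a 0 j)%:P)^`().[t]| <=
    (2 * B * K1 + 4 * B ^+ 2) * c.
  move=> ht h ec c1; have [_ _ /(_ t ht) hy] := sy j.
  have /andP[E0' E1'] := E01 t ht.
  have tb := inr t ht; have rrb' : `|r| <= rb by rewrite ger0_norm ltW.
  have hx' : `|(x1 j)^`().[t]| <= 2 * B.
    rewrite hx1 !hornerE; have h1 := horner_nrm (x j)^`() tb.
    have h2 : `|mu^`().[t] * a 0 j| <= nrm rb mu^`() * `|a 0 j|.
      by rewrite normrM ler_wpM2r //; exact/horner_nrm.
    have hB1 : nrm rb (x j)^`() + nrm rb mu^`() * `|a 0 j| <= B.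
      have := Bj j; have := nn (y j)^`(); have := nn (y j); have := pp mu^`() (b 0 j).
      by have := pp mu (b 0 j); clear; lra.
    apply: le_trans (ler_normD _ _) _; rewrite -mulrA !normrM (ger0_norm E0').
    rewrite (ger0_norm (subE _ (E01 t ht))).
    rewrite normrM in h2; have n1 := normr_ge0 (x j)^`().[t].
    have n2 : 0 <= `|mu^`().[t]| * `|a 0 j| by rewrite mulr_ge0.
    by move: h1 h2 n1 n2 hB1 E0' E1' B1; clear; nra.
  have hy' : `|(y j).[r] + mu.[t] * b 0 j| <= B.
    apply: le_trans (ler_normD _ _) _; rewrite normrM.
    have h1 := horner_nrm (y j) rrb'.
    have h2 : `|mu.[t]| * `|b 0 j| <= nrm rb mu * `|b 0 j|.
      by rewrite ler_wpM2r //; exact/horner_nrm.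
    have := Bj j; have := nn (y j)^`(); have := nn (x j)^`(); have := pp mu^`() (b 0 j).
    by have := pp mu^`() (a 0 j); move: h1 h2; clear; lra.
  apply: le_trans (ler_normD _ _) _; rewrite !normrM mulrDl lerD //.
    have : `|(y1 j).[t] - ((y j).[r] + mu.[t] * b 0 j)| * `|(x1 j)^`().[t]| <=
      (K1 * e) * (2 * B) by apply: ler_pM.
    have : B * K1 * e <= B * K1 * c by rewrite ler_wpM2l.
    by clear; lra.
  have : `|(y j).[r] + mu.[t] * b 0 j| * `|(x1 j - mu * (a 0 j)%:P)^`().[t]| <=
    B * (2 * B * c) by apply: ler_pM.
  have : 0 <= B ^+ 2 * c by rewrite mulr_ge0 // (le_trans (ltW e0)).
  by rewrite expr2; clear; lra.
have f'b t c : r <= t <= rb ->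
    (forall j, `|(x1 j - mu * (a 0 j)%:P)^`().[t]| <= 2 * B * c) ->
    e <= c -> c <= 1 -> `|f^`().[t]| <= K2 * c.
  move=> ht h ec c1; rewrite f'E; apply: le_trans (ler_norm_sum _ _ _) _.
  apply: le_trans (_ : m%:R * (2 * B * K1 + 4 * B ^+ 2) * c <= _).
    apply: le_trans (_ : \sum_(j < m) (2 * B * K1 + 4 * B ^+ 2) * c <= _).
      by apply: ler_sum => j _; apply: term.
    by rewrite sumr_const card_ord -[leLHS]mulr_natl mulrA.
  by rewrite ler_wpM2r ?lerDl // (le_trans (ltW e0)).
have sf t : r <= t <= rb -> `|s1.[t] - (s.[r] + mu.[t] * k)| <= K3 * e.
  move=> ht; have -> : s1.[t] - (s.[r] + mu.[t] * k) = f.[t].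
    by rewrite /f !hornerE; ring.
  apply: (@two_piece f r rb e K2) => //; first by rewrite addr_ge0.
  - have -> : f.[r] = s1.[r] - s.[r] by rewrite /f !hornerE mur; ring.
    rewrite distrC; apply: le_trans start3 _.
    have : 0 <= m%:R * (2 * B * K1 + 4 * B ^+ 2) * e by rewrite mulr_ge0 ?(ltW e0).
    by rewrite /K2; clear; lra.
  - by move=> u /short hu; rewrite -[leRHS]mulr1; apply: f'b => // j; have [h _ _] := sx j; rewrite mulr1 h.
  - by move=> u hu; have hu' := wide u hu; apply: f'b => // j; have [_ h _] := sx j; exact: h.
move=> t ht; split=> [j|j|] /=.
- have [_ _ /(_ t ht) h] := sx j; rewrite !mxE distrC; apply: le_trans h _.
  by rewrite ler_wpM2r ?lerDl ?(ltW K30) // ltW.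
- have [_ _ /(_ t ht) h] := sy j; rewrite !mxE distrC; apply: le_trans h _.
  by rewrite ler_wpM2r ?lerDl ?(ltW K30) // ltW.
- have -> : hdot (\row_j (y j).[r]) a = k.
    by apply: eq_bigr => j _; rewrite mxE.
  rewrite distrC; apply: le_trans (sf t ht) _.
  by rewrite ler_wpM2r ?lerDr // ltW.
Qed.

End HeisenbergCurves.

(** * Prolonging a curve along a segment; stages and reachability *)

Section Extension.
Context (R : realType) (m : nat).
Implicit Types (A B z : heis R m) (a c : 'rV[R]_m) (r t e : R) (P Q : curve R m).

Definition hsize A a c : R :=
  \sum_j (`|a 0 j| + `|c 0 j|) + `|hdot A.1.2 a|.

Lemma hsize_ge0 A a c : 0 <= hsize A a c.
Proof. by rewrite addr_ge0 // sumr_ge0 // => j _; rewrite addr_ge0. Qed.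

Lemma hseg_near A a c t : nearH (`|t| * hsize A a c) A (hseg A a c t).
Proof.
have S0 := hsize_ge0 A a c.
have Sa j : `|a 0 j| + `|c 0 j| <= hsize A a c.
  by rewrite /hsize (bigD1 j) //= -addrA lerDl addr_ge0 // sumr_ge0.
split=> [j|j|] /=.
- rewrite !mxE opprD addNKr normrN normrM ler_wpM2l //.
  by apply: le_trans (Sa j); rewrite lerDl.
- rewrite !mxE opprD addNKr normrN normrM ler_wpM2l //.
  by apply: le_trans (Sa j); rewrite lerDr.
- by rewrite opprD addNKr normrN normrM ler_wpM2l // /hsize lerDr sumr_ge0.
Qed.

Lemma hdotB a1 a2 c : hdot a1 c - hdot a2 c = hdot (a1 - a2) c.
Proof. by rewrite /hdot -sumrB; apply: eq_bigr => j _; rewrite !mxE mulrBl. Qed.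

Lemma hdot_le a c e : (forall j, `|a 0 j| <= e) -> `|hdot a c| <= e * \sum_j `|c 0 j|.
Proof.
move=> h; apply: le_trans (ler_norm_sum _ _ _) _; rewrite mulr_sumr.
by apply: ler_sum => j _; rewrite normrM ler_wpM2r.
Qed.

Lemma hseg_cont A B a c t e : `|t| <= 1 -> nearH e A B ->
  nearH (e * (1 + \sum_j `|a 0 j|)) (hseg A a c t) (hseg B a c t).
Proof.
move=> t1 [h1 h2 h3].
have e0 : 0 <= e by apply: le_trans h3.
have S0 : 0 <= \sum_j `|a 0 j| by rewrite sumr_ge0.
have eS : e <= e * (1 + \sum_j `|a 0 j|) by rewrite ler_peMr // lerDl.
split=> [j|j|] /=.
- by rewrite !mxE opprD addrACA subrr addr0 (le_trans (h1 j)).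
- by rewrite !mxE opprD addrACA subrr addr0 (le_trans (h2 j)).
- rewrite opprD addrACA -mulrBr hdotB mulrDr mulr1.
  apply: le_trans (ler_normD _ _) _; rewrite lerD // normrM.
  have : `|hdot (A.1.2 - B.1.2) a| <= e * \sum_j `|a 0 j|.
    by apply: hdot_le => j; have := h2 j; rewrite !mxE.
  have := normr_ge0 (hdot (A.1.2 - B.1.2) a).
  have := normr_ge0 t; nra.
Qed.

(** [hseg] is affine in t and a [nearH] ball is a box, so the two ends suffice. *)
Lemma hseg_convex q e A a c t : 0 <= t <= 1 ->
  nearH e q A -> nearH e q (hseg A a c 1) -> nearH e q (hseg A a c t).
Proof.
move=> /andP[t0 t1] [h1 h2 h3] [k1 k2 k3].
have H (u v w : R) : `|u - v| <= e -> `|u - (v + 1 * w)| <= e -> `|u - (v + t * w)| <= e.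
  by rewrite !ler_norml => /andP[? ?] /andP[? ?]; apply/andP; split; nra.
split=> [j|j|] /=.
- by have := k1 j; have := h1 j; rewrite !mxE; exact: H.
- by have := k2 j; have := h2 j; rewrite !mxE; exact: H.
- exact: H.
Qed.

(** The new velocity is x' (1 - E) + E l' a, and similarly for y. E is tiny on the old disc; on the
    right the pivot l travels from 0 to 1 along the segment, and on the left l is almost constant,
    so the curve stalls near [ev P (- r)]. *)
Lemma extend_along P r rb a c e : 0 < r -> r < rb -> hdot c a = 0 -> 0 < e ->
  exists Q, [/\ near_curve r e P Q,
    forall t, r <= t <= rb -> exists2 u, 0 <= u <= 1 &
      nearH e (hseg (ev P r) a c u) (ev Q t),
    nearH e (hseg (ev P r) a c 1) (ev Q rb) &
    forall t, - rb <= t <= - r -> nearH e (ev P (- r)) (ev Q t)].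
Proof.
move=> r0 rrb ac0 e0.
have S0 := hsize_ge0 (ev P (- r)) a c.
pose k := e / (2 * (1 + hsize (ev P (- r)) a c)).
have k0 : 0 < k by rewrite /k divr_gt0 // mulr_gt0 //; lra.
have kS : k * hsize (ev P (- r)) a c <= e / 2.
  have : k * (1 + hsize (ev P (- r)) a c) = e / 2 by rewrite /k; field; lra.
  lra.
have [l [lr lb l01 lneg]] := pivot_poly r0 rrb k0.
have [K1 K10 sw1] := switch_estimate (cx P) (cy P) (cs P) r0 rrb ac0 lr.
(* The parameter of the left end seen in reversed time; subtracting l(-r) makes it start at 0, as
   [switch_estimate] requires. *)
pose l' := (l \Po (- 'X)) - (l.[- r])%:P.
have l'r : l'.[r] = 0 by rewrite hornerD hornerN hornerC horner_compN subrr.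
have [K2 K20 sw2] := switch_estimate (cx (refl P)) (cy (refl P)) (cs (refl P))
  r0 rrb ac0 l'r.
have Kp : 0 < 2 * (K1 + K2) by lra.
pose eta := Num.min (Num.min 1 (rb - r)) (Num.min e (e / (2 * (K1 + K2)))).
have eta0 : 0 < eta by rewrite /eta !lt_min ltr01 subr_gt0 rrb e0 divr_gt0.
have [eta1 etab etae etaK] : [/\ eta <= 1, eta <= rb - r, eta <= e &
    eta <= e / (2 * (K1 + K2))].
  by split; rewrite /eta !ge_min lexx ?orbT.
have {etaK} [K1e K2e] : K1 * eta <= e / 2 /\ K2 * eta <= e / 2.
  rewrite ler_pdivlMr // in etaK.
  have : 0 <= K1 * eta by rewrite mulr_ge0 ?(ltW K10) ?(ltW eta0).
  have : 0 <= K2 * eta by rewrite mulr_ge0 ?(ltW K20) ?(ltW eta0).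
  by move: etaK; clear; split; nra.
have [d d0 cont] := curve_cont P (ltW r0) eta0.
pose dxE j := l^`() * (a 0 j)%:P - (cx P j)^`().
pose dyE j := l^`() * (c 0 j)%:P - (cy P j)^`().
pose S := \sum_j (nrm r (dxE j) + nrm r (dyE j)).
have nn (p : {poly R}) : 0 <= nrm r p by rewrite nrm_ge0 // ltW.
have S10 : 0 <= S by apply: sumr_ge0 => j _; rewrite addr_ge0.
have Sx j : nrm r (dxE j) <= S.
  rewrite /S (bigD1 j) //= -addrA lerDl; apply: addr_ge0 => //.
  by apply: sumr_ge0 => i _; rewrite addr_ge0.
have Sy j : nrm r (dyE j) <= S.
  rewrite /S (bigD1 j) //= addrAC lerDr; apply: addr_ge0 => //.
  by apply: sumr_ge0 => i _; rewrite addr_ge0.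
have pS : 0 < (1 + r) * (1 + S) by rewrite mulr_gt0 // ltr_wpDr // ltW.
(* Small enough for the change of velocity, E times a polynomial of norm at most S, and its integral
   over the disc to stay below the tolerance d of [curve_cont]. *)
pose e1 := Num.min eta (d / ((1 + r) * (1 + S))).
have e10 : 0 < e1 by rewrite lt_min eta0 divr_gt0.
have [e1eta e1d] : e1 <= eta /\ e1 * ((1 + r) * (1 + S)) <= d.
  by rewrite -ler_pdivlMr //; split; rewrite /e1 ge_min lexx ?orbT.
have reta : r < r + eta by rewrite ltrDl.
have retab : r + eta <= rb by rewrite addrC -lerBrDr.
have [E [Enrm E01 E1 Eeven]] := step_poly r0 reta retab e10.
pose Q := Curve
  (fun j => ((cx P j).[0])%:P + prim ((cx P j)^`() * (1 - E) + E * l^`() * (a 0 j)%:P))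
  (fun j => ((cy P j).[0])%:P + prim ((cy P j)^`() * (1 - E) + E * l^`() * (c 0 j)%:P))
  (cs0 P).
have dQx j : (cx Q j)^`() = (cx P j)^`() * (1 - E) + E * l^`() * (a 0 j)%:P.
  by rewrite /= derivD derivC add0r deriv_prim.
have dQy j : (cy Q j)^`() = (cy P j)^`() * (1 - E) + E * l^`() * (c 0 j)%:P.
  by rewrite /= derivD derivC add0r deriv_prim.
have small (p q f : {poly R}) : q^`() - p^`() = E * f -> q.[0] = p.[0] ->
    nrm r f <= S -> nrm r (q^`() - p^`()) <= d /\ nrm r (q - p) <= d.
  move=> hq h0 hf; have -> : q - p = prim (q^`() - p^`()).
    by apply: deriv_inj0; rewrite ?deriv_prim ?derivB // hornerD hornerN h0 prim_at0 subrr.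
  have h1 : nrm r (q^`() - p^`()) <= e1 * S.
    rewrite hq; apply: le_trans (nrmM _ _ (ltW r0)) _.
    by apply: ler_pM.
  have e1S : 0 <= e1 * S by rewrite mulr_ge0 // ltW.
  have re1 : 0 <= r * e1 by rewrite mulr_ge0 // ltW.
  have re1S : 0 <= r * (e1 * S) by rewrite mulr_ge0 // ltW.
  split; first by move: h1 e1d re1 re1S e10; clear; lra.
  apply: le_trans (nrm_prim _ (ltW r0)) _.
  have : r * nrm r (q^`() - p^`()) <= r * (e1 * S) by rewrite ler_wpM2l // ltW.
  by move: e1d re1 e1S e10; clear; lra.
have smx j : nrm r ((cx Q j)^`() - (cx P j)^`()) <= d /\ nrm r (cx Q j - cx P j) <= d.
  apply: (small _ _ (dxE j)) => //; first by rewrite dQx /dxE; ring.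
  by rewrite /= hornerD hornerC prim_at0 addr0.
have smy j : nrm r ((cy Q j)^`() - (cy P j)^`()) <= d /\ nrm r (cy Q j - cy P j) <= d.
  apply: (small _ _ (dyE j)) => //; first by rewrite dQy /dyE; ring.
  by rewrite /= hornerD hornerC prim_at0 addr0.
have nearPQ : near_curve r eta P Q.
  by apply: cont => // j; [have [_ h] := smx j|have [h _] := smx j|have [_ h] := smy j].
have nrr : `|r| <= r by rewrite ger0_norm // ltW.
have E01' t : r <= t <= rb -> 0 <= E.[t] <= 1.
  by move=> /andP[rt ?]; apply: E01; rewrite ger0_norm // (le_trans (ltW r0)).
have E1' t : r + eta <= t <= rb -> 1 - eta <= E.[t].
  move=> /andP[rt ?]; have tt : `|t| = t.
    by rewrite ger0_norm // (le_trans _ rt) // addr_ge0 // ltW.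
  by apply: le_trans (E1 t _ _); rewrite ?tt // lerD2l lerN2.
have right t : r <= t <= rb -> nearH (K1 * eta) (hseg (ev P r) a c l.[t]) (ev Q t).
  move=> ht; apply: (sw1 (cx Q) (cy Q) (cs Q) E eta) => //; first exact: deriv_cs.
  exact: (near_ev nearPQ nrr).
have nearR : near_curve r eta (refl P) (refl Q) by exact: near_refl.
have left t : r <= t <= rb ->
    nearH (K2 * eta) (hseg (ev (refl P) r) a c l'.[t]) (ev (refl Q) t).
  move=> ht; apply: (sw2 (cx (refl Q)) (cy (refl Q)) (cs (refl Q)) E eta) => //.
  - move=> j; rewrite /= !deriv_compN dQx comp_polyD !comp_polyM !comp_polyB.
    by rewrite /l' derivB deriv_compN !derivC !comp_polyC Eeven; ring.
  - move=> j; rewrite /= !deriv_compN dQy comp_polyD !comp_polyM !comp_polyB.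
    by rewrite /l' derivB deriv_compN !derivC !comp_polyC Eeven; ring.
  - exact: deriv_cs.
  - exact: (near_ev nearR nrr).
exists Q; split.
- by case: nearPQ => h1 h2 h3; split=> [j|j|]; apply: le_trans etae.
- move=> t ht; exists l.[t]; first exact: l01.
  by apply: nearH_le (right t ht); move: K1e e0; clear; lra.
- rewrite -lb; apply: nearH_le (right rb _); first by move: K1e e0; clear; lra.
  by rewrite lexx andbT ltW.
- move=> t /andP[ht1 ht2]; have ht : r <= - t <= rb by rewrite lerNr ht2 lerNl.
  have := left (- t) ht; rewrite !ev_refl opprK => h.
  have h2 := hseg_near (ev P (- r)) a c l'.[- t].
  have := nearH_trans h2 h; apply: nearH_le.
  have : `|l'.[- t]| <= k.
    rewrite hornerD hornerN hornerC horner_compN opprK; apply: lneg.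
    by apply/andP; split.
  move=> h3; have : `|l'.[- t]| * hsize (ev P (- r)) a c <= k * hsize (ev P (- r)) a c.
    by rewrite ler_wpM2r.
  by move: K2e kS; clear; lra.
Qed.

(* A stage stands for all curves within [rad] of [crv] on the disc of radius
   [time]. *)
Record stage := Stage { crv : curve R m; time : R; rad : R }.

Definition valid (W : set (heis R m)) (S : stage) :=
  [/\ 0 < time S, 0 < rad S & forall t, `|t| <= time S ->
      forall z, nearH (rad S) (ev (crv S) t) z -> W z].

(** The tube of S' lies inside the tube of S. Since the distances travelled are paid out of the
    radius, the relation is transitive, and whatever holds on the whole tube of S survives in the
    limit. *)
Definition refines (S S' : stage) := time S <= time S' /\
  exists e, near_curve (time S) e (crv S) (crv S') /\ e + rad S' <= rad S.

Lemma refines_refl S : refines S S.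
Proof.
by split=> //; exists 0; split; [exact: near_curve_refl|rewrite add0r].
Qed.

Lemma refines_trans S1 S2 S3 : 0 <= time S1 ->
  refines S1 S2 -> refines S2 S3 -> refines S1 S3.
Proof.
move=> t0 [h1 [e1 [n1 d1]]] [h2 [e2 [n2 d2]]]; split; first exact: le_trans h2.
exists (e1 + e2); split; first exact: near_curve_trans n2.
lra.
Qed.

Lemma refines_rad S S' : 0 <= time S -> refines S S' -> rad S' <= rad S.
Proof.
move=> t0 [_ [e [[_ _ h] d]]]; have := nrm_ge0 (cs (crv S) - cs (crv S')) t0; lra.
Qed.

Definition openH (W : set (heis R m)) := forall A, W A ->
  exists2 e, 0 < e & forall z, nearH e A z -> W z.

(** The tolerance d depends on A, B, e and T but not on the stage. The end of a curve being known
    only up to an error, this uniformity is what lets steps be chained, the tolerances being chosen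
    backwards. *)
Definition leads (W : set (heis R m)) A B := forall e T, 0 < e -> exists2 d, 0 < d &
  forall S, valid W S -> nearH d A (ev (crv S) (time S)) ->
  exists S', [/\ valid W S', refines S S', T <= time S' &
    nearH e B (ev (crv S') (time S'))].

Lemma leads_trans W A B z : leads W A B -> leads W B z -> leads W A z.
Proof.
move=> AB Bz e T e0; have [d d0 h] := Bz e T e0; have [d' d'0 h'] := AB d 0 d0.
exists d' => // S vS nS; have [S' [vS' rS' _ nS']] := h' S vS nS.
have [S'' [v'' r'' t'' n'']] := h S' vS' nS'; exists S''; split=> //.
by apply: refines_trans r'' => //; case: vS => /ltW.
Qed.

(** Compactness of [0, 1] in its near-covering form, applied to the filter of small positive radii,
    gives one radius for the whole segment. *)
Lemma segment_margin W A a c : openH W -> (forall t, 0 <= t <= 1 -> W (hseg A a c t)) ->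
  exists2 e, 0 < e & forall t, 0 <= t <= 1 -> forall z, nearH e (hseg A a c t) z -> W z.
Proof.
move=> oW segW; pose S := 1 + hsize A a c.
have S0 : 0 < S by rewrite /S; have := hsize_ge0 A a c; lra.
pose G (e t : R) := forall z, nearH e (hseg A a c t) z -> W z.
have /compact_near_coveringP/(_ R (at_right 0) G) := @segment_compact R 0 1.
move=> cov; have [|e /= e0 he] := cov _.
  move=> t; rewrite /= in_itv /= => t01.
  have [e e0 he] := oW _ (segW t t01).
  exists ([set u | `|t - u| < e / (2 * S)], [set d | d < e / 2]).
    split; first by apply/nbhs_ballP; exists (e / (2 * S)); rewrite //= divr_gt0 // mulr_gt0.
    by apply: nbhs_right_lt; rewrite divr_gt0.
  move=> [u d] /= [tu de] z hz; apply: he.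
  apply: nearH_le (nearH_trans _ hz); last first.
    have := hseg_near A a c (t - u); move=> [k1 k2 k3].
    split=> [j|j|] /=.
    + have -> : (A.1.1 + t *: a) 0 j - (A.1.1 + u *: a) 0 j
        = - (A.1.1 0 j - (A.1.1 + (t - u) *: a) 0 j) by rewrite !mxE; ring.
      by rewrite normrN; exact: k1.
    + have -> : (A.1.2 + t *: c) 0 j - (A.1.2 + u *: c) 0 j
        = - (A.1.2 0 j - (A.1.2 + (t - u) *: c) 0 j) by rewrite !mxE; ring.
      by rewrite normrN; exact: k2.
    + have -> : A.2 + t * hdot A.1.2 a - (A.2 + u * hdot A.1.2 a)
        = - (A.2 - (A.2 + (t - u) * hdot A.1.2 a)) by ring.
      by rewrite normrN; exact: k3.
  rewrite ltr_pdivlMr ?mulr_gt0 // in tu.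
  have : `|t - u| * hsize A a c <= `|t - u| * S by rewrite ler_wpM2l // /S lerDr.
  lra.
have := he (e / 2).
rewrite /ball /= sub0r normrN ger0_norm; last lra.
have e20 : 0 < e / 2 by lra.
move=> /(_ ltac:(lra) e20) h; exists (e / 2) => // t t01; apply: h.
Qed.

Lemma leads_seg W A a c : openH W -> hdot c a = 0 ->
  (forall t, 0 <= t <= 1 -> W (hseg A a c t)) -> leads W A (hseg A a c 1).
Proof.
move=> oW ac0 segW e T e0; have [mu mu0 marg] := segment_margin oW segW.
(* Three errors add up along the segment: the displaced starting point, the prolongation, and the
   radius of the new stage; hence the third of [mu]. *)
pose e1 := Num.min (e / 2) (mu / 3).
have e10 : 0 < e1 by rewrite lt_min; apply/andP; split; lra.
have [e1e e1mu] : e1 <= e / 2 /\ e1 <= mu / 3 by split; rewrite ge_min lexx ?orbT.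
have Sp : 0 < 1 + \sum_j `|a 0 j| by rewrite ltr_wpDr // sumr_ge0.
exists (e1 / (1 + \sum_j `|a 0 j|)); first by rewrite divr_gt0.
move=> [P r d] [/= r0 d0 vS] near0.
have nearseg u : 0 <= u <= 1 -> nearH e1 (hseg A a c u) (hseg (ev P r) a c u).
  move=> /andP[u0 u1]; have := hseg_cont a c (_ : `|u| <= 1) near0.
  by rewrite divfK ?gt_eqF // => h; apply: h; rewrite ger0_norm.
pose rb := Num.max (r + 1) T.
have rrb : r < rb by rewrite /rb lt_max; apply/orP; left; lra.
pose e2 := Num.min e1 (d / 3).
have e20 : 0 < e2 by rewrite lt_min e10 /=; lra.
have [e2e e2d] : e2 <= e1 /\ e2 <= d / 3 by split; rewrite ge_min lexx ?orbT.
have [Q [nPQ right endp left]] := extend_along P r0 rrb ac0 e20.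
exists (Stage Q rb e2); split=> //=.
- split=> //=; first by lra.
  (* Three zones: on the old disc the old tube applies; on the left the curve stalls at the centre
     of the old tube at time -r; on the right the margin of the segment applies. *)
  move=> t tb z hz; have [tr|rt] := leP `|t| r.
    apply: (vS t tr); apply: nearH_le (nearH_trans (near_ev nPQ tr) hz).
    by move: e2d d0; clear; lra.
  move: tb rt; rewrite ler_norml ltNge ler_norml.
  move=> /andP[tb1 tb2]; rewrite negb_and -!ltNge => /orP[ht|ht].
    have hr : `|- r| <= r by rewrite normrN ger0_norm // ltW.
    have ht' : - rb <= t <= - r by rewrite tb1 ltW.
    apply: (vS (- r) hr); apply: nearH_le (nearH_trans (left t ht') hz).
    by move: e2d d0; clear; lra.
  have ht' : r <= t <= rb by rewrite tb2 ltW.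
  have [u u01 hu] := right t ht'; apply: (marg u u01).
  apply: nearH_le (nearH_trans (nearseg u u01) (nearH_trans hu hz)).
  by move: e2e e1mu; clear; lra.
- split=> /=; first exact: ltW.
  by exists e2; split=> //; lra.
- by rewrite /rb le_max lexx orbT.
- have u01 : ((0 : R) <= (1 : R)) && ((1 : R) <= 1).
    by apply/andP; split.
  by apply: nearH_le (nearH_trans (nearseg 1 u01) endp); lra.
Qed.

End Extension.

(** * Local accessibility and reachability in connected open sets *)

Section Reach.
Context (R : realType) (m : nat).
Implicit Types (A B p q z : heis R m.+1) (a c x y : 'rV[R]_m.+1) (s t e k l : R).
Implicit Type W : set (heis R m.+1).

Lemma nbhs_heisP A (U : set (heis R m.+1)) :
  nbhs A U <-> exists2 e, 0 < e & forall z, nearH e A z -> U z.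
Proof.
split=> [/nbhs_ballP[e /= e0 h]|[e e0 h]].
  exists (e / 2) => [|z [h1 h2 h3]]; first by rewrite divr_gt0.
  have lt w : w <= e / 2 -> w < e by lra.
  apply: h; split; [split|].
  - by split=> // i j; rewrite ord1; apply/lt/h1.
  - by split=> // i j; rewrite ord1; apply/lt/h2.
  - exact/lt.
apply/nbhs_ballP; exists e => //= z [[[_ h1] [_ h2]] h3]; apply: h.
by split=> [j|j|]; apply: ltW; [exact: h1|exact: h2|].
Qed.

Lemma openHP W : open W <-> openH W.
Proof.
rewrite openE; split=> [oW A /oW/nbhs_heisP//|oW A /oW h].
exact/nbhs_heisP.
Qed.

Lemma hsegx x y s a : hseg (x, y, s) a 0 1 = (x + a, y, s + hdot y a) :> heis R m.+1.
Proof. by rewrite /hseg /= !scale1r addr0 mul1r. Qed.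

Lemma hsegy x y s c : hseg (x, y, s) 0 c 1 = (x, y + c, s) :> heis R m.+1.
Proof.
rewrite /hseg /= !scale1r addr0 mul1r.
have -> : hdot y 0 = 0 by rewrite /hdot big1 // => j _; rewrite mxE mulr0.
by rewrite addr0.
Qed.

Lemma hdot0l a : hdot (0 : 'rV[R]_m.+1) a = 0.
Proof. by rewrite /hdot big1 // => j _; rewrite mxE mul0r. Qed.

Lemma hdot0r c : hdot c (0 : 'rV[R]_m.+1) = 0.
Proof. by rewrite /hdot big1 // => j _; rewrite mxE mulr0. Qed.

Lemma hdot_delta y k : hdot y (k *: delta_mx 0 0) = k * y 0 0.
Proof.
rewrite /hdot (bigD1 ord0) //= big1 => [|j /negPf j0].
  by rewrite !mxE eqxx mulr1 addr0 mulrC.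
by rewrite !mxE eqxx j0 !mulr0.
Qed.

(* Two moves correct x and y; the commutator loop of size k * l corrects s. *)
Lemma leads_six W (C : set (heis R m.+1)) p q k l :
  let d := delta_mx 0 0 : 'rV[R]_m.+1 in
  let s2 := p.2 + hdot p.1.2 (q.1.1 - p.1.1) in
  openH W -> (forall z, C z -> W z) ->
  (forall z a c t, 0 <= t <= 1 -> C z -> C (hseg z a c 1) -> C (hseg z a c t)) ->
  k * l = s2 - q.2 -> C p -> C q -> C (q.1.1, p.1.2, s2) -> C (q.1.1, q.1.2, s2) ->
  C (q.1.1 + k *: d, q.1.2, s2 + k * q.1.2 0 0) ->
  C (q.1.1 + k *: d, q.1.2 + l *: d, s2 + k * q.1.2 0 0) ->
  C (q.1.1, q.1.2 + l *: d, q.2) -> leads W p q.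
Proof.
move=> d s2 oW CW conv kl Cp Cq C1 C2 C3 C4 C5.
(* C is a box inside W, or the whole group: by [conv] a segment lies in W once its two ends are in
   C, so only the seven corners need checking. *)
have step z a c z' : hdot c a = 0 -> hseg z a c 1 = z' -> C z -> C z' -> leads W z z'.
  move=> h <- Cz Cz'; apply: leads_seg => // t t01; apply: CW; exact: conv.
apply: (leads_trans (step p (q.1.1 - p.1.1) 0 _ _ _ Cp C1)).
- exact: hdot0l.
- by rewrite [p in LHS](_ : p = (p.1.1, p.1.2, p.2)) ?hsegx 1?addrC ?subrK //;
    case: (p) => [[]].
apply: (leads_trans (step _ 0 (q.1.2 - p.1.2) _ _ _ C1 C2)).
- exact: hdot0r.
- by rewrite hsegy addrC subrK.
apply: (leads_trans (step _ (k *: d) 0 _ _ _ C2 C3)).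
- exact: hdot0l.
- by rewrite hsegx hdot_delta.
apply: (leads_trans (step _ 0 (l *: d) _ _ _ C3 C4)).
- exact: hdot0r.
- by rewrite hsegy.
apply: (leads_trans (step _ (- k *: d) 0 _ _ _ C4 C5)).
- exact: hdot0l.
- rewrite hsegx hdot_delta scaleNr addrK !mxE eqxx mulr1; congr (_, _, _).
  have -> : q.2 = s2 - k * l by rewrite kl; ring.
  by ring.
apply: (step _ 0 (- l *: d)) => //.
- exact: hdot0r.
- by rewrite hsegy scaleNr addrK; case: (q) => [[]].
Qed.

(** Splitting u evenly keeps both sides of the commutator loop small when u is small. *)
Lemma sqrt_factor (u : R) : exists k l,
  [/\ k * l = u, `|k| <= Num.sqrt `|u| & `|l| <= Num.sqrt `|u|].
Proof.
have h : Num.sqrt `|u| * Num.sqrt `|u| = `|u| by rewrite -expr2 sqr_sqrtr.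
have n : `|Num.sqrt `|u| | = Num.sqrt `|u| by rewrite ger0_norm ?sqrtr_ge0.
exists (Num.sqrt `|u|), (Num.sg u * Num.sqrt `|u|); split.
- by rewrite mulrCA h -numEsg.
- by rewrite n.
- rewrite normrM n normr_sg; case: (u != 0); rewrite ?mul1r // mul0r.
  exact: sqrtr_ge0.
Qed.

(** A ball-box estimate: correcting s by an amount of order e takes a loop with sides of order the
    square root of e, which must still fit in the box of size rho around q0. *)
Lemma leads_local W q0 : openH W -> W q0 ->
  exists2 e, 0 < e & forall p q, nearH e q0 p -> nearH e q0 q -> leads W p q.
Proof.
move=> oW /oW [rho rho0 hrho].
pose S := \sum_j (`|q0.1.2 0 j| + 1).
have S0 : 0 <= S by apply: sumr_ge0 => j _; rewrite addr_ge0.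
pose T := 1 + S.
have T1 : 1 <= T by rewrite /T lerDl.
pose g := rho / (4 * T).
have g0 : 0 < g by rewrite /g divr_gt0 // mulr_gt0 //; lra.
have gT : g * T = rho / 4 by rewrite /g; field; lra.
have gle : g <= rho / 4 by rewrite -gT ler_peMr // ltW.
(* T bounds the relevant coordinates y near q0, so after the moves in x and y the error in s is at
   most 2 e T <= g^2, and the sides of the loop are at most g. *)
pose e := Num.min 1 (Num.min (g / 2) (g ^+ 2 / (2 * T))).
have T20 : 0 < 2 * T by lra.
have e0 : 0 < e.
  by rewrite !lt_min ltr01 /=; apply/andP; split; apply: divr_gt0 => //; exact: exprn_gt0.
have [e1 eg egT] : [/\ e <= 1, e <= g / 2 & e * (2 * T) <= g ^+ 2].
  by rewrite -ler_pdivlMr //; split; rewrite /e !ge_min lexx ?orbT.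
have eT : 2 * e * T <= rho / 4.
  by have := ler_wpM2r (_ : 0 <= T) eg; rewrite -gT => h; have := h ltac:(lra); lra.
exists e => // p q np nq.
have [px py ps] := np; have [qx qy qs] := nq.
pose s2 := p.2 + hdot p.1.2 (q.1.1 - p.1.1).
have hd : `|hdot p.1.2 (q.1.1 - p.1.1)| <= 2 * e * S.
  apply: le_trans (ler_norm_sum _ _ _) _; rewrite /S mulr_sumr.
  apply: ler_sum => j _; rewrite normrM mulrC !mxE; apply: ler_pM => //.
    have := px j; have := qx j; rewrite !ler_norml => /andP[? ?] /andP[? ?].
    by apply/andP; split; lra.
  have -> : p.1.2 0 j = q0.1.2 0 j - (q0.1.2 0 j - p.1.2 0 j) by ring.
  by apply: le_trans (ler_normB _ _) _; rewrite lerD // (le_trans (py j)).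
have u_le : `|s2 - q.2| <= 2 * e * T.
  have -> : s2 - q.2 = (q0.2 - q.2) - (q0.2 - p.2) + hdot p.1.2 (q.1.1 - p.1.1).
    by rewrite /s2; ring.
  apply: le_trans (ler_normD _ _) _.
  by have := ler_normB (q0.2 - q.2) (q0.2 - p.2); rewrite /T; lra.
have [k [l [kl k_le l_le]]] := sqrt_factor (s2 - q.2).
have sq_le : Num.sqrt `|s2 - q.2| <= g.
  have -> : g = Num.sqrt (g ^+ 2) by rewrite sqrtr_sqr ger0_norm // ltW.
  rewrite ler_sqrt ?sqr_ge0 //.
  by apply: le_trans u_le _; lra.
have {}k_le : `|k| <= g by exact: le_trans sq_le.
have {}l_le : `|l| <= g by exact: le_trans sq_le.
have erho : e <= rho by lra.
have qy0 : `|q.1.2 0 0| <= T.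
  have -> : q.1.2 0 0 = q0.1.2 0 0 - (q0.1.2 0 0 - q.1.2 0 0) by ring.
  apply: le_trans (ler_normB _ _) _; have := qy 0.
  have : `|q0.1.2 0 0| + 1 <= S.
    rewrite /S (bigD1 ord0) //= lerDl sumr_ge0 // => j _; by rewrite addr_ge0.
  by rewrite /T; lra.
have ky : `|k * q.1.2 0 0| <= rho / 4.
  by rewrite -gT normrM; apply: ler_pM.
have s2le : `|q0.2 - s2| <= rho / 2.
  have -> : q0.2 - s2 = (q0.2 - p.2) - hdot p.1.2 (q.1.1 - p.1.1) by rewrite /s2; ring.
  by apply: le_trans (ler_normB _ _) _; move: eT; rewrite /T; lra.
have s3le : `|q0.2 - (s2 + k * q.1.2 0 0)| <= rho.
  rewrite opprD addrA; apply: le_trans (ler_normB _ _) _; lra.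
have shift (b : 'rV[R]_m.+1) (w : R) j : `|w| <= g ->
    `|b 0 j - (b + w *: delta_mx 0 0) 0 j| <= g.
  move=> wg; rewrite !mxE opprD addNKr normrN normrM; apply: le_trans wg.
  by rewrite ler_piMr //; case: (_ && _); rewrite ?normr1 ?normr0.
have qxs j : `|q0.1.1 0 j - (q.1.1 + k *: delta_mx 0 0) 0 j| <= rho.
  apply: le_trans (ler_distD (q.1.1 0 j) _ _) _.
  by have := qx j; have := shift q.1.1 k j k_le; lra.
have qys j : `|q0.1.2 0 j - (q.1.2 + l *: delta_mx 0 0) 0 j| <= rho.
  apply: le_trans (ler_distD (q.1.2 0 j) _ _) _.
  by have := qy j; have := shift q.1.2 l j l_le; lra.
have le1 (w : R) : w <= e -> w <= rho by lra.
apply: (@leads_six W (nearH rho q0) p q k l) => //.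
- by move=> z a c t t01; exact: hseg_convex.
- exact: nearH_le erho np.
- exact: nearH_le erho nq.
- by split=> [j|j|] /=; [exact/le1/qx|exact/le1/py|lra].
- by split=> [j|j|] /=; [exact/le1/qx|exact/le1/qy|lra].
- by split=> [j|j|] //=; exact/le1/qy.
- by split=> [j|j|] /=; [exact/le1/qx|exact: qys|exact: le1].
Qed.

(** The points reachable from A form a set open and closed in W: near any point of W, [leads_local]
    connects in both directions. *)
Lemma leads_connected W A B : open W -> connected W -> W A -> W B -> leads W A B.
Proof.
move=> opW cW WA WB; have oW : openH W by exact/openHP.
suff : W `&` [set z | leads W A z] = W by
  move=> h; have [] : (W `&` [set z | leads W A z]) B by rewrite h.
apply: cW.
- exists A; split=> //=; have [e e0 h] := leads_local oW WA.
  by apply: h; apply: nearH_refl; exact: ltW.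
- exists (W `&` [set z | leads W A z]); last by rewrite setIA setIid.
  apply/openHP => z [Wz /= lz]; have [e e0 h] := leads_local oW Wz.
  have [e' e'0 h'] := oW z Wz.
  exists (Num.min e e') => [|w nw]; first by rewrite lt_min e0.
  split; first by apply: h'; apply: nearH_le nw; rewrite ge_min lexx orbT.
  apply: leads_trans lz _; apply: h; first by apply: nearH_refl; exact: ltW.
  by apply: nearH_le nw; rewrite ge_min lexx.
- exists (~` (W `&` [set z | ~ leads W A z])); last first.
    rewrite eqEsubset; split=> z [Wz /=] h; first by split=> //= -[].
    by split=> //=; apply: contrapT => nl; apply: h.
  apply: open_closedC; apply/openHP => z [Wz /= lz].
  have [e e0 h] := leads_local oW Wz; have [e' e'0 h'] := oW z Wz.
  exists (Num.min e e') => [|w nw]; first by rewrite lt_min e0.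
  split; first by apply: h'; apply: nearH_le nw; rewrite ge_min lexx orbT.
  move=> /= lw; apply: lz; apply: leads_trans lw _; apply: h.
    by apply: nearH_le nw; rewrite ge_min lexx.
  by apply: nearH_refl; exact: ltW.
Qed.

(** In the whole group the loop may have any size, so six segments suffice globally. *)
Lemma leads_setT A B : leads setT A B.
Proof.
have [k [l [kl _ _]]] := sqrt_factor (A.2 + hdot A.1.2 (B.1.1 - A.1.1) - B.2).
apply: (@leads_six setT setT A B k l) => // z _.
by exists 1.
Qed.

Lemma visit W S B e T : openH W -> (forall A, W A -> leads W A B) -> valid W S -> 0 < e ->
  exists S', [/\ valid W S', refines S S', T <= time S' &
    nearH e B (ev (crv S') (time S'))].
Proof.
move=> oW lW vS e0.
have WA : W (ev (crv S) (time S)).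
  have [t0 d0 h] := vS; apply: (h (time S)); first by rewrite ger0_norm // ltW.
  by apply: nearH_refl; exact: ltW.
have [d d0 h] := lW _ WA e T e0; apply: h => //.
by apply: nearH_refl; exact: ltW.
Qed.

Definition stage_refl (S : stage R m.+1) := Stage (refl (crv S)) (time S) (rad S).

Lemma valid_refl W S : valid W S -> valid W (stage_refl S).
Proof.
move=> [t0 d0 h]; split=> // t ht z; rewrite ev_refl; apply: h.
by rewrite normrN.
Qed.

Lemma visit_left W S B e T : openH W -> (forall A, W A -> leads W A B) -> valid W S ->
  0 < e -> exists S', [/\ valid W S', refines S S', T <= time S' &
    nearH e B (ev (crv S') (- time S'))].
Proof.
move=> oW lW vS e0.
have [S' [vS' [rS' [d [nS' dS']]] tS' hS']] := visit T oW lW (valid_refl vS) e0.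
exists (stage_refl S'); split=> //; first exact: valid_refl.
  by split=> //; exists d; split=> //; exact: near_refl_r.
by rewrite ev_refl opprK.
Qed.

Lemma shrink W S d : valid W S -> 0 < d ->
  exists S', [/\ valid W S', refines S S', crv S' = crv S, time S' = time S &
    rad S' <= d].
Proof.
move=> [t0 d0 h] dp; exists (Stage (crv S) (time S) (Num.min (rad S) d)); split=> //=.
- split=> //=; first by rewrite lt_min d0.
  by move=> t ht z hz; apply: (h t ht); apply: nearH_le hz; rewrite ge_min lexx.
- split=> //=; exists 0; split; first exact: near_curve_refl.
  by rewrite add0r ge_min lexx.
- by rewrite ge_min lexx orbT.
Qed.

End Reach.

(** * Immersion and injectivity by small perturbations *)

Section Perturbation.
Context (R : realType) (m : nat).
Implicit Types (P Q : curve R m.+1) (r t e d : R) (Y : {poly R}).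
Implicit Types (W : set (heis R m.+1)) (S : stage R m.+1) (c : 'I_3 -> R).

Local Notation i0 := (@Ordinal 3 0 isT).
Local Notation i1 := (@Ordinal 3 1 isT).
Local Notation i2 := (@Ordinal 3 2 isT).

Lemma I3P (K : 'I_3 -> Prop) : K i0 -> K i1 -> K i2 -> forall i, K i.
Proof.
move=> h0 h1 h2 [[|[|[|//]]] hi].
- by rewrite (_ : Ordinal hi = i0) //; exact: val_inj.
- by rewrite (_ : Ordinal hi = i1) //; exact: val_inj.
- by rewrite (_ : Ordinal hi = i2) //; exact: val_inj.
Qed.

Definition triple (T : Type) (a b c : T) (i : 'I_3) : T :=
  match val i with 0%N => a | 1%N => b | _ => c end.

(** Three parameters, one more than the number of times t1, t2 in a self-intersection. Y is left
    free so that the third one can act on s almost independently of x and y. *)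
Definition pert P Y c := Curve
  (fun j => if j == ord0 then cx P j + c i0 *: 'X else cx P j)
  (fun j => if j == ord0 then cy P j + c i1 *: 'X + c i2 *: Y else cy P j)
  (cs0 P).

Lemma pert_near P Y r e : 0 <= r -> 0 < e -> exists2 d, 0 < d &
  forall c, (forall j, 0 <= c j <= d) -> near_curve r e P (pert P Y c).
Proof.
move=> r0 e0; have [h h0 cont] := curve_cont P r0 e0.
have Y0 := nrm_ge0 Y r0.
exists (h / (2 * (1 + r + nrm r Y))); first by rewrite divr_gt0 // mulr_gt0 //; lra.
move=> c hc; have {}hc j : `|c j| * (1 + r + nrm r Y) <= h / 2.
  have /andP[c0 cd] := hc j; rewrite ger0_norm // -ler_pdivlMr //; last lra.
  by apply: le_trans cd _; rewrite invfM mulrA.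
have c0 j : 0 <= `|c j| * r by rewrite mulr_ge0.
have cY j : 0 <= `|c j| * nrm r Y by rewrite mulr_ge0.
have cp j : 0 <= `|c j| by [].
apply: cont => //= j; case: eqP => [_|_]; rewrite ?subrr ?nrm0 ?(ltW h0) //.
- by rewrite addrC addKr nrmZ nrmX; have := hc i0; have := cY i0; have := cp i0; lra.
- rewrite derivD addrC addKr derivZ derivX nrmZ nrm1.
  by have := hc i0; have := cY i0; have := c0 i0; lra.
- have -> (p q s : {poly R}) : p + q + s - p = q + s by ring.
  apply: le_trans (nrmD _ _ r0) _; rewrite !nrmZ nrmX.
  have := hc i1; have := hc i2; have := cY i1; have := c0 i2; have := cp i1.
  by have := cp i2; lra.
Qed.

(** Half of the old radius pays for the move from the old curve, the other half for the new tube. *)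
Lemma refine_near W S Q d : valid W S -> near_curve (time S) (rad S / 2) (crv S) Q ->
  0 < d -> d <= rad S / 2 ->
  valid W (Stage Q (time S) d) /\ refines S (Stage Q (time S) d).
Proof.
move=> [t0 d0 h] nQ dp dle; split.
  split=> //= t ht z hz; apply: (h t ht).
  by apply: nearH_le (nearH_trans (near_ev nQ ht) hz); lra.
by split=> //=; exists (rad S / 2); split=> //; lra.
Qed.

Lemma immerse W S : valid W S -> exists S', [/\ valid W S', refines S S',
  time S' = time S & forall t, `|t| <= time S ->
    rad S' < `|(cx (crv S') 0)^`().[t]| \/ rad S' < `|(cy (crv S') 0)^`().[t]|].
Proof.
move=> vS; have [T0 d0 _] := vS; set T := time S in T0 *; set P := crv S.
have e0 : 0 < rad S / 2 by lra.
have [d dp hd] := pert_near P 0 (ltW T0) e0.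
pose dx := (cx P 0)^`(); pose dy := (cy P 0)^`().
pose L := 1 + nrm T dx^`() + nrm T dy^`().
have nx : 0 <= nrm T dx^`() by rewrite nrm_ge0 // ltW.
have ny : 0 <= nrm T dy^`() by rewrite nrm_ge0 // ltW.
have L1 : 1 <= L by rewrite /L; lra.
(* The vanishing of the velocity involves one time and two equations. The third component and the
   time t2 are fillers that fit [transversality]; setting t2 = c2 at the end makes the filler
   vanish, so one of the two true components is large. *)
pose F c t1 t2 := triple (dx.[t1] + c i0) (dy.[t1] + c i1) (t2 - c i2).
have bd t : - T <= t <= T -> `|t| <= T by rewrite ler_norml.
have [|||c [hc [e ep he]]] := @transversality R F d L (- T) T 0 d dp.
- by lra.
- move=> c t1 t2 t1' t2' i _ /bd h1 _ /bd h1' _.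
  have n1 : 0 <= `|t1 - t1'| by [].
  have n2 : 0 <= `|t2 - t2'| by [].
  have Ln1 : 0 <= L * `|t1 - t1'| by rewrite mulr_ge0 //; lra.
  have Ln2 : 0 <= L * `|t2 - t2'| by rewrite mulr_ge0 //; lra.
  elim/I3P: i; rewrite /F /triple /=.
  + rewrite opprD addrACA subrr addr0 mulrDr.
    have := poly_lip_nrm dx h1' h1.
    by have := ler_wpM2r n1 (_ : nrm T dx^`() <= L) => /(_ ltac:(rewrite /L; lra)); lra.
  + rewrite opprD addrACA subrr addr0 mulrDr.
    have := poly_lip_nrm dy h1' h1.
    by have := ler_wpM2r n1 (_ : nrm T dy^`() <= L) => /(_ ltac:(rewrite /L; lra)); lra.
  + rewrite opprD addrACA subrr addr0 mulrDr; have := ler_peMl n2 L1; lra.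
- move=> c c' t1 t2 e' _ _ _ _ e'0 h i.
  apply: le_trans (_ : e' <= _); last by rewrite ler_peMl.
  have := h i; elim/I3P: i; rewrite /F /triple /=.
  + by rewrite opprD addrACA subrr add0r.
  + by rewrite opprD addrACA subrr add0r.
  + by rewrite opprD addrACA subrr add0r -opprD normrN.
pose d' := Num.min (rad S / 2) (e / 2).
have d'0 : 0 < d' by rewrite lt_min e0 /=; lra.
have d'S : d' <= rad S / 2 by rewrite ge_min lexx.
have [v' r'] := refine_near vS (hd c hc) d'0 d'S.
exists (Stage (pert P 0 c) T d'); split=> //.
move=> t ht /=; have ht' : - T <= t <= T by rewrite -ler_norml.
have d'e : d' < e by apply: le_lt_trans (_ : e / 2 < e); [rewrite ge_min lexx orbT|lra].
have [i ] := he t (c i2) ht' (hc i2).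
have -> : (cx P 0 + c i0 *: 'X)^`().[t] = dx.[t] + c i0.
  by rewrite derivD derivZ derivX hornerD hornerZ hornerC mulr1.
have -> : (cy P 0 + c i1 *: 'X + c i2 *: 0)^`().[t] = dy.[t] + c i1.
  by rewrite scaler0 addr0 derivD derivZ derivX hornerD hornerZ hornerC mulr1.
elim/I3P: i; rewrite /F /triple /= => h; [left; exact: lt_le_trans h|right; exact: lt_le_trans h|].
by rewrite subrr normr0 in h; lra.
Qed.

Lemma poly_nonroot (p : {poly R}) (u v : R) : p != 0 -> u < v ->
  exists2 t, u < t < v & p.[t] != 0.
Proof.
move=> p0 uv; pose n := size p.
pose s := [seq u + (v - u) * (i.+1%:R / n.+2%:R) | i <- iota 0 n].
have n0 : 0 < n.+2%:R :> R by rewrite ltr0n.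
apply: contrapT => h; have : (size s < size p)%N.
  apply: max_poly_roots => //.
    apply/allP => _ /mapP[i hi ->]; rewrite mem_iota add0n /= in hi.
    apply/negPn/negP => nr; apply: h; exists (u + (v - u) * (i.+1%:R / n.+2%:R)) => //.
    have h1 : 0 < i.+1%:R / n.+2%:R :> R by rewrite divr_gt0 // ltr0n.
    have h2 : i.+1%:R / n.+2%:R < 1 :> R by rewrite ltr_pdivrMr // mul1r ltr_nat ltnS ltnW.
    have vu0 : 0 < v - u by rewrite subr_gt0.
    have h3 := mulr_gt0 vu0 h1; have h4 : (v - u) * (i.+1%:R / n.+2%:R) < v - u by rewrite gtr_pMr.
    by move: h3 h4; set w := (v - u) * _ => h3 h4; apply/andP; split; lra.
  rewrite map_inj_uniq ?iota_uniq // => i j /addrI.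
  have vu : v - u != 0 by rewrite subr_eq0 gt_eqF.
  move/(mulfI vu)/(mulIf (invr_neq0 (lt0r_neq0 n0)))/eqP.
  by rewrite eqr_nat => /eqP[].
by rewrite size_map size_iota ltnn.
Qed.

(* Used with p = x': here q = G p for a bump G between the two intervals, so the
   integral of q p is bounded below while q is small on the intervals. *)
Lemma bump (p : {poly R}) (T u v : R) : p != 0 -> 0 < T -> - T <= u -> u < v -> v <= T ->
  exists2 k, 0 < k & forall e, 0 < e -> e <= 1 / 2 -> exists q : {poly R},
  [/\ forall t, `|t| <= T -> `|q.[t]| <= nrm T p,
    forall t, - T <= t <= u -> `|q.[t]| <= e * nrm T p,
    forall t, v <= t <= T -> `|q.[t]| <= e * nrm T p &
    forall t1 t2, - T <= t1 <= u -> v <= t2 <= T ->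
      k <= (prim (q * p)).[t2] - (prim (q * p)).[t1]].
Proof.
move=> p0 T0 Tu uv vT; have [tau /andP[t1 t2] ptau] := poly_nonroot p0 uv.
pose mu := `|p.[tau]| / 2.
have mu0 : 0 < mu by rewrite divr_gt0 // normr_gt0.
pose K := nrm T p^`() + 1.
have K0 : 0 < K by rewrite ltr_wpDl // nrm_ge0 // ltW.
pose rho := Num.min (mu / K) (Num.min (tau - u) (v - tau)).
have rho0 : 0 < rho by rewrite !lt_min divr_gt0 //= !subr_gt0 t1 t2.
have [rK ru rv] : [/\ rho <= mu / K, rho <= tau - u & rho <= v - tau].
  by split; rewrite /rho !ge_min lexx ?orbT.
have pmu t : `|t - tau| <= rho -> mu <= `|p.[t]|.
  move=> h; have tT : `|t| <= T.
    by move: h; rewrite !ler_norml => /andP[? ?]; apply/andP; split; lra.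
  have tauT : `|tau| <= T by rewrite ler_norml; apply/andP; split; lra.
  have h1 := poly_lip_nrm p tauT tT.
  have : nrm T p^`() * `|t - tau| <= K * rho.
    by apply: ler_pM => //; rewrite ?nrm_ge0 ?(ltW T0) // /K lerDl.
  rewrite ler_pdivlMr // in rK.
  have : `|p.[tau]| <= `|p.[t]| + `|p.[t] - p.[tau]|.
    have := ler_normB p.[t] (p.[t] - p.[tau]).
    by rewrite (_ : p.[t] - (p.[t] - p.[tau]) = p.[tau]) //; ring.
  have : `|p.[tau]| = 2 * mu by rewrite /mu; field.
  lra.
(* The integrand is G p^2 with G >= 1/2 and |p| >= mu on an interval of length rho around tau, and
   it is nonnegative elsewhere on [-T, T]. *)
exists (mu ^+ 2 / 2 * rho); first by rewrite mulr_gt0 // divr_gt0 // exprn_gt0.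
move=> e e0 e12.
have rb : rho <= 2 * T by lra.
have rho20 : 0 < rho / 2 by lra.
have rho2 : rho / 2 < rho by lra.
have [E [Enrm E01 E1 _]] := step_poly rho20 rho2 rb e0.
pose G := 1 - (E \Po ('X - tau%:P)).
have GE t : G.[t] = 1 - E.[t - tau].
  by rewrite /G hornerD hornerN hornerC horner_comp hornerD hornerN hornerX hornerC.
have inb t : `|t| <= T -> `|t - tau| <= 2 * T.
  rewrite !ler_norml => /andP[? ?]; apply/andP; split; lra.
have G01 t : `|t| <= T -> 0 <= G.[t] <= 1.
  by move=> /inb/E01; rewrite GE => /andP[? ?]; apply/andP; split; lra.
have Gout t : `|t| <= T -> rho <= `|t - tau| -> `|G.[t]| <= e.
  move=> ht /E1/(_ (inb t ht)) h; have /andP[g0 g1] := G01 t ht.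
  by rewrite ger0_norm // GE; lra.
have Gin t : `|t - tau| <= rho / 2 -> 1 / 2 <= G.[t].
  move=> h; have := horner_nrm E h; rewrite GE ler_norml => /andP[? ?]; lra.
have bound t w : `|t| <= T -> `|G.[t]| <= w -> `|(G * p).[t]| <= w * nrm T p.
  by move=> ht hw; rewrite hornerM normrM; apply: ler_pM => //; exact: horner_nrm.
exists (G * p); split.
- move=> t ht; rewrite -[leRHS]mul1r; apply: bound => //.
  by have /andP[g0 g1] := G01 t ht; rewrite ger0_norm.
- move=> t /andP[h1 h2]; have ht : `|t| <= T.
    by rewrite ler_norml h1 (le_trans h2) // (le_trans (ltW uv)).
  apply: bound => //; apply: Gout => //; rewrite distrC; apply: le_trans (ler_norm _).
  by rewrite (le_trans ru) // lerD2l lerN2.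
- move=> t /andP[h1 h2]; have ht : `|t| <= T.
    by rewrite ler_norml h2 andbT (le_trans Tu) // (le_trans (ltW uv)).
  apply: bound => //; apply: Gout => //; apply: le_trans (ler_norm _).
  by rewrite (le_trans rv) // lerD2r.
- move=> s1 s2 /andP[a1 a2] /andP[b1 b2]; set H := prim _.
  have H'E t : H^`().[t] = G.[t] * p.[t] ^+ 2.
    by rewrite deriv_prim !hornerM expr2 mulrA.
  have Hpos t : - T <= t <= T -> 0 <= H^`().[t].
    rewrite -ler_norml => /G01/andP[g0 g1]; rewrite H'E.
    by rewrite mulr_ge0 // sqr_ge0.
  have mono w1 w2 : - T <= w1 -> w1 <= w2 -> w2 <= T -> H.[w1] <= H.[w2].
    move=> h1 h2 h3; have := @poly_incr_ge R H w1 w2 0 h2; rewrite mul0r subr_ge0.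
    by apply=> w /andP[w1w ww2]; apply: Hpos; rewrite (le_trans h1) // (le_trans ww2).
  have h1 : H.[s1] <= H.[tau - rho / 2].
    by apply: mono; move: a1 a2 vT t2 ru rho0 rho2; clear; lra.
  have h2 : H.[tau + rho / 2] <= H.[s2].
    by apply: mono; move: Tu t1 b1 b2 rv rho0 rho2; clear; lra.
  have : mu ^+ 2 / 2 * (tau + rho / 2 - (tau - rho / 2)) <=
      H.[tau + rho / 2] - H.[tau - rho / 2].
    apply: poly_incr_ge; first by lra.
    move=> w /andP[w1 w2].
    have hw : `|w - tau| <= rho / 2 by rewrite ler_distl w1 w2.
    have g := Gin w hw; have := pmu w (le_trans hw (ltW rho2)) => pm.
    have : mu ^+ 2 <= p.[w] ^+ 2.
      by rewrite -(real_normK (num_real p.[w])) lerXn2r ?nnegrE // ltW.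
    by rewrite H'E; have := sqr_ge0 p.[w]; move: g; clear; nra.
  have -> : tau + rho / 2 - (tau - rho / 2) = rho by field.
  by move: h1 h2; clear; lra.
Qed.

(** The integral of (y + c1 X + c2 Y)(x' + c0), expanded in c, for the perturbed component, the
    other components being unchanged in [cs P]. The bump makes the increment of the c2 term
    large. *)
Definition pert_s P Y c : {poly R} := cs P + c i0 *: prim (cy P 0)
  + c i1 *: prim ('X * (cx P 0)^`()) + c i2 *: prim (Y * (cx P 0)^`())
  + (c i0 * c i1) *: prim 'X + (c i0 * c i2) *: prim Y.

Lemma cs_pert P Y c : cs (pert P Y c) = pert_s P Y c.
Proof.
apply: deriv_inj0; last first.
  by rewrite cs_at0 /pert_s !hornerD !hornerZ !prim_at0 !mulr0 !addr0 hornerC.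
rewrite deriv_cs /pert_s !derivD !derivZ !deriv_prim derivC add0r.
rewrite (bigD1 ord0) //= [in RHS](bigD1 ord0) //=.
under eq_bigr => j /negPf -> do [].
rewrite derivD derivZ derivX -!mul_polyC !polyCM; ring.
Qed.

(** A quantitative inverse of an almost triangular system in the parameter differences D0, D1, D2.
    The increment of x determines D0; that of y determines D1 up to D2 dY, small because eta is;
    that of s determines D2, whose coefficient K >= k dominates. The bounds on eta and d allow the
    remaining coupling to be absorbed, and L results from solving backwards. *)
Lemma expanding_arith (D0 D1 D2 Dt dY A Bq K Xq Z g k e M eta B d c1 c2 c0 : R) :
  0 < g -> g <= Dt -> 0 < k -> k <= K -> `|A| <= M -> `|Bq| <= M -> `|Xq| <= M ->
  `|Z| <= M -> `|dY| <= 2 * eta * B -> 0 <= M -> 0 <= B -> 0 <= eta -> 0 <= e ->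
  `|c1| <= 1 -> `|c2| <= 1 -> 0 <= c0 <= d -> d <= 1 -> d * (4 * (M + 1)) <= k ->
  eta * (2 * (B + 1)) <= g -> eta * (16 * (M * B + 1)) <= k * g ->
  `|D0 * Dt| <= e -> `|D1 * Dt + D2 * dY| <= e ->
  `|D2 * K + (D0 * A + D1 * Bq + (D0 * c1 + c0 * D1) * Xq + (D0 * c2 + c0 * D2) * Z)| <= e ->
  let L := 1 / g + 2 / k * (1 + 5 * M / g) in
  [/\ `|D0| <= L * e, `|D1| <= L * e & `|D2| <= L * e].
Proof.
move=> g0 gDt k0 kK AM BM XM ZM YB M0 B0 eta0 e0 cb1 cb2 /andP[c00 c0d] d1 dk etag etak hx hy hz.
have n0 := normr_ge0 D0; have n1 := normr_ge0 D1; have n2 := normr_ge0 D2.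
have ge (w v x : R) : 0 < v -> v <= w -> `|x| * v <= `|x * w|.
  by move=> v0 vw; rewrite normrM ler_wpM2l // ger0_norm // (le_trans (ltW v0)).
have x1 : `|D0| * g <= e by apply: le_trans (ge _ _ _ g0 gDt) hx.
have y1 : `|D1| * g <= e + `|D2| * (2 * eta * B).
  apply: le_trans (ge _ _ _ g0 gDt) _.
  rewrite -[X in `|X|](addrK (D2 * dY)); apply: le_trans (ler_normB _ _) _.
  by rewrite lerD // normrM ler_wpM2l.
have z1 : `|D2| * k <= e + (M * (3 * `|D0| + 2 * `|D1|) + d * M * `|D2|).
  apply: le_trans (ge _ _ _ k0 kK) _.
  rewrite -[X in `|X|](addrK (D0 * A + D1 * Bq + (D0 * c1 + c0 * D1) * Xq
    + (D0 * c2 + c0 * D2) * Z)).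
  apply: le_trans (ler_normB _ _) _; rewrite lerD //.
  have b1 : `|D0 * A| <= `|D0| * M by rewrite normrM ler_wpM2l.
  have b2 : `|D1 * Bq| <= `|D1| * M by rewrite normrM ler_wpM2l.
  have b3 : `|(D0 * c1 + c0 * D1) * Xq| <= (`|D0| + `|D1|) * M.
    rewrite normrM; apply: ler_pM => //; apply: le_trans (ler_normD _ _) _.
    rewrite !normrM lerD //; first by rewrite ler_piMr.
    by rewrite ler_piMl // ger0_norm // (le_trans c0d).
  have b4 : `|(D0 * c2 + c0 * D2) * Z| <= (`|D0| + d * `|D2|) * M.
    rewrite normrM; apply: ler_pM => //; apply: le_trans (ler_normD _ _) _.
    rewrite !normrM lerD //; first by rewrite ler_piMr.
    by rewrite ler_wpM2r // ger0_norm.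
  rewrite (_ : M * (3 * `|D0| + 2 * `|D1|) + d * M * `|D2| = `|D0| * M + `|D1| * M
    + (`|D0| + `|D1|) * M + (`|D0| + d * `|D2|) * M); last by ring.
  by do 3![apply: le_trans (ler_normD _ _) _; apply: lerD => //].
move: hx hy hz AM BM XM ZM YB cb1 cb2 gDt kK ge => _ _ _ _ _ _ _ _ _ _ _ _ _.
have eg0 : 0 <= e / g by rewrite divr_ge0 // ltW.
have f1 : `|D0| <= e / g by rewrite ler_pdivlMr.
have f2 : `|D1| <= e / g + `|D2|.
  have y2 : `|D1| * g <= (e / g + `|D2|) * g.
    rewrite mulrDl divfK ?gt_eqF //; apply: le_trans y1 _; rewrite lerD2l ler_wpM2l //.
    by move: etag eta0; clear; lra.
  by rewrite ler_pM2r in y2.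
have f2' : M * `|D1| <= M * (e / g) + `|D2| * (k / 8).
  have y2 : M * `|D1| * g <= (M * (e / g) + `|D2| * (k / 8)) * g.
    have -> : (M * (e / g) + `|D2| * (k / 8)) * g = M * e + `|D2| * (k * g / 8).
      by field; rewrite gt_eqF.
    have h1 : M * (`|D1| * g) <= M * (e + `|D2| * (2 * eta * B)) by rewrite ler_wpM2l.
    have h2 : `|D2| * (2 * (eta * (M * B))) <= `|D2| * (k * g / 8).
      by rewrite ler_wpM2l //; move: etak eta0; clear; lra.
    by move: h1 h2; clear; lra.
  by rewrite ler_pM2r in y2.
have f3 : M * `|D0| <= M * (e / g) by rewrite ler_wpM2l.
have f4 : d * M * `|D2| <= k / 4 * `|D2|.
  rewrite ler_wpM2r //; move: dk (le_trans c00 c0d); clear; lra.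
have f5 : `|D2| * k <= 2 * (e + 5 * M * (e / g)).
  by move: z1 f2' f3 f4; clear; lra.
have f6 : `|D2| <= 2 / k * (1 + 5 * M / g) * e.
  have -> : 2 / k * (1 + 5 * M / g) * e = 2 * (e + 5 * M * (e / g)) / k.
    by field; rewrite !gt_eqF.
  by rewrite ler_pdivlMr.
have LE : (1 / g + 2 / k * (1 + 5 * M / g)) * e = e / g + 2 / k * (1 + 5 * M / g) * e.
  by field; rewrite !gt_eqF.
have pos : 0 <= 2 / k * (1 + 5 * M / g) * e by exact: le_trans f6.
move=> L; rewrite /L LE; split.
- by rewrite (le_trans f1) // lerDl.
- by rewrite (le_trans f2) // lerD2l.
- by rewrite (le_trans f6) // lerDr.
Qed.

(** The increments of x_0, y_0 and s between two times are three functions of (t1, t2). The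
    parameters c0 and c1 act on the first two. The third multiplies a bump Y proportional to x_0'
    and concentrated between the intervals: it acts on s with a coefficient at least k, and hardly
    on y_0, as Y is small at both times. *)
Lemma separate W S (u1 v1 u2 v2 : R) : valid W S -> - time S <= u1 -> v1 < u2 ->
  u1 <= v1 -> u2 <= v2 -> v2 <= time S -> exists S', [/\ valid W S', refines S S',
  time S' = time S & forall t1 t2, u1 <= t1 <= v1 -> u2 <= t2 <= v2 ->
    ~ nearH (2 * rad S') (ev (crv S') t1) (ev (crv S') t2)].
Proof.
(* The bump needs a nonzero x_0'. If it vanishes identically, as on a constant curve, a preliminary
   perturbation adds d t to x_0. *)
wlog x'0 : S / (cx (crv S) 0)^`() != 0 => [H vS h1 h2 h3 h4 h5|].
  have [T0 d0 _] := vS.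
  have [x'0|] := eqVneq (cx (crv S) 0)^`() 0; last by move=> x'0; exact: H.
  have e0 : 0 < rad S / 2 by lra.
  have [d dp hd] := pert_near (crv S) 0 (ltW T0) e0.
  pose c : 'I_3 -> R := fun=> d.
  have hc j : 0 <= c j <= d by rewrite /c lexx andbT ltW.
  have [v' r'] := refine_near vS (hd c hc) e0 (lexx _).
  have [] := H _ _ v' h1 h2 h3 h4 h5.
    by rewrite /= derivD x'0 add0r derivZ derivX /c alg_polyC polyC_eq0 gt_eqF.
  move=> S' [v'' r'' t'' n'']; exists S'; split=> //.
  by apply: refines_trans r' r''; exact: ltW.
move=> vS; have [T0 d0 _] := vS; set T := time S in T0 *; set P := crv S in x'0 *.
move=> Tu1 v1u2 uv1 uv2 v2T.
pose p := (cx P 0)^`(); have {x'0}p0 : p != 0 by [].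
have Tv1 : - T <= v1 by lra.
have u2T : u2 <= T by lra.
have nT q : 0 <= nrm T q by rewrite nrm_ge0 // ltW.
have [k k0 hk] := bump p0 T0 Tv1 v1u2 u2T.
pose g := u2 - v1; have g0 : 0 < g by rewrite subr_gt0.
pose B := nrm T p; have B0 : 0 <= B by exact: nT.
pose M := 2 * T * (nrm T (cy P 0) + nrm T ('X * p) + nrm T 'X + B).
have M0 : 0 <= M by apply: mulr_ge0; [lra|rewrite !addr_ge0 // ; exact: nT].
have MB0 : 0 <= M * B by rewrite mulr_ge0.
(* The last two bounds are the thresholds of [expanding_arith]; 1/2 is required by [bump]. *)
pose eta := Num.min (1 / 2) (Num.min (g / (2 * (B + 1))) (k * g / (16 * (M * B + 1)))).
have B1 : 0 < 2 * (B + 1) by lra.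
have MB1 : 0 < 16 * (M * B + 1) by lra.
have eta0 : 0 < eta.
  by rewrite !lt_min; apply/and3P; split; [lra|exact: divr_gt0|apply: divr_gt0 => //; exact: mulr_gt0].
have [eta1 etag etak] : [/\ eta <= 1 / 2, eta * (2 * (B + 1)) <= g &
    eta * (16 * (M * B + 1)) <= k * g].
  by rewrite -!ler_pdivlMr //; split; rewrite /eta !ge_min lexx ?orbT.
have [Y [YB Y1 Y2 Yk]] := hk eta eta0 eta1.
have e0 : 0 < rad S / 2 by lra.
have [d1 d10 hd1] := pert_near P Y (ltW T0) e0.
pose d := Num.min d1 (Num.min 1 (k / (4 * (M + 1)))).
have M4 : 0 < 4 * (M + 1) by lra.
have dp : 0 < d by rewrite !lt_min d10 ltr01 divr_gt0.
have [dd1 dle1 dk] : [/\ d <= d1, d <= 1 & d * (4 * (M + 1)) <= k].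
  by rewrite -ler_pdivlMr //; split; rewrite /d !ge_min lexx ?orbT.
pose F c t1 t2 := triple
  ((cx P 0 + c i0 *: 'X).[t2] - (cx P 0 + c i0 *: 'X).[t1])
  ((cy P 0 + c i1 *: 'X + c i2 *: Y).[t2] - (cy P 0 + c i1 *: 'X + c i2 *: Y).[t1])
  ((pert_s P Y c).[t2] - (pert_s P Y c).[t1]).
have [MA MX M1 MB] : [/\ nrm T (cy P 0) * (2 * T) <= M, nrm T ('X * p) * (2 * T) <= M,
    nrm T 'X * (2 * T) <= M & B * (2 * T) <= M].
  have T2 : 0 <= 2 * T by lra.
  rewrite /M ![_ * (2 * T)]mulrC; split; rewrite ler_wpM2l //.
  - by rewrite -!addrA lerDl !addr_ge0 ?nT.
  - by rewrite -!addrA addrCA lerDl !addr_ge0 ?nT.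
  - by rewrite addrAC lerDr !addr_ge0 ?nT.
  - by rewrite lerDr !addr_ge0 ?nT.
pose Lx := nrm T p + 1.
pose Ly := nrm T (cy P 0)^`() + 1 + nrm T Y^`().
pose Ls := nrm T (cs P)^`() + nrm T (cy P 0) + nrm T ('X * p) + nrm T (Y * p)
  + nrm T 'X + nrm T Y.
pose Lc := 1 / g + 2 / k * (1 + 5 * M / g).
have Lc1 : 0 < 1 / g by rewrite divr_gt0.
have Lc2 : 0 <= 2 / k * (1 + 5 * M / g).
  have h : 0 <= 5 * M / g by apply: divr_ge0; [exact: mulr_ge0|exact: ltW].
  apply: mulr_ge0; first by apply: divr_ge0 => //; exact: ltW.
  by apply: addr_ge0.
have Lc0 : 0 < Lc by rewrite /Lc; lra.
pose L := Lx + Ly + Ls + Lc.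
have Lx0 : 0 <= Lx by rewrite addr_ge0 // nT.
have Ly0 : 0 <= Ly by rewrite !addr_ge0 // nT.
have Ls0 : 0 <= Ls by rewrite !addr_ge0 // nT.
have [LxL LyL LsL LcL'] : [/\ Lx <= L, Ly <= L, Ls <= L & Lc <= L].
  by rewrite /L; move: Lx0 Ly0 Ls0 Lc0; clear; split; lra.
have inT1 t : u1 <= t <= v1 -> `|t| <= T.
  move=> /andP[ut tv]; rewrite ler_norml (le_trans Tu1 ut) (le_trans tv) //.
  by rewrite (le_trans (ltW v1u2)).
have inT2 t : u2 <= t <= v2 -> `|t| <= T.
  move=> /andP[ut tv]; rewrite ler_norml (le_trans tv v2T) andbT (le_trans Tv1) //.
  by rewrite (le_trans (ltW v1u2)).
have [|||c [hc [e ep he]]] := @transversality R F d L u1 v1 u2 v2 dp.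
- exact: lt_le_trans LcL'.
- move=> c t1 t2 t1' t2' i hc /inT1 a1 /inT2 a2 /inT1 b1 /inT2 b2.
  have hc1 j : `|c j| <= 1.
    by have /andP[? hd] := hc j; rewrite ger0_norm // (le_trans hd).
  have cc j j' : `|c j * c j'| <= 1.
    by rewrite normrM -[leRHS]mulr1 ler_pM.
  have sc (w : R) (q : {poly R}) : `|w| <= 1 -> nrm T (w *: q) <= nrm T q.
    by move=> hw; rewrite nrmZ ler_piMl.
  have main (q : {poly R}) l : nrm T q^`() <= l -> l <= L ->
      `|q.[t2] - q.[t1] - (q.[t2'] - q.[t1'])| <= L * (`|t1 - t1'| + `|t2 - t2'|).
    move=> ql lL; have -> : q.[t2] - q.[t1] - (q.[t2'] - q.[t1']) =
      (q.[t2] - q.[t2']) - (q.[t1] - q.[t1']) by ring.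
    apply: le_trans (ler_normB _ _) _; rewrite addrC mulrDr.
    have qL := le_trans ql lL.
    apply: lerD; first by apply: le_trans (poly_lip_nrm q b1 a1) _; rewrite ler_wpM2r.
    by apply: le_trans (poly_lip_nrm q b2 a2) _; rewrite ler_wpM2r.
  elim/I3P: i; rewrite /F /triple /=.
  + apply: (main _ Lx) => //.
    rewrite derivD derivZ derivX; apply: le_trans (nrmD _ _ (ltW T0)) _.
    by rewrite lerD // -[leRHS](nrm1 T) sc.
  + apply: (main _ Ly) => //.
    rewrite !derivD !derivZ derivX; apply: le_trans (nrmD _ _ (ltW T0)) _.
    rewrite lerD ?sc //; apply: le_trans (nrmD _ _ (ltW T0)) _.
    by rewrite lerD // -[leRHS](nrm1 T) sc.
  + apply: (main _ Ls) => //.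
    rewrite /Ls /pert_s; move: (cs P) => q; rewrite !derivD !derivZ !deriv_prim.
    by do 5![apply: le_trans (nrmD _ _ (ltW T0)) _; apply: lerD; rewrite ?sc //].
- move=> c c' t1 t2 e' hc hc' ht1 ht2 e'0 h.
  have a1 := inT1 t1 ht1; have a2 := inT2 t2 ht2.
  have /andP[p1 p2] := ht1; have /andP[q1 q2] := ht2.
  have t12 : t1 <= t2 by rewrite (le_trans p2) // (le_trans (ltW v1u2)).
  have DtT : `|t2 - t1| <= 2 * T.
    by apply: le_trans (ler_normB _ _) _; rewrite mulr_natl mulr2n lerD.
  have inc (q : {poly R}) : nrm T q * (2 * T) <= M ->
      `|(prim q).[t2] - (prim q).[t1]| <= M.
    have := poly_lip_nrm (prim q) a1 a2; rewrite deriv_prim => hq; apply: le_trans.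
    by apply: le_trans hq _; rewrite ler_wpM2l.
  have cb j : `|c j| <= 1.
    by have /andP[? hd] := hc j; rewrite ger0_norm // (le_trans hd).
  have ZM : `|(prim Y).[t2] - (prim Y).[t1]| <= M.
    apply: le_trans MB; apply: le_trans (_ : B * `|t2 - t1| <= _); last by rewrite ler_wpM2l.
    apply: poly_lip => w; rewrite min_l ?max_r // => /andP[w1 w2]; rewrite deriv_prim.
    apply: YB; move: a1 a2; rewrite !ler_norml => /andP[b1 _] /andP[_ b2].
    by rewrite (le_trans b1) //= (le_trans w2).
  have Kk : k <= (prim (Y * p)).[t2] - (prim (Y * p)).[t1].
    by apply: Yk; rewrite ?p2 ?q1 ?(le_trans Tu1) // ?(le_trans q2).
  have YY : `|Y.[t2] - Y.[t1]| <= 2 * eta * B.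
    apply: le_trans (ler_normB _ _) _; rewrite -mulrA mulr_natl mulr2n lerD //.
      by apply: Y2; rewrite q1 (le_trans q2).
    by apply: Y1; rewrite p2 (le_trans Tu1).
  have gDt : g <= t2 - t1 by rewrite lerB.
  have [] := @expanding_arith (c i0 - c' i0) (c i1 - c' i1) (c i2 - c' i2)
    (t2 - t1) (Y.[t2] - Y.[t1]) _ _ _ _ _ g k e' M eta B d (c i1) (c i2) (c' i0)
    g0 gDt k0 Kk (inc _ MA) (inc _ MX) (inc _ M1) ZM YY M0 B0 (ltW eta0) e'0 (cb i1) (cb i2)
    (hc' i0) dle1 dk etag etak.
  + have := h i0; rewrite /F /triple /=; congr (`|_| <= _); rewrite !hornerE /=; ring.
  + have := h i1; rewrite /F /triple /=; congr (`|_| <= _); rewrite !hornerE /=; ring.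
  + have := h i2; rewrite /F /triple /= /pert_s; congr (`|_| <= _).
    move: (cs P) => q; rewrite !hornerD !hornerZ -/p; ring.
  + have LcL : Lc * e' <= L * e' by rewrite ler_wpM2r.
    by move=> h0 h1 h2; elim/I3P; apply: le_trans LcL.
have {}hd1 : near_curve T (rad S / 2) P (pert P Y c).
  by apply: hd1 => j; have /andP[-> h] := hc j; exact: le_trans dd1.
(* Points within 2 d' of each other would have all three increments at most e / 2, against the lower
   bound e for one of them. *)
pose d' := Num.min (rad S / 2) (e / 4).
have d'0 : 0 < d' by rewrite lt_min e0 divr_gt0.
have d'S : d' <= rad S / 2 by rewrite ge_min lexx.
have d'e : d' <= e / 4 by rewrite ge_min lexx orbT.
have [v' r'] := refine_near vS hd1 d'0 d'S.
exists (Stage (pert P Y c) T d'); split=> //= t1 t2 ht1 ht2 [n1 n2 n3].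
have [i ] := he t1 t2 ht1 ht2.
have := n1 0; have := n2 0; move: n3; rewrite /= !mxE /= cs_pert => m3 m2 m1.
by elim/I3P: i; rewrite /F /triple /= distrC; move: m1 m2 m3 d'e ep; clear; lra.
Qed.

End Perturbation.

(** * Analytic functions as limits of polynomials *)

Section AnalyticLimits.
Context (R : realType).
Implicit Types (f g : R -> R) (r t x e : R) (p q : nat -> {poly R}).

Lemma cauchy_seq (u : nat -> R) :
  (forall e, 0 < e -> exists N, forall k l, (N <= k)%N -> (N <= l)%N -> `|u k - u l| <= e) ->
  exists l : R, u @ \oo --> l.
Proof.
move=> hu; apply/cvg_ex; apply/cauchy_cvgP/cauchy_ballP => e e0; rewrite near_map2.
have [|N hN] := hu (e / 2); first by rewrite divr_gt0.
exists ([set n | (N <= n)%N], [set n | (N <= n)%N]); first by split; exists N.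
by move=> [k l] /= [hk hl]; rewrite /ball /=; have := hN k l hk hl; lra.
Qed.

Lemma cvg_seqP (u : nat -> R) (l : R) : u @ \oo --> l <->
  forall e, 0 < e -> exists N, forall k, (N <= k)%N -> `|l - u k| <= e.
Proof.
split=> [/cvgrPdist_le h e /h[N _ hN]|h]; first by exists N => k /hN.
by apply/cvgrPdist_le => e /h[N hN]; exists N => // k /hN.
Qed.

Definition nrm_cauchy r p := forall e, 0 < e -> exists N, forall k l,
  (N <= k)%N -> (N <= l)%N -> nrm r (p k - p l) <= e.

(** A stand-in for an absolutely convergent power series on a disc: convergence is Cauchy in the
    majorant norm, and the values of the limit are recorded on the real interval only. Sums,
    products and inverses then follow from the norm estimates. *)
Definition plim r p f := nrm_cauchy r p /\
  forall t, `|t| <= r -> (p k).[t] @[k --> \oo] --> f t.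

Definition analytic_at f x := exists2 r, 0 < r & exists p, plim r p (fun h => f (x + h)).

Lemma nrm_cauchy_le r1 r2 p : 0 <= r1 -> r1 <= r2 -> nrm_cauchy r2 p -> nrm_cauchy r1 p.
Proof.
move=> r0 r12 h e /h[N hN]; exists N => k l hk hl.
exact: le_trans (nrm_le _ r0 r12) (hN k l hk hl).
Qed.

Lemma plim_le r1 r2 p f : 0 <= r1 -> r1 <= r2 -> plim r2 p f -> plim r1 p f.
Proof.
move=> r0 r12 [h1 h2]; split; first exact: nrm_cauchy_le h1.
by move=> t tr; apply: h2; exact: le_trans r12.
Qed.

Lemma nrm_cauchyD r p q : 0 <= r -> nrm_cauchy r p -> nrm_cauchy r q ->
  nrm_cauchy r (fun k => p k + q k).
Proof.
move=> r0 hp hq e e0; have e20 : 0 < e / 2 by rewrite divr_gt0.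
have [N hN] := hp _ e20; have [M hM] := hq _ e20; exists (maxn N M) => k l.
rewrite !geq_max => /andP[k1 k2] /andP[l1 l2]; rewrite opprD addrACA.
by apply: le_trans (nrmD _ _ r0) _; have := hN k l k1 l1; have := hM k l k2 l2; lra.
Qed.

Lemma nrm_cauchy_bounded r p : 0 <= r -> nrm_cauchy r p ->
  exists2 B, 0 < B & exists N, forall k, (N <= k)%N -> nrm r (p k) <= B.
Proof.
move=> r0 hp; have [N hN] := hp 1 ltr01.
have n0 := nrm_ge0 (p N) r0.
exists (nrm r (p N) + 1); first lra.
exists N => k hk; rewrite -[p k](subrK (p N)); apply: le_trans (nrmD _ _ r0) _.
by rewrite addrC lerD2l; exact: hN.
Qed.

Lemma nrm_cauchyM r p q : 0 <= r -> nrm_cauchy r p -> nrm_cauchy r q ->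
  nrm_cauchy r (fun k => p k * q k).
Proof.
move=> r0 hp hq e e0.
have [B B0 [N1 hB]] := nrm_cauchy_bounded r0 hp.
have [C C0 [N2 hC]] := nrm_cauchy_bounded r0 hq.
have [N3 h3] : exists N, forall k l, (N <= k)%N -> (N <= l)%N ->
    nrm r (p k - p l) <= e / (2 * C) by apply: hp; rewrite divr_gt0 // mulr_gt0.
have [N4 h4] : exists N, forall k l, (N <= k)%N -> (N <= l)%N ->
    nrm r (q k - q l) <= e / (2 * B) by apply: hq; rewrite divr_gt0 // mulr_gt0.
exists (maxn (maxn N1 N2) (maxn N3 N4)) => k l; rewrite !geq_max.
move=> /andP[/andP[k1 k2] /andP[k3 k4]] /andP[/andP[l1 l2] /andP[l3 l4]].
have -> : p k * q k - p l * q l = (p k - p l) * q k + p l * (q k - q l) by ring.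
apply: le_trans (nrmD _ _ r0) _.
have a1 : nrm r ((p k - p l) * q k) <= e / (2 * C) * C.
  by apply: le_trans (nrmM _ _ r0) _; apply: ler_pM; rewrite ?nrm_ge0 ?h3 ?hC.
have a2 : nrm r (p l * (q k - q l)) <= B * (e / (2 * B)).
  by apply: le_trans (nrmM _ _ r0) _; apply: ler_pM; rewrite ?nrm_ge0 ?h4 ?hB.
have e1 : e / (2 * C) * C = e / 2 by field; rewrite gt_eqF.
have e2 : B * (e / (2 * B)) = e / 2 by field; rewrite gt_eqF.
lra.
Qed.

Lemma nrm_cauchy_cst r (c : {poly R}) : nrm_cauchy r (fun=> c).
Proof. by move=> e e0; exists 0%N => k l _ _; rewrite subrr nrm0 ltW. Qed.

Lemma plimD r p q f g : 0 <= r -> plim r p f -> plim r q g ->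
  plim r (fun k => p k + q k) (fun t => f t + g t).
Proof.
move=> r0 [p1 p2] [q1 q2]; split=> [|t tr]; first exact: nrm_cauchyD.
by under eq_fun do rewrite hornerD; apply: cvgD; [exact: p2|exact: q2].
Qed.

Lemma plimM r p q f g : 0 <= r -> plim r p f -> plim r q g ->
  plim r (fun k => p k * q k) (fun t => f t * g t).
Proof.
move=> r0 [p1 p2] [q1 q2]; split=> [|t tr]; first exact: nrm_cauchyM.
by under eq_fun do rewrite hornerM; apply: cvgM; [exact: p2|exact: q2].
Qed.

Lemma plim_poly r (c : {poly R}) : plim r (fun=> c) (fun t => c.[t]).
Proof. by split=> [|t _]; [exact: nrm_cauchy_cst|exact: cvg_cst]. Qed.

Lemma analytic_cst x (c : R) : analytic_at (fun=> c) x.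
Proof.
exists 1; first exact: ltr01.
exists (fun=> c%:P); have := plim_poly 1 c%:P.
by congr plim; apply/funext => t; rewrite hornerC.
Qed.

Lemma analyticD f g x : analytic_at f x -> analytic_at g x ->
  analytic_at (fun t => f t + g t) x.
Proof.
move=> [r1 r10 [p hp]] [r2 r20 [q hq]]; pose r := Num.min r1 r2.
have r0 : 0 < r by rewrite lt_min r10.
exists r => //; exists (fun k => p k + q k); apply: plimD; first exact: ltW.
  by apply: plim_le hp; [exact: ltW|rewrite ge_min lexx].
by apply: plim_le hq; [exact: ltW|rewrite ge_min lexx orbT].
Qed.

Lemma analyticM f g x : analytic_at f x -> analytic_at g x ->
  analytic_at (fun t => f t * g t) x.
Proof.
move=> [r1 r10 [p hp]] [r2 r20 [q hq]]; pose r := Num.min r1 r2.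
have r0 : 0 < r by rewrite lt_min r10.
exists r => //; exists (fun k => p k * q k); apply: plimM; first exact: ltW.
  by apply: plim_le hp; [exact: ltW|rewrite ge_min lexx].
by apply: plim_le hq; [exact: ltW|rewrite ge_min lexx orbT].
Qed.

Fixpoint geom (u : {poly R}) k : {poly R} := if k is k'.+1 then 1 + u * geom u k' else 0.

Lemma geomE u k : (1 - u) * geom u k = 1 - u ^+ k.
Proof.
elim: k => [|k IH] /=; first by rewrite mulr0 expr0 subrr.
by rewrite mulrDr mulr1 mulrCA IH exprS; ring.
Qed.

Lemma geom_at u k t : (1 - u.[t]) * (geom u k).[t] = 1 - u.[t] ^+ k.
Proof.
have := congr1 (horner^~ t) (geomE u k).
by rewrite /= hornerM !hornerD !hornerN !hornerC horner_exp.
Qed.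

Lemma nrm_geom r u k : 0 <= r -> nrm r u <= 1 / 2 -> nrm r (geom u k) <= 2.
Proof.
move=> r0 hu; elim: k => [|k IH] /=; first by rewrite nrm0.
apply: le_trans (nrmD _ _ r0) _; rewrite nrm1.
have := nrmM u (geom u k) r0; have := nrm_ge0 u r0; have := nrm_ge0 (geom u k) r0; nra.
Qed.

(** Shrinking the disc by c multiplies every term except the constant one by at most c. *)
Lemma nrm_shrink_zero r (u : {poly R}) c : 0 < r -> 0 <= c -> c <= 1 ->
  nrm (c * r) u <= `|u.[0]| + c * nrm r u.
Proof.
move=> r0 c0 c1; rewrite horner_coef0.
have le : (size u <= (size u).+1)%N by [].
rewrite !(nrm_widen _ le) !big_ord_recl /= !expr0 !mulr1 mulrDr addrA.
apply: lerD; first by rewrite lerDl mulr_ge0.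
rewrite mulr_sumr; apply: ler_sum => i _; rewrite mulrCA ler_wpM2l //.
rewrite ?lift0 ?/bump ?leq0n ?add1n exprMn ler_wpM2r ?exprn_ge0 ?(ltW r0) //.
by rewrite exprS ler_piMr // exprn_ile1.
Qed.

(** With c = f(x) and u = 1 - f / c, the inverse is the geometric series of u divided by c, and u
    vanishes at x, hence is small on a smaller disc. The approximants are diagonal: the series is
    truncated at order k in the k-th approximant of u. *)
Lemma analyticV f x : analytic_at f x -> f x != 0 -> analytic_at (fun t => (f t)^-1) x.
Proof.
move=> [r r0 [p [pc pl]]] fx0.
have fx0' : f x = f (x + 0) by rewrite addr0.
pose c := f x; pose u k := 1 - c^-1 *: p k.
have c10 : 0 < `|c^-1| by rewrite normr_gt0 invr_eq0.
have uc : nrm_cauchy r u.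
  move=> e e0; have [|N hN] := pc (e / `|c^-1|); first by rewrite divr_gt0.
  exists N => k l hk hl; rewrite /u opprB addrC addrA subrK -scalerBr nrmZ mulrC.
  by rewrite -ler_pdivlMr // nrm_dist nrm_dist hN.
have ul t : `|t| <= r -> (u k).[t] @[k --> \oo] --> 1 - c^-1 * f (x + t).
  move=> tr; rewrite /u; under eq_fun do rewrite hornerD hornerN hornerC hornerZ.
  by apply: cvgB; [exact: cvg_cst|apply: cvgMr; exact: pl].
have q0 : (0 : R) < 1 / 8 by lra.
have [N1 hN1] := uc _ q0.
have nr0 : `|0 : R| <= r by rewrite normr0 ltW.
have /cvg_seqP/(_ _ q0)[N2] := ul 0 nr0.
rewrite -fx0' mulVf // subrr => hN2.
pose N := maxn N1 N2.
have uN0 : `|(u N).[0]| <= 1 / 8.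
  by have := hN2 N (leq_maxr _ _); rewrite sub0r normrN.
have nuN := nrm_ge0 (u N) (ltW r0).
(* Three eighths bound u_k on the disc of radius a r: the value of u_N at 0, the other terms of u_N,
   and the difference u_k - u_N. *)
pose a := 1 / (8 * (1 + nrm r (u N))).
have a0 : 0 < a by rewrite divr_gt0 // mulr_gt0 //; lra.
have aN : a * (1 + nrm r (u N)) = 1 / 8 by rewrite /a; field; lra.
have a1 : a <= 1 by nra.
have ar0 : 0 < a * r by rewrite mulr_gt0.
have arr : a * r <= r by rewrite ler_piMl // ltW.
have ub k : (N <= k)%N -> nrm (a * r) (u k) <= 1 / 2.
  move=> hk; rewrite -[u k](subrK (u N)); apply: le_trans (nrmD _ _ (ltW ar0)) _.
  have h1 := nrm_shrink_zero (u N) r0 (ltW a0) a1.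
  have h2 : nrm r (u k - u N) <= 1 / 8.
    by apply: hN1; rewrite ?leq_maxl // (leq_trans (leq_maxl _ _) hk).
  have := nrm_le (u k - u N) (ltW ar0) arr; lra.
pose v k := geom (u k) k.
have vb k : (N <= k)%N -> nrm (a * r) (v k) <= 2.
  by move=> hk; apply: nrm_geom; [exact: ltW|exact: ub].
have half0 : ((0 : R) <= 1 / 2) && ((1 / 2 : R) < 1) by apply/andP; split; lra.
have vc : nrm_cauchy (a * r) v.
  move=> e e0.
  have [|M hM] := nrm_cauchy_le (ltW ar0) arr uc (_ : 0 < e / 8); first by rewrite divr_gt0.
  have [|K hK] := small_expr half0 (_ : 0 < e / 8); first by rewrite divr_gt0.
  exists (maxn (maxn N M) K) => k l; rewrite !geq_max.
  move=> /andP[/andP[k1 k2] k3] /andP[/andP[l1 l2] l3].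
  have {}k1 : (N <= k)%N by rewrite geq_max.
  have {}l1 : (N <= l)%N by rewrite geq_max.
  have pw n : (N <= n)%N -> (K <= n)%N -> nrm (a * r) (u n ^+ n) <= e / 8.
    move=> n1 n2; apply: le_trans (nrmXn _ _ (ltW ar0)) _; apply: le_trans hK.
    apply: le_trans (_ : (1 / 2) ^+ n <= _); last by rewrite ler_wiXn2l //; lra.
    by rewrite lerXn2r ?nnegrE ?nrm_ge0 ?ub ?(ltW ar0) //; lra.
  (* The resolvent identity for the inverses of 1 - u_k and 1 - u_l, corrected by the two truncation
     errors. *)
  have -> : v k - v l = v k * v l * (u k - u l) + (v k * u l ^+ l - v l * u k ^+ k).
    have hk := geomE (u k) k; have hl := geomE (u l) l; rewrite -/(v k) -/(v l) in hk hl.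
    have -> : u k ^+ k = 1 - (1 - u k) * v k by rewrite hk; ring.
    have -> : u l ^+ l = 1 - (1 - u l) * v l by rewrite hl; ring.
    by ring.
  have ar := ltW ar0; have n0 c' := nrm_ge0 c' ar.
  apply: le_trans (nrmD _ _ ar) _.
  have b1 : nrm (a * r) (v k * v l * (u k - u l)) <= 2 * 2 * (e / 8).
    apply: le_trans (nrmM _ _ ar) (ler_pM (n0 _) (n0 _) _ (hM k l k2 l2)).
    exact: le_trans (nrmM _ _ ar) (ler_pM (n0 _) (n0 _) (vb k k1) (vb l l1)).
  have b2 : nrm (a * r) (v k * u l ^+ l) <= 2 * (e / 8).
    exact: le_trans (nrmM _ _ ar) (ler_pM (n0 _) (n0 _) (vb k k1) (pw l l1 l3)).
  have b3 : nrm (a * r) (v l * u k ^+ k) <= 2 * (e / 8).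
    exact: le_trans (nrmM _ _ ar) (ler_pM (n0 _) (n0 _) (vb l l1) (pw k k1 k3)).
  have := nrmB (v k * u l ^+ l) (v l * u k ^+ k) ar; lra.
exists (a * r) => //; exists (fun k => c^-1 *: v k); split.
  move=> e e0; have [|M hM] := vc (e / `|c^-1|); first by rewrite divr_gt0.
  exists M => k l hk hl; rewrite -scalerBr nrmZ mulrC -ler_pdivlMr //; exact: hM.
move=> t tar; have tr : `|t| <= r by exact: le_trans arr.
pose w := 1 - c^-1 * f (x + t).
have uw : (u k).[t] @[k --> \oo] --> w by exact: ul.
have ubt k : (N <= k)%N -> `|(u k).[t]| <= 1 / 2.
  by move=> hk; apply: le_trans (horner_nrm _ tar) (ub k hk).
have w2 : `|w| <= 1 / 2.
  apply/ler_addgt0Pr => e e0; have /cvg_seqP/(_ _ e0)[M hM] := uw.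
  have h1 := hM (maxn N M) (leq_maxr _ _); have h2 := ubt (maxn N M) (leq_maxl _ _).
  have := ler_normD (w - (u (maxn N M)).[t]) (u (maxn N M)).[t].
  by rewrite subrK; lra.
have w1 : 1 - w != 0.
  by apply/eqP => h; have := w2; rewrite (_ : w = 1) ?normr1; [lra|move: h; lra].
have -> : (f (x + t))^-1 = c^-1 * ((1 - 0) * (1 - w)^-1).
  have cf : c != 0 by [].
  have -> : 1 - w = c^-1 * f (x + t) by rewrite /w; ring.
  by rewrite subr0 mul1r invfM invrK mulrA mulVf // mul1r.
under eq_fun do rewrite hornerZ.
apply: cvgMr; apply: (@cvg_trans _ (((1 - (u k).[t] ^+ k) * (1 - (u k).[t])^-1) @[k --> \oo])).
  apply: near_eq_cvg; exists N => // k /= hk.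
  have hk2 := ubt k hk.
  have n0 : 1 - (u k).[t] != 0.
    by apply/eqP => h; have := hk2; rewrite (_ : (u k).[t] = 1) ?normr1; [lra|move: h; lra].
  rewrite -geom_at.
  by rewrite mulrAC divff // mul1r.
apply: cvgM; last by apply: cvgV => //; apply: cvgB => //; exact: cvg_cst.
apply: cvgB; first exact: cvg_cst.
apply/cvg_seqP => e e0; have [K hK] := small_expr half0 e0.
exists (maxn N K) => k; rewrite geq_max => /andP[k1 k2]; rewrite sub0r normrN normrX.
apply: le_trans hK; apply: le_trans (_ : (1 / 2) ^+ k <= _).
  by rewrite lerXn2r ?nnegrE ?ubt //; lra.
by rewrite ler_wiXn2l //; lra.
Qed.

Lemma partial_sum_nrm r t n (c : {poly R}) : `|t| <= r ->
  `|\sum_(i < n) c`_i * t ^+ i| <= nrm r c.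
Proof.
move=> tr; have r0 : 0 <= r by exact: le_trans tr.
apply: le_trans (ler_norm_sum _ _ _) _.
rewrite (nrm_widen r (leq_maxr n (size c))).
rewrite (big_ord_widen _ (fun i => `|c`_i * t ^+ i|) (leq_maxl n (size c))) big_mkcond.
apply: ler_sum => i _; case: ifP => _; last by rewrite mulr_ge0 ?exprn_ge0.
by rewrite normrM normrX ler_wpM2l // lerXn2r ?nnegrE.
Qed.

(** Each coefficient converges because [nrm r] dominates r^i times the i-th one; partial sums are
    compared with those of the approximants uniformly in their length. *)
Lemma plim_pseries r p f : 0 < r -> plim r p f -> exists a : nat -> R,
  forall t, `|t| <= r -> pseries a t @ \oo --> f t.
Proof.
move=> r0 [pc pl].
have coefc i : exists l : R, (p k)`_i @[k --> \oo] --> l.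
  apply: cauchy_seq => e e0.
  have ri : 0 < r ^+ i by exact: exprn_gt0.
  have [|N hN] := pc (e * r ^+ i); first exact: mulr_gt0.
  exists N => k l hk hl; rewrite -(ler_pM2r ri); apply: le_trans (hN k l hk hl).
  rewrite -coefB; set c := p k - p l.
  rewrite (nrm_widen r (leq_maxr i.+1 (size c))).
  rewrite (bigD1 (Ordinal (leq_maxl i.+1 (size c)))) //= lerDl sumr_ge0 // => j _.
  by rewrite mulr_ge0 ?exprn_ge0 // ltW.
have {coefc}[a ha] := choice coefc; exists a => t tr.
apply/cvg_seqP => e e0; have e40 : 0 < e / 4 by rewrite divr_gt0.
have [N hN] := pc _ e40; have /cvg_seqP/(_ _ e40)[M hM] := pl t tr.
(* Beyond the size of [p k], its partial sums equal its value at t. *)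
pose k := maxn N M; exists (size (p k)) => n hn.
have -> : pseries a t n = \sum_(i < n) a i * t ^+ i by rewrite /pseries /series /= big_mkord.
have hk := hM k (leq_maxr _ _).
have pk : (p k).[t] = \sum_(i < n) (p k)`_i * t ^+ i.
  rewrite horner_coef (big_ord_widen _ (fun i => (p k)`_i * t ^+ i) hn) big_mkcond.
  by apply: eq_bigr => i _; case: ltnP => // h; rewrite nth_default ?mul0r.
have Tc : \sum_(i < n) (p l)`_i * t ^+ i @[l --> \oo] --> \sum_(i < n) a i * t ^+ i.
  elim: (n) => [|n' IH].
    by rewrite big_ord0; under eq_fun do rewrite big_ord0; exact: cvg_cst.
  rewrite big_ord_recr; under eq_fun do rewrite big_ord_recr.
  by apply: cvgD => //; apply: cvgMl; exact: ha.
have /cvg_seqP/(_ _ e40)[K hK] := Tc.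
pose l := maxn N K; have hl := hK l (leq_maxr _ _).
have hkl : `|\sum_(i < n) (p l)`_i * t ^+ i - (p k).[t]| <= e / 4.
  rewrite pk -sumrB; under eq_bigr do rewrite -mulrBl -coefB.
  by apply: le_trans (partial_sum_nrm _ _ tr) _; apply: hN; rewrite leq_maxl.
have -> : f t - \sum_(i < n) a i * t ^+ i = (f t - (p k).[t])
  - (\sum_(i < n) (p l)`_i * t ^+ i - (p k).[t])
  - (\sum_(i < n) a i * t ^+ i - \sum_(i < n) (p l)`_i * t ^+ i) by ring.
apply: le_trans (ler_normB _ _) _.
have := ler_normB (f t - (p k).[t]) (\sum_(i < n) (p l)`_i * t ^+ i - (p k).[t]); lra.
Qed.

Lemma analytic_real_analytic f : (forall x, analytic_at f x) -> real_analytic f.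
Proof.
move=> hf x; have [r r0 [p hp]] := hf x; have [a ha] := plim_pseries r0 hp.
exists a; apply/nbhs_ballP; exists r => // y; rewrite /ball /= => xy.
by have := ha (y - x); rewrite (addrC x) subrK; apply; rewrite distrC ltW.
Qed.

(** Derivatives are Cauchy on every disc at the price of one unit of radius. The quadratic Taylor
    remainder is bounded uniformly in k, so it passes to the limit and identifies g as the
    derivative of f. *)
Lemma entire_limit p : (forall r, 0 <= r -> nrm_cauchy r p) ->
  exists f g, [/\ forall t, (p k).[t] @[k --> \oo] --> f t,
    forall t, (p k)^`().[t] @[k --> \oo] --> g t,
    forall t, is_derive t (1 : R) f (g t) & forall x, analytic_at f x].
Proof.
move=> pc.
have lim_ex (q : nat -> {poly R}) : (forall r, 0 <= r -> nrm_cauchy r q) ->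
    forall t, exists l : R, (q k).[t] @[k --> \oo] --> l.
  move=> qc t; apply: cauchy_seq => e e0; have [N hN] := qc `|t| (normr_ge0 t) e e0.
  exists N => k l hk hl; rewrite -hornerN -hornerD.
  by apply: le_trans (horner_nrm _ (lexx `|t|)) (hN k l hk hl).
have dc r : 0 <= r -> nrm_cauchy r (fun k => (p k)^`()).
  move=> r0 e e0; have r10 : 0 <= r + 1 by lra.
  have [N hN] := pc _ r10 e e0; exists N => k l hk hl.
  by rewrite -derivB; apply: le_trans (nrm_deriv _ r0) (hN k l hk hl).
have ddc r : 0 <= r -> nrm_cauchy r (fun k => (p k)^`()^`()).
  move=> r0 e e0; have r10 : 0 <= r + 1 by lra.
  have [N hN] := dc _ r10 e e0; exists N => k l hk hl.
  by rewrite -derivB; apply: le_trans (nrm_deriv _ r0) (hN k l hk hl).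
have [f hf] := choice (lim_ex p pc); have [g hg] := choice (lim_ex _ dc).
exists f, g; split=> // [t|x].
- pose r := `|t| + 1; have r0 : 0 <= r by rewrite addr_ge0.
  have [B B0 [N hB]] := nrm_cauchy_bounded r0 (ddc r r0).
  have quad h : `|h| <= 1 -> `|f (t + h) - f t - h * g t| <= B * h ^+ 2.
    move=> h1; apply/ler_addgt0Pr => e e0.
    have /cvg_seqP/(_ _ e0)[M hM] : (p k).[t + h] - (p k).[t] - h * (p k)^`().[t]
        @[k --> \oo] --> f (t + h) - f t - h * g t.
      by apply: cvgB; [apply: cvgB|apply: cvgMr].
    pose k := maxn N M; have := hM k (leq_maxr _ _).
    have tr : `|t| <= r by rewrite /r lerDl.
    have thr : `|t + h| <= r by apply: le_trans (ler_normD _ _) _; rewrite /r lerD2l.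
    have := poly_taylor2 (p k) tr thr.
    have : nrm r (p k)^`()^`() * h ^+ 2 <= B * h ^+ 2.
      by rewrite ler_wpM2r ?sqr_ge0 // hB // leq_maxl.
    set z := (p k).[_] - _ - _ => a1 a2 a3.
    by have := ler_normD (f (t + h) - f t - h * g t - z) z; rewrite subrK; lra.
  have lim : h^-1 *: ((f \o shift t) (h *: (1 : R)) - f t) @[h --> 0^'] --> g t.
    apply/cvgrPdist_le => e e0; near=> h.
    have h0 : h != 0 by near: h; exact: nbhs_dnbhs_neq.
    have h1 : `|h| <= 1 by near: h; apply: dnbhs0_le.
    have he : `|h| <= e / B by near: h; apply: dnbhs0_le; rewrite divr_gt0.
    rewrite /= -[h *: 1]/(h * 1) mulr1 -[_ *: _]/(h^-1 * _) (addrC h).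
    have -> : g t - h^-1 * (f (t + h) - f t) = - (h^-1 * (f (t + h) - f t - h * g t)).
      by field.
    rewrite normrN normrM normfV ler_pdivrMl ?normr_gt0 //.
    apply: le_trans (quad h h1) _; rewrite -(real_normK (num_real h)) expr2 mulrCA.
    by rewrite ler_wpM2l // mulrC -ler_pdivlMr.
  split; first by apply/cvg_ex; exists (g t).
  exact: cvg_lim lim.
- exists 1; first exact: ltr01.
  exists (fun k => p k \Po ('X + x%:P)); split.
    move=> e e0; have x1 : 0 <= 1 + `|x| by rewrite addr_ge0.
    have [N hN] := pc _ x1 e e0; exists N => k l hk hl.
    rewrite -comp_polyB; apply: le_trans (nrm_shift _ _ ler01) (hN k l hk hl).
  move=> t _; under eq_fun do rewrite horner_comp hornerD hornerX hornerC addrC.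
  exact: hf.
Unshelve. all: by end_near. Qed.

End AnalyticLimits.

(** * The sequence of stages and its limit *)

Section LegendrianLine.
Context (R : realType) (m : nat).
Implicit Types (P Q : curve R m.+1) (t e : R) (A B : heis R m.+1).
Implicit Types (W : set (heis R m.+1)) (S : stage R m.+1).

Definition hpoint (x y : 'I_m.+1 -> R -> R) (s : R -> R) t : heis R m.+1 :=
  (\row_j x j t, \row_j y j t, s t).

Record legendrian_line W (x y dx dy : 'I_m.+1 -> R -> R) (s : R -> R) : Prop := {
  line_dx : forall j t, is_derive t (1 : R) (x j) (dx j t);
  line_dy : forall j t, is_derive t (1 : R) (y j) (dy j t);
  line_ds : forall t, is_derive t (1 : R) s (\sum_j y j t * dx j t);
  line_ax : forall j t, analytic_at (x j) t;
  line_ay : forall j t, analytic_at (y j) t;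
  line_as : forall t, analytic_at s t;
  line_in : forall t, W (hpoint x y s t);
  line_inj : injective (hpoint x y s);
  line_imm : forall t, dx 0 t != 0 \/ dy 0 t != 0;
  line_dense_right : forall A e T, W A -> 0 < e ->
    exists2 t, T <= t & nearH e A (hpoint x y s t);
  line_dense_left : forall A e T, W A -> 0 < e ->
    exists2 t, t <= T & nearH e A (hpoint x y s t) }.

Local Notation ratH := ('rV[rat]_m.+1 * 'rV[rat]_m.+1 * rat)%type.

Definition of_rat (c : ratH) : heis R m.+1 :=
  (map_mx ratr c.1.1, map_mx ratr c.1.2, ratr c.2).

Lemma rat_near (u e : R) : 0 < e -> exists q : rat, `|u - ratr q| <= e.
Proof.
move=> e0; have [|q] := @rat_in_itvoo R (u - e) (u + e); first lra.
rewrite in_itv /= => /andP[h1 h2]; exists q; rewrite ler_norml.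
by apply/andP; split; lra.
Qed.

Lemma of_rat_near A e : 0 < e -> exists c, nearH e A (of_rat c).
Proof.
move=> e0.
have [f hf] := choice (fun j => rat_near (A.1.1 0 j) e0).
have [g hg] := choice (fun j => rat_near (A.1.2 0 j) e0).
have [q hq] := rat_near A.2 e0.
by exists (\row_j f j, \row_j g j, q); split=> [j|j|] //=; rewrite !mxE.
Qed.

Lemma inv_nat_small e (T : R) : 0 < e -> exists n : nat, T <= n%:R /\ n.+1%:R^-1 <= e.
Proof.
move=> e0; pose n := maxn (Num.truncn `|T|).+1 (Num.truncn e^-1).
exists n; split.
  apply: le_trans (ler_norm T) _.
  have /Num.Theory.truncn_itv/andP[_ h] := normr_ge0 T.
  by apply: le_trans (ltW h) _; rewrite ler_nat leq_maxl.
have ei : 0 <= e^-1 by rewrite invr_ge0 ltW.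
have /Num.Theory.truncn_itv/andP[_ h] := ei.
rewrite -[leRHS]invrK lef_pV2 ?posrE ?invr_gt0 ?ltr0n //.
by apply: le_trans (ltW h) _; rewrite ler_nat ltnS leq_maxr.
Qed.

(* Approaching the rational point [c] up to 1/(n+1) at a time beyond [n]
   ([side] = true) or before [- n]; separating two rational intervals; being
   immersed on [-n, n]. *)
Definition task : Type :=
  ((ratH * nat * bool) + (rat * rat * rat * rat) + nat)%type.

(** Each requirement carries a margin of order [rad S], because the limit stays within [rad S] of
    [crv S]; separation needs twice that, both points being displaced. A task about a point outside
    W or about badly placed intervals is achieved vacuously. *)
Definition achieved W (T : task) S : Prop :=
  match T with
  | inl (inl (c, n, side)) => W (of_rat c) -> rad S <= n.+1%:R^-1 /\
      exists t, [/\ (if side then n%:R <= t else t <= - n%:R), `|t| <= time S &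
        nearH n.+1%:R^-1 (of_rat c) (ev (crv S) t)]
  | inl (inr (u1, v1, u2, v2)) => ratr u1 <= ratr v1 :> R -> ratr v1 < ratr u2 :> R ->
      ratr u2 <= ratr v2 :> R ->
      [/\ - time S <= ratr u1, ratr v2 <= time S & forall t1 t2,
        ratr u1 <= t1 <= ratr v1 -> ratr u2 <= t2 <= ratr v2 ->
        ~ nearH (2 * rad S) (ev (crv S) t1) (ev (crv S) t2)]
  | inr n => [/\ n.+1%:R <= time S, rad S <= n.+1%:R^-1 & forall t, `|t| <= time S ->
      rad S < `|(cx (crv S) 0)^`().[t]| \/ rad S < `|(cy (crv S) 0)^`().[t]|]
  end.

Lemma perform_task W (T : task) S : openH W -> (forall A B, W A -> W B -> leads W A B) ->
  valid W S -> exists S', [/\ valid W S', refines S S' & achieved W T S'].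
Proof.
move=> oW lW vS; have [t0 d0 hS] := vS.
have WS : W (ev (crv S) (time S)).
  apply: (hS (time S)); first by rewrite ger0_norm // ltW.
  by apply: nearH_refl; exact: ltW.
have inv0 n : 0 < n.+1%:R^-1 :> R by rewrite invr_gt0 ltr0n.
(* Going back, up to 1, to the end point of S merely serves to lengthen the time interval. *)
have grow S1 (T' : R) : valid W S1 -> exists S', [/\ valid W S', refines S1 S' & T' <= time S'].
  move=> v1; have [S' [v' r' t' _]] := visit T' oW (fun A WA => lW A _ WA WS) v1 ltr01.
  by exists S'.
case: T => [[[[c n] side]|[[[u1 v1] u2] v2]]|n] /=.
- have [Wc|nWc] := pselect (W (of_rat c)); last first.
    by exists S; split=> //; exact: refines_refl.
  have [S1 [v1 r1 c1 e1 d1]] := shrink vS (inv0 n).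
  have [t1 _ _] := v1.
  have tn S2 : n%:R <= time S2 -> 0 <= time S2 by apply: le_trans.
  case: side.
    have [S2 [v2 r2 t2 n2]] := visit n%:R oW (fun A WA => lW A _ WA Wc) v1 (inv0 n).
    exists S2; split=> //; first exact: refines_trans (ltW t0) r1 r2.
    move=> _; split; first exact: le_trans (refines_rad (ltW t1) r2) d1.
    by exists (time S2); rewrite ger0_norm ?tn.
  have [S2 [v2 r2 t2 n2]] := visit_left n%:R oW (fun A WA => lW A _ WA Wc) v1 (inv0 n).
  exists S2; split=> //; first exact: refines_trans (ltW t0) r1 r2.
  move=> _; split; first exact: le_trans (refines_rad (ltW t1) r2) d1.
  by exists (- time S2); rewrite normrN ger0_norm ?tn // lerN2.
- have [S1 [w1 r1 t1]] := grow S (Num.max (- ratr u1) (ratr v2)) vS.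
  move: t1; rewrite ge_max => /andP[a1 a2].
  have [b1|b1] := leP (ratr u1 : R) (ratr v1); last by exists S1; split.
  have [b2|b2] := ltP (ratr v1 : R) (ratr u2); last by exists S1; split.
  have [b3|b3] := leP (ratr u2 : R) (ratr v2); last by exists S1; split.
  have a1' : - time S1 <= ratr u1 by rewrite lerNl.
  have [S2 [w2 r2 e2 h2]] := separate w1 a1' b2 b1 b3 a2.
  exists S2; split=> //; first exact: refines_trans (ltW t0) r1 r2.
  by move=> _ _ _; rewrite e2; split.
- have [S1 [v1 r1 c1 e1 d1]] := shrink vS (inv0 n).
  have [S2 [v2 r2 t2]] := grow S1 n.+1%:R v1.
  have [S3 [v3 r3 e3 h3]] := immerse v2.
  have [t1 _ _] := v1; have [t2' _ _] := v2.
  exists S3; split=> //.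
    apply: refines_trans (ltW t0) r1 _; exact: refines_trans (ltW t1) r2 r3.
  split; first by rewrite e3.
    apply: le_trans (refines_rad (ltW t2') r3) _.
    exact: le_trans (refines_rad (ltW t1) r2) d1.
  by rewrite e3.
Qed.

(** Tasks form a countable type, and the k-th step performs the task of code k, if any. Once is
    enough for each task, since later stages are refinements. *)
Lemma stage_sequence W S0 : openH W -> (forall A B, W A -> W B -> leads W A B) ->
  valid W S0 -> exists S : nat -> stage R m.+1,
    [/\ forall k, valid W (S k), forall k l, (k <= l)%N -> refines (S k) (S l) &
     forall T : task, exists k, achieved W T (S k)].
Proof.
move=> oW lW v0.
have step (T : task * {S | valid W S}) : exists S' : {S | valid W S},
    refines (sval T.2) (sval S') /\ achieved W T.1 (sval S').
  have [S' [v' r' d']] := perform_task T.1 oW lW (svalP T.2).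
  by exists (exist _ S' v').
have [f hf] := choice step.
pose next k (S : {S | valid W S}) := if unpickle k is Some T then f (T, S) else S.
pose S := fix S k : {S | valid W S} := if k is k'.+1 then next k' (S k') else exist _ S0 v0.
have t0 k : 0 <= time (sval (S k)) by have [/ltW] := svalP (S k).
exists (fun k => sval (S k)); split=> [k|k l|T]; first exact: svalP.
- elim: l => [|l IH]; first by rewrite leqn0 => /eqP ->; exact: refines_refl.
  rewrite leq_eqVlt => /orP[/eqP ->|]; first exact: refines_refl.
  rewrite ltnS => /IH kl; apply: refines_trans kl _ => //=.
  rewrite /next; case: unpickle => [T|]; last exact: refines_refl.
  by have [] := hf (T, S l).
- exists (pickle T).+1; rewrite /= /next pickleK.
  by have [] := hf (T, S (pickle T)).
Qed.

Lemma limit_close (u : nat -> R) (a l d : R) k : u @ \oo --> l ->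
  (forall n, (k <= n)%N -> `|a - u n| <= d) -> `|a - l| <= d.
Proof.
move=> ul h; apply/ler_addgt0Pr => e e0; have /cvg_seqP/(_ _ e0)[N hN] := ul.
have h1 := hN (maxn N k) (leq_maxl _ _); have h2 := h (maxn N k) (leq_maxr _ _).
have -> : a - l = (a - u (maxn N k)) - (l - u (maxn N k)) by ring.
by apply: le_trans (ler_normB _ _) _; rewrite lerD.
Qed.

Lemma cvg_sum_seq (I : Type) (r : seq I) (u : I -> nat -> R) (l : I -> R) :
  (forall i, u i @ \oo --> l i) -> (\sum_(i <- r) u i k) @[k --> \oo] --> \sum_(i <- r) l i.
Proof.
move=> h; elim: r => [|i r IH].
  by rewrite big_nil; under eq_fun do rewrite big_nil; exact: cvg_cst.
by rewrite big_cons; under eq_fun do rewrite big_cons; apply: cvgD.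
Qed.

Theorem exists_legendrian_line W : openH W -> W !=set0 ->
  (forall A B, W A -> W B -> leads W A B) ->
  exists x y dx dy s, legendrian_line W x y dx dy s.
Proof.
move=> oW [A0 WA0] lW; have [e0 e00 hA0] := oW _ WA0.
pose P0 := Curve (fun j => (A0.1.1 0 j)%:P) (fun j => (A0.1.2 0 j)%:P) A0.2.
have evP0 t : ev P0 t = A0.
  have cs0 : cs P0 = (A0.2)%:P.
    apply: deriv_inj0; last by rewrite cs_at0 hornerC.
    by rewrite deriv_cs derivC big1 // => j _; rewrite derivC mulr0.
  rewrite /ev cs0 hornerC [in RHS](surjective_pairing A0) [in RHS](surjective_pairing A0.1).
  by congr (_, _, _); apply/rowP => j; rewrite mxE hornerC.
have v0 : valid W (Stage P0 1 e0).
  by split=> //= t _ z; rewrite evP0; exact: hA0.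
have [S [vS rS dS]] := stage_sequence oW lW v0.
have T0 k : 0 <= time (S k) by have [/ltW] := vS k.
(* The immersion tasks also force the times to infinity and the radii to 0. *)
have fine (r e : R) : 0 < e -> exists2 k, r + 1 <= time (S k) & rad (S k) <= e.
  move=> ep; have [n [rn ne]] := inv_nat_small r ep.
  have [k [h1 h2 _]] := dS (inr n); exists k; last exact: le_trans ne.
  by apply: le_trans h1; rewrite -natr1 lerD2r.
have radpos k : 0 < rad (S k) by have [] := vS k.
have close k l : (k <= l)%N -> near_curve (time (S k)) (rad (S k)) (crv (S k)) (crv (S l)).
  move=> kl; have [_ [e [[h1 h2 h3] he]]] := rS k l kl; have := radpos l => r0.
  by split=> [j|j|]; (apply: le_trans; [try exact: h1; try exact: h2; exact: h3|lra]).
have cauchy (c : curve R m.+1 -> {poly R}) :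
    (forall k l, (k <= l)%N -> nrm (time (S k)) (c (crv (S k)) - c (crv (S l))) <= rad (S k)) ->
    forall r, 0 <= r -> nrm_cauchy r (fun k => c (crv (S k))).
  move=> hc r r0 e ep; have [|N hN1 hN2] := fine r (e / 2); first by rewrite divr_gt0.
  exists N => k l hk hl.
  have rN : r <= time (S N) by lra.
  have a1 := le_trans (nrm_le _ r0 rN) (hc N k hk).
  have a2 := le_trans (nrm_le _ r0 rN) (hc N l hl).
  have -> : c (crv (S k)) - c (crv (S l)) =
    (c (crv (S N)) - c (crv (S l))) - (c (crv (S N)) - c (crv (S k))) by ring.
  by apply: le_trans (nrmB _ _ r0) _; lra.
have cX j := cauchy (fun P => cx P j) (fun k l kl => let: And3 h _ _ := close k l kl in h j).
have cY j := cauchy (fun P => cy P j) (fun k l kl => let: And3 _ h _ := close k l kl in h j).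
have cS := cauchy (@cs R m.+1) (fun k l kl => let: And3 _ _ h := close k l kl in h).
have [x hx] := choice (fun j => entire_limit (cX j)).
have {hx}[dx hx] := choice hx.
have [y hy] := choice (fun j => entire_limit (cY j)).
have {hy}[dy hy] := choice hy.
have [s [ds [s1 s2 s3 s4]]] := entire_limit cS.
have dsE t : ds t = \sum_j y j t * dx j t.
  apply: (cvg_unique _ (s2 t)) => //.
  have sumE k : (cs (crv (S k)))^`().[t] =
      \sum_j (cy (crv (S k)) j).[t] * (cx (crv (S k)) j)^`().[t].
    by rewrite deriv_cs horner_sum_poly; apply: eq_bigr => j _; rewrite hornerM.
  rewrite (funext sumE).
  apply: cvg_sum_seq => j; have [x1 x2 _ _] := hx j; have [y1 y2 _ _] := hy j.
  by apply: cvgM.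
have near k t : `|t| <= time (S k) -> nearH (rad (S k)) (ev (crv (S k)) t) (hpoint x y s t).
  move=> ht; split=> [j|j|] /=; rewrite ?mxE.
  - have [x1 _ _ _] := hx j; apply: (limit_close (x1 t)) => n kn.
    by have [h _ _] := near_ev (close k n kn) ht; have := h j; rewrite !mxE.
  - have [y1 _ _ _] := hy j; apply: (limit_close (y1 t)) => n kn.
    by have [_ h _] := near_ev (close k n kn) ht; have := h j; rewrite !mxE.
  - apply: (limit_close (s1 t)) => n kn.
    by have [_ _ h] := near_ev (close k n kn) ht.
(* The unit of time added to |t| is the radius lost in [nrm_deriv]. *)
have dnear k t : `|t| + 1 <= time (S k) ->
    `|(cx (crv (S k)) 0)^`().[t] - dx 0 t| <= rad (S k) /\
    `|(cy (crv (S k)) 0)^`().[t] - dy 0 t| <= rad (S k).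
  move=> ht; have [_ x2 _ _] := hx 0; have [_ y2 _ _] := hy 0.
  have D (p q : {poly R}) : nrm (time (S k)) (p - q) <= rad (S k) ->
      `|p^`().[t] - q^`().[t]| <= rad (S k).
    move=> h; rewrite -hornerN -hornerD -derivB.
    apply: le_trans (horner_nrm _ (lexx `|t|)) _.
    apply: le_trans (nrm_deriv _ (normr_ge0 t)) _; apply: le_trans h.
    by apply: nrm_le => //; rewrite addr_ge0.
  split; [apply: (limit_close (x2 t)) => n kn|apply: (limit_close (y2 t)) => n kn].
    by have [h _ _] := close k n kn; exact: D (h 0).
  by have [_ h _] := close k n kn; exact: D (h 0).
have time_le k t : `|t| + 1 <= time (S k) -> `|t| <= time (S k) by lra.
(* The three errors are A to the rational point c, c to the stage, and the stage to the limit.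
   Choosing c within e1 of A keeps it in W, so that its task is not vacuous. *)
have visits A e (T : R) (side : bool) : W A -> 0 < e ->
    exists2 t, (if side then T <= t else t <= T) & nearH e A (hpoint x y s t).
  move=> WA ep; have [e1 e10 h1] := oW _ WA.
  pose e' := Num.min e1 (e / 3).
  have e'0 : 0 < e' by rewrite lt_min e10 /=; lra.
  have e'e : e' <= e / 3 by rewrite ge_min lexx orbT.
  have [c hc] := of_rat_near A e'0.
  have Wc : W (of_rat c) by apply: h1; apply: nearH_le hc; rewrite ge_min lexx.
  have [n [Tn ne]] := inv_nat_small `|T| e'0.
  have [k /= /(_ Wc)[hr [t [t1 t2 t3]]]] := dS (inl (inl (c, n, side))).
  exists t.
    move: Tn; rewrite ler_norml; case: (side) t1 => /= t1 /andP[? ?]; lra.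
  apply: nearH_le (nearH_trans hc (nearH_trans t3 (near k t t2))).
  by move: hr ne; set w := n.+1%:R^-1; lra.
exists x, y, dx, dy, s; split.
- by move=> j t; have [_ _ h _] := hx j.
- by move=> j t; have [_ _ h _] := hy j.
- by move=> t; rewrite -dsE.
- by move=> j t; have [_ _ _ h] := hx j.
- by move=> j t; have [_ _ _ h] := hy j.
- by [].
- move=> t; have [k hk _] := fine `|t| 1 ltr01; have tk := time_le k t hk.
  by have [_ _ h] := vS k; apply: (h t tk); exact: near.
- move=> t1 t2 eq12; apply: contrapT => ne.
  wlog lt12 : t1 t2 eq12 ne / t1 < t2 => [H|].
    have /eqP := ne; rewrite neq_lt => /orP[lt|lt]; first exact: (H t1 t2).
    by apply: (H t2 t1) => // h; apply: ne.
  have itv (u v : R) : u < v -> exists q : rat, u < ratr q /\ ratr q < v.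
    by move=> /rat_in_itvoo[q]; rewrite in_itv /= => /andP[? ?]; exists q.
  (* Rational intervals around t1 and t2, kept disjoint by the midpoint. *)
  have [u1 [a1 a2]] : exists q : rat, t1 - 1 < ratr q /\ ratr q < t1 by apply: itv; lra.
  have [v1 [b1 b2]] : exists q : rat, t1 < ratr q /\ ratr q < (t1 + t2) / 2.
    by apply: itv; lra.
  have [u2 [c1 c2]] : exists q : rat, (t1 + t2) / 2 < ratr q /\ ratr q < t2.
    by apply: itv; lra.
  have [v2 [d1 d2]] : exists q : rat, t2 < ratr q /\ ratr q < t2 + 1 by apply: itv; lra.
  have [k /= [||| l1 l2 /(_ t1 t2) sep]] := dS (inl (inr (u1, v1, u2, v2))); try lra.
  have h1 : `|t1| <= time (S k) by rewrite ler_norml; apply/andP; split; lra.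
  have h2 : `|t2| <= time (S k) by rewrite ler_norml; apply/andP; split; lra.
  apply: sep; [apply/andP; split; lra|apply/andP; split; lra|].
  have n1 := near k t1 h1; rewrite eq12 in n1.
  by have := nearH_trans n1 (nearHC (near k t2 h2)); apply: nearH_le; lra.
- move=> t; have [n [tn _]] := inv_nat_small `|t| ltr01.
  have [k /= [h1 h2 h3]] := dS (inr n).
  have tk : `|t| + 1 <= time (S k) by apply: le_trans h1; rewrite -natr1 lerD2r.
  have [d1 d2] := dnear k t tk.
  have [h|h] := h3 t (time_le k t tk); [left|right]; apply/eqP => z.
    by move: d1; rewrite z subr0; lra.
  by move: d2; rewrite z subr0; lra.
- by move=> A e T WA ep; exact: (visits A e T true).
- by move=> A e T WA ep; exact: (visits A e T false).
Qed.

End LegendrianLine.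

(** * Derivatives and analyticity of complex-valued functions of a real variable *)

Section ComplexCalculus.
Context (R : realType).
Local Notation C := R[i].
Implicit Types (F G : R -> C) (t : R) (u v w z : C).
Local Notation Re := complex.Re.
Local Notation Im := complex.Im.

Lemma cplx_eq u v : Re u = Re v -> Im u = Im v -> u = v.
Proof. by case: u v => [a b] [c d] /= -> ->. Qed.

Lemma ReD u v : Re (u + v) = Re u + Re v. Proof. by case: u v => [a b] [c d]. Qed.
Lemma ImD u v : Im (u + v) = Im u + Im v. Proof. by case: u v => [a b] [c d]. Qed.
Lemma ReN u : Re (- u) = - Re u. Proof. by case: u. Qed.
Lemma ImN u : Im (- u) = - Im u. Proof. by case: u. Qed.
Lemma ReM u v : Re (u * v) = Re u * Re v - Im u * Im v.
Proof. by case: u v => [a b] [c d]. Qed.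
Lemma ImM u v : Im (u * v) = Re u * Im v + Im u * Re v.
Proof. by case: u v => [a b] [c d]. Qed.
Lemma ReV u : Re u^-1 = Re u / (Re u ^+ 2 + Im u ^+ 2). Proof. by case: u. Qed.
Lemma ImV u : Im u^-1 = - (Im u / (Re u ^+ 2 + Im u ^+ 2)). Proof. by case: u. Qed.

Lemma Re_sum (I : Type) (r : seq I) (P : pred I) (f : I -> C) :
  Re (\sum_(i <- r | P i) f i) = \sum_(i <- r | P i) Re (f i).
Proof. by apply: (big_rec2 (fun (a : C) (b : R) => Re a = b)) => // i a b _ <-; rewrite ReD. Qed.

Lemma Im_sum (I : Type) (r : seq I) (P : pred I) (f : I -> C) :
  Im (\sum_(i <- r | P i) f i) = \sum_(i <- r | P i) Im (f i).
Proof. by apply: (big_rec2 (fun (a : C) (b : R) => Im a = b)) => // i a b _ <-; rewrite ImD. Qed.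

Lemma conjE u : u^* = Complex (Re u) (- Im u).
Proof. by case: u. Qed.

Lemma cplx_neq0 u : u != 0 -> Re u ^+ 2 + Im u ^+ 2 != 0.
Proof.
move=> u0; rewrite paddr_eq0 ?sqr_ge0 // !expf_eq0 /=; apply: contra u0 => /andP[/eqP a /eqP b].
by apply/eqP/cplx_eq.
Qed.

Definition cderive F t v :=
  is_derive t (1 : R) (fun x => Re (F x)) (Re v) /\ is_derive t (1 : R) (fun x => Im (F x)) (Im v).

Lemma cderive_eq F t v w : cderive F t v -> v = w -> cderive F t w.
Proof. by move=> ? <-. Qed.

Lemma cderive_cst t z : cderive (fun=> z) t 0.
Proof. by split; exact: is_derive_cst. Qed.

Lemma cderiveD F G t v w : cderive F t v -> cderive G t w ->
  cderive (fun x => F x + G x) t (v + w).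
Proof.
move=> [f1 f2] [g1 g2]; split.
  by rewrite ReD (_ : (fun _ => _) = (fun x => Re (F x)) + (fun x => Re (G x)));
    [exact: is_deriveD|apply/funext => x; rewrite ReD].
by rewrite ImD (_ : (fun _ => _) = (fun x => Im (F x)) + (fun x => Im (G x)));
  [exact: is_deriveD|apply/funext => x; rewrite ImD].
Qed.

Lemma real_deriveM (f g : R -> R) t (df dg : R) : is_derive t (1 : R) f df ->
  is_derive t (1 : R) g dg -> is_derive t (1 : R) (fun x => f x * g x) (df * g t + f t * dg).
Proof.
move=> hf hg; have h := is_deriveM hf hg.
by apply: is_derive_eq; rewrite -[_ *: dg]/(_ * dg) -[_ *: df]/(_ * df) addrC (mulrC df).
Qed.

Lemma real_deriveD (f g : R -> R) t (df dg : R) : is_derive t (1 : R) f df ->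
  is_derive t (1 : R) g dg -> is_derive t (1 : R) (fun x => f x + g x) (df + dg).
Proof. by move=> hf hg; exact: (is_deriveD hf hg). Qed.

Lemma real_deriveN (f : R -> R) t (df : R) : is_derive t (1 : R) f df ->
  is_derive t (1 : R) (fun x => - f x) (- df).
Proof. by move=> hf; exact: (is_deriveN hf). Qed.

Lemma real_deriveV (f : R -> R) t (df : R) : f t != 0 -> is_derive t (1 : R) f df ->
  is_derive t (1 : R) (fun x => (f x)^-1) (- df / f t ^+ 2).
Proof.
move=> f0 hf; have h := is_deriveV f0 hf; apply: is_derive_eq.
by rewrite -[_ *: df]/(_ * df) mulNr mulrC mulNr.
Qed.

Lemma real_derive_sum (I : Type) (r : seq I) (f : I -> R -> R) t (df : I -> R) :
  (forall i, is_derive t (1 : R) (f i) (df i)) ->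
  is_derive t (1 : R) (fun x => \sum_(i <- r) f i x) (\sum_(i <- r) df i).
Proof.
move=> h; elim: r => [|i r IH].
  by rewrite big_nil; under eq_fun do rewrite big_nil; exact: is_derive_cst.
rewrite big_cons; under eq_fun do rewrite big_cons.
exact: real_deriveD.
Qed.

Lemma cderiveM F G t v w : cderive F t v -> cderive G t w ->
  cderive (fun x => F x * G x) t (v * G t + F t * w).
Proof.
move=> [f1 f2] [g1 g2]; split.
  under eq_fun do rewrite ReM.
  have := real_deriveD (real_deriveM f1 g1) (real_deriveN (real_deriveM f2 g2)).
  by congr is_derive; rewrite ReD !ReM; ring.
under eq_fun do rewrite ImM.
have := real_deriveD (real_deriveM f1 g2) (real_deriveM f2 g1).
by congr is_derive; rewrite ImD !ImM; ring.
Qed.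

Lemma cderiveV F t v : F t != 0 -> cderive F t v ->
  cderive (fun x => (F x)^-1) t (- v * (F t)^-1 * (F t)^-1).
Proof.
move=> F0 [f1 f2]; have N0 := cplx_neq0 F0.
have dN : is_derive t (1 : R) (fun x => Re (F x) ^+ 2 + Im (F x) ^+ 2)
    (2 * Re (F t) * Re v + 2 * Im (F t) * Im v).
  have := real_deriveD (real_deriveM f1 f1) (real_deriveM f2 f2).
  by congr is_derive; ring.
have dV := @real_deriveV (fun x => Re (F x) ^+ 2 + Im (F x) ^+ 2) _ _ N0 dN.
split.
  under eq_fun do rewrite ReV.
  have := real_deriveM f1 dV; congr is_derive.
  rewrite !(ReM, ImM, ReN, ImN, ReV, ImV).
  by field.
under eq_fun do rewrite ImV.
have := real_deriveN (real_deriveM f2 dV); congr is_derive.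
rewrite !(ReM, ImM, ReN, ImN, ReV, ImV).
by field.
Qed.

Lemma cderive_sum (I : Type) (r : seq I) (F : I -> R -> C) t (v : I -> C) :
  (forall i, cderive (F i) t (v i)) ->
  cderive (fun x => \sum_(i <- r) F i x) t (\sum_(i <- r) v i).
Proof.
move=> h; elim: r => [|i r IH].
  by rewrite big_nil; under eq_fun do rewrite big_nil; exact: cderive_cst.
rewrite big_cons; under eq_fun do rewrite big_cons.
exact: cderiveD.
Qed.

Lemma velocityE n (f : R -> 'rV[C]_n) t (v : 'rV[C]_n) :
  (forall j, cderive (fun x => f x 0 j) t (v 0 j)) -> velocity f t = v.
Proof.
move=> h; apply/rowP => j; rewrite mxE; have [[_ h1] [_ h2]] := h j.
by apply: cplx_eq; rewrite /= derive1E.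
Qed.

Definition canalytic F x :=
  analytic_at (fun t => Re (F t)) x /\ analytic_at (fun t => Im (F t)) x.

Lemma canalytic_cst x z : canalytic (fun=> z) x.
Proof. by split; exact: analytic_cst. Qed.

Lemma canalyticD F G x : canalytic F x -> canalytic G x -> canalytic (fun t => F t + G t) x.
Proof.
move=> [f1 f2] [g1 g2]; split.
  by under eq_fun do rewrite ReD; exact: analyticD.
by under eq_fun do rewrite ImD; exact: analyticD.
Qed.

Lemma analyticN (f : R -> R) x : analytic_at f x -> analytic_at (fun t => - f t) x.
Proof.
move=> h; under eq_fun do rewrite -mulN1r.
exact: analyticM (analytic_cst x (-1)) h.
Qed.

Lemma canalyticM F G x : canalytic F x -> canalytic G x -> canalytic (fun t => F t * G t) x.
Proof.
move=> [f1 f2] [g1 g2]; split.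
  under eq_fun do rewrite ReM.
  exact: analyticD (analyticM f1 g1) (analyticN (analyticM f2 g2)).
under eq_fun do rewrite ImM.
exact: analyticD (analyticM f1 g2) (analyticM f2 g1).
Qed.

Lemma canalyticV F x : F x != 0 -> canalytic F x -> canalytic (fun t => (F t)^-1) x.
Proof.
move=> F0 [f1 f2].
have aN : analytic_at (fun t => Re (F t) ^+ 2 + Im (F t) ^+ 2) x.
  exact: analyticD (analyticM f1 f1) (analyticM f2 f2).
have aV := @analyticV R (fun t => Re (F t) ^+ 2 + Im (F t) ^+ 2) x aN (cplx_neq0 F0); split.
  by under eq_fun do rewrite ReV; exact: analyticM.
by under eq_fun do rewrite ImV; apply: analyticN; exact: analyticM.
Qed.

Lemma analytic_sum (I : Type) (r : seq I) (f : I -> R -> R) x :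
  (forall i, analytic_at (f i) x) -> analytic_at (fun t => \sum_(i <- r) f i t) x.
Proof.
move=> h; elim: r => [|i r IH].
  by under eq_fun do rewrite big_nil; exact: analytic_cst.
by under eq_fun do rewrite big_cons; exact: analyticD.
Qed.

Lemma canalytic_sum (I : Type) (r : seq I) (F : I -> R -> C) x :
  (forall i, canalytic (F i) x) -> canalytic (fun t => \sum_(i <- r) F i t) x.
Proof.
move=> h; elim: r => [|i r IH].
  by under eq_fun do rewrite big_nil; exact: canalytic_cst.
by under eq_fun do rewrite big_cons; exact: canalyticD.
Qed.

Lemma canalytic_curve n (f : R -> 'rV[C]_n) :
  (forall x j, canalytic (fun t => f t 0 j) x) -> real_analytic_curve f.
Proof.
by move=> h j; split; apply: analytic_real_analytic => x; have [] := h x j.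
Qed.

End ComplexCalculus.

(** * Continuity of complex-valued maps *)

Section ComplexTopology.
Context (R : realType) (T : topologicalType).
Local Notation C := R[i].
Local Notation Re := complex.Re.
Local Notation Im := complex.Im.
Implicit Types (x : T).

Lemma ltc_real (a b : R) : (real_complex R a < real_complex R b) = (a < b).
Proof. by rewrite ltcE /= eqxx. Qed.

(** The order of R[i] makes positive elements real, so the radii of its balls are real numbers. *)
Lemma posc_real (e : C) : 0 < e -> 0 < Re e /\ e = real_complex R (Re e).
Proof.
rewrite ltcE /= => /andP[/eqP h ->]; split=> //.
by apply: cplx_eq.
Qed.

Lemma cont_Re x (f : T -> C) : {for x, continuous f} -> {for x, continuous (fun t => Re (f t))}.
Proof.
move=> cf; apply/cvgrPdist_lt => e e0.
have e0' : 0 < real_complex R e by rewrite ltc_real.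
have /cvgrPdist_lt/(_ _ e0') := cf; apply: filterS => t h.
have := le_lt_trans (normc_ge_Re _) h; rewrite ltc_real.
by rewrite ReD ReN.
Qed.

Lemma cont_Im x (f : T -> C) : {for x, continuous f} -> {for x, continuous (fun t => Im (f t))}.
Proof.
move=> cf; have -> : (fun t => Im (f t)) = (fun t => Re (f t * Complex 0 (-1))).
  by apply/funext => t; rewrite ReM /=; ring.
by apply: (@cont_Re x (fun t => f t * Complex 0 (-1))); apply: cvgM; [exact: cf|exact: cvg_cst].
Qed.

Lemma cont_real x (f : T -> R) : {for x, continuous f} ->
  {for x, continuous (fun t => real_complex R (f t))}.
Proof.
move=> cf; apply/cvgrPdist_lt => e /posc_real[e0 ->].
have /cvgrPdist_lt/(_ _ e0) := cf; apply: filterS => t h.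
rewrite -(rmorphB (real_complex R)) normc_def /= expr0n addr0 sqrtr_sqr.
by rewrite ltc_real.
Qed.

Lemma cont_cplx x (f g : T -> R) : {for x, continuous f} -> {for x, continuous g} ->
  {for x, continuous (fun t => Complex (f t) (g t))}.
Proof.
move=> cf cg.
have -> : (fun t => Complex (f t) (g t)) =
    (fun t => real_complex R (f t) + Complex 0 1 * real_complex R (g t)).
  by apply/funext => t; rewrite [LHS]complexE.
apply: cvgD; first exact: cont_real.
by apply: cvgM; [exact: cvg_cst|exact: cont_real].
Qed.

Lemma cont_cst (K : numFieldType) x (c : K) : {for x, continuous (fun=> c)}.
Proof. exact: cvg_cst. Qed.

Lemma contD (K : numFieldType) x (f g : T -> K) : {for x, continuous f} ->
  {for x, continuous g} -> {for x, continuous (fun t => f t + g t)}.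
Proof. exact: cvgD. Qed.

Lemma contN (K : numFieldType) x (f : T -> K) : {for x, continuous f} ->
  {for x, continuous (fun t => - f t)}.
Proof. exact: cvgN. Qed.

Lemma contM (K : numFieldType) x (f g : T -> K) : {for x, continuous f} ->
  {for x, continuous g} -> {for x, continuous (fun t => f t * g t)}.
Proof. exact: cvgM. Qed.

Lemma contV (K : numFieldType) x (f : T -> K) : f x != 0 -> {for x, continuous f} ->
  {for x, continuous (fun t => (f t)^-1)}.
Proof. exact: cvgV. Qed.

Lemma cont_sum (K : numFieldType) (I : Type) (r : seq I) x (f : I -> T -> K) :
  (forall i, {for x, continuous (f i)}) ->
  {for x, continuous (fun t => \sum_(i <- r) f i t)}.
Proof.
move=> h; elim: r => [|i r IH].
  rewrite (_ : (fun _ => _) = fun=> 0); first exact: cvg_cst.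
  by apply/funext => t; rewrite big_nil.
rewrite (_ : (fun _ => _) = fun t => f i t + \sum_(j <- r) f j t).
  by apply: cvgD; [exact: h|exact: IH].
by apply/funext => t; rewrite big_cons.
Qed.

Lemma cont_row (K : numFieldType) n x (F : T -> 'rV[K]_n) :
  (forall j, {for x, continuous (fun t => F t 0 j)}) -> {for x, continuous F}.
Proof.
move=> h U /nbhs_ballP[e /= e0 hU].
have hj j : nbhs x [set t | ball (F x 0 j) e (F t 0 j)].
  by have /cvg_ballP/(_ e e0) := h j.
have hF := @filter_forall T 'I_n (fun j => [set t | ball (F x 0 j) e (F t 0 j)]) (nbhs x) (nbhs_filter x) hj.
move: hF; apply: filterS => t ht; apply: hU; split=> // i j; rewrite ord1; exact: ht.
Qed.

End ComplexTopology.

(** * The Cayley transform and its contact geometry *)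

Section CayleyChart.
Context (R : realType) (m : nat).
Local Notation C := R[i].
Local Notation Re := complex.Re.
Local Notation Im := complex.Im.
Local Notation I := (Complex 0 1 : C).
Implicit Types (A : heis R m.+1) (u v z : 'rV[C]_m.+2).

Definition hw A j : C := Complex (A.1.1 0 j) (A.1.2 0 j).

(** The imaginary part is |w|^2, the equation of the boundary of the Siegel domain. In the real
    part, the term in x y turns the symmetric expression y dx - x dy of the contact form into a
    multiple of y dx. *)
Definition hzeta A : C := Complex (4 * A.2 - 2 * \sum_j A.1.1 0 j * A.1.2 0 j)
  (\sum_j (A.1.1 0 j ^+ 2 + A.1.2 0 j ^+ 2)).

(* The Cayley transform from the Siegel domain Im zeta > |w|^2 to the ball; it
   pulls the contact structure of the sphere back to dzeta = 2 i conj(w) dw,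
   that is, ds = y dx. *)
Definition cayley A : 'rV[C]_m.+2 := \row_k (if unlift ord0 k is Some j
  then 2 * hw A j / (hzeta A + I) else (hzeta A - I) / (hzeta A + I)).

Lemma cayley0 A : cayley A 0 ord0 = (hzeta A - I) / (hzeta A + I).
Proof. by rewrite mxE unlift_none. Qed.

Lemma cayleyS A j : cayley A 0 (lift ord0 j) = 2 * hw A j / (hzeta A + I).
Proof. by rewrite mxE liftK. Qed.

Lemma hzeta_neq0 A : hzeta A + I != 0.
Proof.
apply/eqP => /(congr1 (@complex.Im R)); rewrite ImD /= => h.
have : 0 <= \sum_j (A.1.1 0 j ^+ 2 + A.1.2 0 j ^+ 2).
  by apply: sumr_ge0 => j _; rewrite addr_ge0 ?sqr_ge0.
lra.
Qed.

Lemma I2 : I * I = -1.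
Proof. by apply: cplx_eq; rewrite ?ReM ?ImM /=; ring. Qed.

Lemma conjI : I^* = - I.
Proof. by rewrite conjE; apply: cplx_eq; rewrite /= ?oppr0. Qed.

Lemma conjD (u v : C) : (u + v)^* = u^* + v^*. Proof. exact: rmorphD. Qed.
Lemma conjB (u v : C) : (u - v)^* = u^* - v^*. Proof. exact: rmorphB. Qed.
Lemma conjM (u v : C) : (u * v)^* = u^* * v^*. Proof. exact: rmorphM. Qed.
Lemma conjdiv (u v : C) : (u / v)^* = u^* / v^*. Proof. exact: fmorph_div. Qed.
Lemma conj_nat n : (n%:R : C)^* = n%:R. Proof. exact: rmorph_nat. Qed.
Lemma conj_neq0 (u : C) : u != 0 -> u^* != 0. Proof. by rewrite fmorph_eq0. Qed.

Lemma half_sub_conj (z : C) : - I * (z - z^*) / 2 = real_complex R (Im z).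
Proof.
rewrite conjE; have h : (2 : C) != 0 by rewrite pnatr_eq0.
apply: (mulIf h); rewrite divfK //.
have -> : (2 : C) = real_complex R 2 by rewrite rmorph_nat.
by apply: cplx_eq; rewrite ?(ReM, ImM, ReD, ImD, ReN, ImN) /=; ring.
Qed.

(** Writing Im zeta through zeta and its conjugate makes the identities on the sphere rational in
    these two, hence accessible to [field]. *)
Lemma hw_norm A : \sum_j hw A j * (hw A j)^* = - I * (hzeta A - (hzeta A)^*) / 2.
Proof.
rewrite half_sub_conj; apply: cplx_eq; rewrite ?Re_sum ?Im_sum.
  by apply: eq_bigr => j _; rewrite conjE ReM /=; ring.
by rewrite big1 // => j _; rewrite conjE ImM /=; ring.
Qed.

Lemma dotmx_sum n (u v : 'rV[C]_n) : dotmx u v = \sum_k u 0 k * (v 0 k)^*.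
Proof. by rewrite dotmxE mxE; apply: eq_bigr => k _; rewrite !mxE. Qed.

Lemma conj_cayley0 A : (cayley A 0 ord0)^* = ((hzeta A)^* + I) / ((hzeta A)^* - I).
Proof. by rewrite cayley0 conjdiv conjB conjD conjI opprK. Qed.

Lemma conj_cayleyS A j :
  (cayley A 0 (lift ord0 j))^* = 2 * (hw A j)^* / ((hzeta A)^* - I).
Proof. by rewrite cayleyS conjdiv conjM conjD conjI conj_nat. Qed.

Lemma hzetac_neq0 A : (hzeta A)^* - I != 0.
Proof.
by have := conj_neq0 (hzeta_neq0 A); rewrite conjD conjI.
Qed.

Lemma cayley_sphere A : dotmx (cayley A) (cayley A) = 1.
Proof.
have D0 := hzeta_neq0 A; have Dc0 := hzetac_neq0 A.
rewrite dotmx_sum big_ord_recl conj_cayley0 cayley0.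
under eq_bigr do rewrite conj_cayleyS cayleyS.
have -> : \sum_(i < m.+1) 2 * hw A i / (hzeta A + I) * (2 * (hw A i)^* / ((hzeta A)^* - I))
    = 4 / ((hzeta A + I) * ((hzeta A)^* - I)) * \sum_j hw A j * (hw A j)^*.
  rewrite mulr_sumr; apply: eq_bigr => j _; field.
  by do ?[apply/andP; split].
rewrite hw_norm; field.
by do ?[apply/andP; split].
Qed.

Definition dcayley A (dz : C) (dw : 'I_m.+1 -> C) : 'rV[C]_m.+2 :=
  \row_k (if unlift ord0 k is Some j
    then 2 * dw j / (hzeta A + I) - 2 * hw A j * dz / (hzeta A + I) ^+ 2
    else 2 * I * dz / (hzeta A + I) ^+ 2).

(** The hypothesis is dzeta = 2 i conj(w) dw. The conclusion, Hermitian orthogonality to the point,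
    expresses complex tangency. *)
Lemma dcayley_contact A dz dw : \sum_j dw j * (hw A j)^* = - I * dz / 2 ->
  dotmx (dcayley A dz dw) (cayley A) = 0.
Proof.
move=> hdz; have D0 := hzeta_neq0 A; have Dc0 := hzetac_neq0 A.
rewrite dotmx_sum big_ord_recl conj_cayley0 mxE unlift_none.
under eq_bigr do rewrite conj_cayleyS mxE liftK.
have -> : \sum_(i < m.+1) (2 * dw i / (hzeta A + I) - 2 * hw A i * dz / (hzeta A + I) ^+ 2)
      * (2 * (hw A i)^* / ((hzeta A)^* - I))
    = 4 / ((hzeta A + I) * ((hzeta A)^* - I)) * \sum_j dw j * (hw A j)^*
     - 4 * dz / ((hzeta A + I) ^+ 2 * ((hzeta A)^* - I)) * \sum_j hw A j * (hw A j)^*.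
  rewrite !mulr_sumr -sumrB; apply: eq_bigr => j _; field.
  by do ?[apply/andP; split].
rewrite hdz hw_norm; field.
by do ?[apply/andP; split].
Qed.

Lemma dcayley_eq0 A dz dw : dcayley A dz dw = 0 -> forall j, dw j = 0.
Proof.
have D0 := hzeta_neq0 A; have two0 : (2 : C) != 0 by rewrite pnatr_eq0.
have I0 : I != 0.
  by apply/eqP => h; have := I2; rewrite h mul0r => /eqP; rewrite eq_sym oppr_eq0 oner_eq0.
move=> h; have dz0 : dz = 0.
  have /rowP/(_ ord0) := h; rewrite !mxE unlift_none => /eqP.
  rewrite !mulf_eq0 invr_eq0 expf_eq0 /= (negPf D0) (negPf two0) (negPf I0) !orbF /=.
  by move/eqP.
move=> j; have /rowP/(_ (lift ord0 j)) := h; rewrite !mxE liftK dz0 mulr0 mul0r subr0 => /eqP.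
by rewrite !mulf_eq0 invr_eq0 (negPf D0) (negPf two0) orbF /= => /eqP.
Qed.

Lemma cayley_derive (x y dx dy : 'I_m.+1 -> R -> R) (s : R -> R) t :
  (forall j, is_derive t (1 : R) (x j) (dx j t)) ->
  (forall j, is_derive t (1 : R) (y j) (dy j t)) ->
  is_derive t (1 : R) s (\sum_j y j t * dx j t) ->
  exists dz dw, [/\ forall j, dw j = Complex (dx j t) (dy j t),
    \sum_j dw j * (hw (hpoint x y s t) j)^* = - I * dz / 2 &
    forall k, cderive (fun r => cayley (hpoint x y s r) 0 k) t
      (dcayley (hpoint x y s t) dz dw 0 k)].
Proof.
move=> hx hy hs; set A := hpoint x y s t.
pose dw j : C := Complex (dx j t) (dy j t).
pose dz : C := Complex
  (4 * (\sum_j y j t * dx j t) - 2 * \sum_j (dx j t * y j t + x j t * dy j t))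
  (\sum_j (2 * x j t * dx j t + 2 * y j t * dy j t)).
have cdw j : cderive (fun r => hw (hpoint x y s r) j) t (dw j).
  by split; rewrite /hw /=; under eq_fun do rewrite mxE.
have cdz : cderive (fun r => hzeta (hpoint x y s r)) t dz.
  split; rewrite /hzeta /=.
    under eq_fun do under eq_bigr do rewrite !mxE.
    have h4 := real_deriveM (is_derive_cst (4 : R) t (1 : R)) hs.
    have h2 := real_deriveM (is_derive_cst (2 : R) t (1 : R))
      (real_derive_sum (index_enum 'I_m.+1) (fun j => real_deriveM (hx j) (hy j))).
    have := real_deriveD h4 (real_deriveN h2); congr is_derive.
    by rewrite !mul0r !add0r.
  under eq_fun do under eq_bigr do rewrite !mxE.
  have := real_derive_sum (index_enum 'I_m.+1)
    (fun j => real_deriveD (real_deriveM (hx j) (hx j)) (real_deriveM (hy j) (hy j))).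
  by congr is_derive; apply: eq_bigr => j _; ring.
have D0 := hzeta_neq0 A.
have cdD : cderive (fun r => hzeta (hpoint x y s r) + I) t dz.
  by have := cderiveD cdz (cderive_cst t I); rewrite addr0.
have cdV := cderiveV (F := fun r => hzeta (hpoint x y s r) + I) D0 cdD.
exists dz, dw; split=> // [|k].
- apply: (mulIf (_ : (2 : C) != 0)); first by rewrite pnatr_eq0.
  rewrite divfK ?pnatr_eq0 //.
  have -> : (2 : C) = real_complex R 2 by rewrite rmorph_nat.
  have R1 : Re (- I * dz) = \sum_j (2 * x j t * dx j t + 2 * y j t * dy j t).
    by rewrite ReM /=; ring.
  have I1 : Im (- I * dz) = \sum_j 2 * (dx j t * y j t + x j t * dy j t)
      - \sum_j 4 * (y j t * dx j t).
    by rewrite ImM /= -!mulr_sumr; ring.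
  rewrite mulr_suml; apply: cplx_eq; rewrite ?Re_sum ?Im_sum ?R1 ?I1.
    by apply: eq_bigr => j _; rewrite conjE !(ReM, ImM) /= !mxE; ring.
  by rewrite -sumrB; apply: eq_bigr => j _; rewrite conjE !(ReM, ImM) /= !mxE; ring.
- case: (unliftP ord0 k) => [j ->|->].
    under eq_fun do rewrite cayleyS.
    rewrite mxE liftK.
    have := cderiveM (cderiveM (cderive_cst t 2) (cdw j)) cdV.
    by move/cderive_eq; apply; rewrite -/A; field.
  under eq_fun do rewrite cayley0.
  rewrite mxE unlift_none.
  have := cderiveM (cderiveD cdz (cderive_cst t (- I))) cdV.
  by move/cderive_eq; apply; rewrite -/A; field.
Qed.

Lemma cayley_analytic (x y : 'I_m.+1 -> R -> R) (s : R -> R) t :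
  (forall j, analytic_at (x j) t) -> (forall j, analytic_at (y j) t) -> analytic_at s t ->
  forall k, canalytic (fun r => cayley (hpoint x y s r) 0 k) t.
Proof.
move=> hx hy hs k.
have aw j : canalytic (fun r => hw (hpoint x y s r) j) t.
  by split; rewrite /hw /=; under eq_fun do rewrite mxE.
have az : canalytic (fun r => hzeta (hpoint x y s r)) t.
  split; rewrite /hzeta /=.
    under eq_fun do under eq_bigr do rewrite !mxE.
    apply: analyticD; first exact: analyticM (analytic_cst t 4) hs.
    apply: analyticN; apply: analyticM; first exact: analytic_cst.
    by apply: analytic_sum => j; exact: analyticM.
  under eq_fun do under eq_bigr do rewrite !mxE.
  by apply: analytic_sum => j; apply: analyticD; exact: analyticM.
have aV : canalytic (fun r => (hzeta (hpoint x y s r) + I)^-1) t.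
  apply: canalyticV; first exact: hzeta_neq0.
  exact: canalyticD az (canalytic_cst t I).
case: (unliftP ord0 k) => [j ->|->].
  under eq_fun do rewrite cayleyS.
  by apply: canalyticM => //; apply: canalyticM => //; exact: canalytic_cst.
under eq_fun do rewrite cayley0.
by apply: canalyticM => //; exact: canalyticD az (canalytic_cst t (- I)).
Qed.

Definition cayley_inv u : heis R m.+1 :=
  let w j := I * u 0 (lift ord0 j) / (1 - u 0 ord0) in
  let zeta := I * (1 + u 0 ord0) / (1 - u 0 ord0) in
  (\row_j Re (w j), \row_j Im (w j), (Re zeta + 2 * \sum_j Re (w j) * Im (w j)) / 4).

(** [hzeta] has imaginary part |w|^2 by definition; the equation of the sphere, which gives the last
    coordinates the squared norm 1 - |u_0|^2, is what identifies this with Im zeta. *)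
Lemma cayley_invK u : dotmx u u = 1 -> u 0 ord0 != 1 -> cayley (cayley_inv u) = u.
Proof.
move=> uu u1; have t0 : 1 - u 0 ord0 != 0 by rewrite subr_eq0 eq_sym.
have tc0 : 1 - (u 0 ord0)^* != 0.
  by have := conj_neq0 t0; rewrite conjB (conj_nat 1).
have I0 : I != 0.
  by apply/eqP => h; have := I2; rewrite h mul0r => /eqP; rewrite eq_sym oppr_eq0 oner_eq0.
have two0 : (2 : C) != 0 by rewrite pnatr_eq0.
have wE j : hw (cayley_inv u) j = I * u 0 (lift ord0 j) / (1 - u 0 ord0).
  by rewrite /hw /= !mxE; case: (_ / _).
pose zeta := I * (1 + u 0 ord0) / (1 - u 0 ord0).
have zetac : zeta^* = - I * (1 + (u 0 ord0)^*) / (1 - (u 0 ord0)^*).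
  by rewrite /zeta conjdiv conjM conjD conjB (conj_nat 1) conjI.
have zE : hzeta (cayley_inv u) = zeta.
  apply: cplx_eq => /=.
    under [X in _ - 2 * X]eq_bigr do rewrite !mxE.
    by rewrite -/zeta; field.
  have -> : \sum_j ((cayley_inv u).1.1 0 j ^+ 2 + (cayley_inv u).1.2 0 j ^+ 2)
      = Re (\sum_j hw (cayley_inv u) j * (hw (cayley_inv u) j)^*).
    by rewrite Re_sum; apply: eq_bigr => j _; rewrite conjE ReM /=; ring.
  have -> : Im zeta = Re (- I * (zeta - zeta^*) / 2) by rewrite half_sub_conj.
  congr (complex.Re _); rewrite zetac /zeta.
  have -> : \sum_j hw (cayley_inv u) j * (hw (cayley_inv u) j)^* =
      (I * I^*) / ((1 - u 0 ord0) * (1 - (u 0 ord0)^*)) *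
      \sum_(j < m.+1) u 0 (lift ord0 j) * (u 0 (lift ord0 j))^*.
    rewrite mulr_sumr; apply: eq_bigr => j _.
    rewrite wE conjdiv conjM conjB (conj_nat 1); field.
    by do ?[apply/andP; split].
  have -> : \sum_(j < m.+1) u 0 (lift ord0 j) * (u 0 (lift ord0 j))^* =
      1 - u 0 ord0 * (u 0 ord0)^*.
    by move: uu; rewrite dotmx_sum big_ord_recl => <-; ring.
  rewrite conjI; field.
  by do ?[apply/andP; split].
have DE : hzeta (cayley_inv u) + I = 2 * I / (1 - u 0 ord0).
  by rewrite zE /zeta; field.
apply/rowP => k; case: (unliftP ord0 k) => [j ->|->].
  by rewrite cayleyS DE wE; field; do ?[apply/andP; split].
by rewrite cayley0 DE zE /zeta; field; do ?[apply/andP; split].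
Qed.

Lemma cayleyK : cancel cayley cayley_inv.
Proof.
have I0 : I != 0.
  by apply/eqP => h; have := I2; rewrite h mul0r => /eqP; rewrite eq_sym oppr_eq0 oner_eq0.
have two0 : (2 : C) != 0 by rewrite pnatr_eq0.
move=> A.
have D0 := hzeta_neq0 A.
have E1 : 1 - cayley A 0 ord0 = 2 * I / (hzeta A + I) by rewrite cayley0; field.
have E2 j : I * cayley A 0 (lift ord0 j) / (1 - cayley A 0 ord0) = hw A j.
  by rewrite E1 cayleyS; field; do ?[apply/andP; split].
have E3 : I * (1 + cayley A 0 ord0) / (1 - cayley A 0 ord0) = hzeta A.
  by rewrite E1 cayley0; field; do ?[apply/andP; split].
rewrite /cayley_inv E3; under [X in 2 * X]eq_bigr do rewrite E2.
rewrite [in RHS](surjective_pairing A) [in RHS](surjective_pairing A.1).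
congr (_, _, _); first by apply/rowP => j; rewrite mxE E2.
  by apply/rowP => j; rewrite mxE E2.
by rewrite /=; field.
Qed.

End CayleyChart.

(** * Cluster sets from recurrence to every open set *)

Section ClusterSets.
Context (R : realType) (n : nat).
Local Notation C := R[i].
Implicit Types (f : R -> 'rV[C]_n) (omega : set 'rV[C]_n).

Lemma cluster_pinfty_closure f omega : (forall t, omega (f t)) ->
  (forall q V T, omega q -> nbhs q V -> exists2 t, T <= t & V (f t)) ->
  cluster_set_pinfty f = closure omega.
Proof.
move=> fo dense; rewrite eqEsubset; split=> [q [t [_ tq]] V /tq[N _ hN]|q clq].
  by exists (f (t N)); split=> //; apply: hN => /=.
have ball_nbhs k : nbhs q (ball q (real_complex R k.+1%:R^-1)).
  by apply: nbhsx_ballx; rewrite -[0]/(real_complex R 0) ltc_real invr_gt0 ltr0n.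
have ex k : exists t, k%:R <= t /\ ball q (real_complex R k.+1%:R^-1) (f t).
  have /clq[q1 [oq1]] := nbhs_interior (ball_nbhs k).
  by move=> /(dense _ _ k%:R oq1)[t kt bt]; exists t.
have [t ht] := choice ex; exists t; split.
  apply/cvgryPge => A; have [N [AN _]] := inv_nat_small A (ltr01 : 0 < 1 :> R).
  exists N => // k /= Nk; have [kt _] := ht k.
  by apply: le_trans AN (le_trans _ kt); rewrite ler_nat.
apply/cvg_ballP => e /posc_real[e0 ee].
have e20 : 0 < complex.Re e / 2 by rewrite divr_gt0.
have [N [_ Ne]] := inv_nat_small 0 e20.
exists N => // k /= Nk; have [_ bt] := ht k; apply: le_ball bt; rewrite ee.
rewrite lecE /= eqxx /=; have : k.+1%:R^-1 <= N.+1%:R^-1 :> R.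
  by rewrite lef_pV2 ?posrE ?ltr0n // ler_nat.
by move: Ne; set a := N.+1%:R^-1; set b := k.+1%:R^-1; lra.
Qed.

Lemma cluster_ninfty_opp f : cluster_set_ninfty f = cluster_set_pinfty (fun t => f (- t)).
Proof.
rewrite eqEsubset; split=> q [t [tl tq]]; exists (fun k => - t k).
  split; first exact/cvgNry.
  by rewrite (_ : _ \o _ = f \o t) //; apply/funext => k /=; rewrite opprK.
split; first exact/cvgNrNy.
exact: tq.
Qed.

Lemma cluster_ninfty_closure f omega : (forall t, omega (f t)) ->
  (forall q V T, omega q -> nbhs q V -> exists2 t, t <= T & V (f t)) ->
  cluster_set_ninfty f = closure omega.
Proof.
move=> fo dense; rewrite cluster_ninfty_opp; apply: cluster_pinfty_closure => //.
move=> q V T oq /(dense _ _ (- T) oq)[t tT Vt].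
by exists (- t); rewrite ?opprK // lerNr.
Qed.

End ClusterSets.

(** * Unitary matrices with a prescribed first row *)

Section UnitaryFrames.
Context (C : numClosedFieldType).

(** Gram-Schmidt on the matrix all of whose rows are p still yields a unitary matrix. There p = c q
    for the first row q, with |c| = 1 by comparing norms and c >= 0 by the normalisation of
    [schmidt], so c = 1. *)
Lemma unitary_first_row n (p : 'rV[C]_n.+1) : dotmx p p = 1 ->
  exists2 U : 'M[C]_n.+1, U \is unitarymx & row ord0 U = p.
Proof.
move=> pp; pose A : 'M[C]_n.+1 := \matrix_(i, j) p 0 j.
have rA : row ord0 A = p by apply/rowP => j; rewrite !mxE.
pose U := schmidt A.
have uU : U \is unitarymx by exact: schmidt_unitarymx.
exists U => //.
have /row_unitarymxP/(_ ord0 ord0) := uU; rewrite eqxx => q1.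
have c0 := form1_row_schmidt A ord0; rewrite rA -/U in c0.
have := row_schmidt_sub A ord0; rewrite rA -/U.
rewrite (big_pred1 ord0) => [|i]; last first.
  by rewrite leqn0.
rewrite genmxE => /sub_rVP[c pE].
have dE (a b : C) (u v : 'rV[C]_n.+1) : dotmx (a *: u) (b *: v) = a * b^* * dotmx u v.
  rewrite !dotmxE !mxE mulr_sumr; apply: eq_bigr => j _.
  by rewrite !mxE rmorphM mulrACA.
have cc : c * c^* = 1.
  by move: pp; rewrite pE dE q1 mulr1.
have {}c0 : 0 <= c.
  by move: c0; rewrite pE -[X in dotmx _ X]scale1r dE rmorph1 q1 !mulr1.
have c1 : c = 1.
  have := cc; rewrite (CrealP (ger0_real c0)) -expr2 => /eqP.
  by rewrite sqrp_eq1 // => /eqP.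
by rewrite pE c1 scale1r.
Qed.

Lemma dotmx_unitary n (U : 'M[C]_n) (u v : 'rV[C]_n) : U \is unitarymx ->
  dotmx (u *m U) (v *m U) = dotmx u v.
Proof.
move=> /unitarymxP UU; rewrite !dotmxE trmx_mul map_mxM /= mulmxA -(mulmxA u) UU.
by rewrite mulmx1.
Qed.

Lemma unitary_mulK n (U : 'M[C]_n) (u : 'rV[C]_n) : U \is unitarymx ->
  u *m U *m (U^t*)%sesqui = u.
Proof. by move=> /unitarymxP UU; rewrite -mulmxA UU mulmx1. Qed.

Lemma unitary_mulVK n (U : 'M[C]_n) (u : 'rV[C]_n) : U \is unitarymx ->
  u *m (U^t*)%sesqui *m U = u.
Proof. by move=> /unitarymxP/mulmx1C UU; rewrite -mulmxA UU mulmx1. Qed.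

End UnitaryFrames.

(** * Charts of the punctured sphere and the conclusion *)

Section SphereChart.
Context (R : realType) (m : nat).
Local Notation C := R[i].
Local Notation I := (Complex 0 1 : C).
Implicit Types (A B : heis R m.+1) (U : 'M[C]_m.+2) (p z : 'rV[C]_m.+2).
Implicit Type omega : set 'rV[C]_m.+2.

(** The Cayley transform misses only the first basis vector; the unitary U moves this pole to its
    own row 0 and preserves the Hermitian product, hence the contact structure. *)
Definition chart U A : 'rV[C]_m.+2 := cayley A *m U.
Definition chart_inv U z : heis R m.+1 := cayley_inv (z *m (U^t*)%sesqui).

Lemma chart_sphere U A : U \is unitarymx -> sphere (chart U A).
Proof. by move=> uU; rewrite /sphere /= dotmx_unitary // cayley_sphere. Qed.

Lemma chartK U : U \is unitarymx -> cancel (chart U) (chart_inv U).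
Proof. by move=> uU A; rewrite /chart_inv /chart unitary_mulK // cayleyK. Qed.

Lemma frame_neq1 U z : U \is unitarymx -> sphere z -> z != row ord0 U ->
  (z *m (U^t*)%sesqui) 0 ord0 != 1.
Proof.
move=> uU sz; apply: contra => /eqP u0; set u := z *m _ in u0.
have uu : dotmx u u = 1 by rewrite -(dotmx_unitary _ _ uU) unitary_mulVK.
have uS j : u 0 (lift ord0 j) = 0.
  have : \sum_(j < m.+1) u 0 (lift ord0 j) * (u 0 (lift ord0 j))^* = 0.
    move: uu; rewrite dotmx_sum big_ord_recl u0 (conj_nat R 1) mulr1 => /eqP.
    by rewrite -subr_eq0 addrAC subrr add0r => /eqP.
  move/eqP; rewrite psumr_eq0 => [|i _]; last by rewrite -normCK exprn_ge0.
  by move/allP/(_ j (mem_index_enum j)); rewrite -normCK expf_eq0 normr_eq0 /= => /eqP.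
rewrite -[z](unitary_mulVK _ uU) -/u rowE; apply/eqP; congr (_ *m _).
apply/rowP => k; case: (unliftP ord0 k) => [j ->|->]; rewrite [in RHS]mxE.
  by rewrite uS eqxx eq_sym (negPf (neq_lift _ _)).
by rewrite u0 !eqxx.
Qed.

Lemma chart_invK U z : U \is unitarymx -> sphere z -> z != row ord0 U ->
  chart U (chart_inv U z) = z.
Proof.
move=> uU sz zp; rewrite /chart /chart_inv cayley_invK ?unitary_mulVK //.
  by rewrite -(dotmx_unitary _ _ uU) unitary_mulVK.
exact: frame_neq1.
Qed.

Lemma cont_mulmx (T : topologicalType) (x : T) k n (F : T -> 'rV[C]_k) (M : 'M[C]_(k, n)) :
  (forall j, {for x, continuous (fun t => F t 0 j)}) ->
  {for x, continuous (fun t => F t *m M)}.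
Proof.
move=> cF; apply: cont_row => j.
rewrite (_ : (fun _ => _) = fun t => \sum_l F t 0 l * M l j); last first.
  by apply/funext => t; rewrite mxE.
by apply: cont_sum => l; apply: contM; [exact: cF|exact: cont_cst].
Qed.

Lemma chart_continuous U A : {for A, continuous (chart U)}.
Proof.
have cx j : {for A, continuous (fun B : heis R m.+1 => B.1.1 0 j)}.
  apply: (@continuous_comp _ _ _ (fun B : heis R m.+1 => B.1.1) (fun v => v 0 j)).
    apply: (@continuous_comp _ _ _ (fun B : heis R m.+1 => B.1) fst); exact: cvg_fst.
  exact: coord_continuous.
have cy j : {for A, continuous (fun B : heis R m.+1 => B.1.2 0 j)}.
  apply: (@continuous_comp _ _ _ (fun B : heis R m.+1 => B.1.2) (fun v => v 0 j)).
    apply: (@continuous_comp _ _ _ (fun B : heis R m.+1 => B.1) snd);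
      [exact: cvg_fst|exact: cvg_snd].
  exact: coord_continuous.
have cs : {for A, continuous (fun B : heis R m.+1 => B.2)} by exact: cvg_snd.
have cw j : {for A, continuous (fun B => hw B j)} by exact: cont_cplx.
have cz : {for A, continuous (@hzeta R m)}.
  apply: cont_cplx.
    apply: contD; first by apply: contM; [exact: cont_cst|exact: cs].
    apply: contN; apply: contM; first exact: cont_cst.
    by apply: cont_sum => j; apply: contM; [exact: cx|exact: cy].
  by apply: cont_sum => j; apply: contD; apply: contM; first [exact: cx|exact: cy].
have cV : {for A, continuous (fun B => (hzeta B + I)^-1)}.
  apply: contV; first exact: hzeta_neq0.
  by apply: contD; [exact: cz|exact: cont_cst].
apply: cont_mulmx => k; case: (unliftP ord0 k) => [j ->|->].
  rewrite (_ : (fun _ => _) = fun B => 2 * hw B j / (hzeta B + I)); last first.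
    by apply/funext => B; rewrite cayleyS.
  by apply: contM; [apply: contM; [exact: cont_cst|exact: cw]|exact: cV].
rewrite (_ : (fun _ => _) = fun B => (hzeta B - I) / (hzeta B + I)); last first.
  by apply/funext => B; rewrite cayley0.
by apply: contM; [apply: contD; [exact: cz|exact: cont_cst]|exact: cV].
Qed.

Lemma chart_inv_continuous U z : U \is unitarymx -> sphere z -> z != row ord0 U ->
  {for z, continuous (chart_inv U)}.
Proof.
move=> uU sz zp; have u1 := frame_neq1 uU sz zp.
pose u (z : 'rV[C]_m.+2) := z *m (U^t*)%sesqui.
have cu k : {for z, continuous (fun z => u z 0 k)}.
  apply: (@continuous_comp _ _ _ u (fun v => v 0 k)); last exact: coord_continuous.
  by apply: cont_mulmx => j; exact: coord_continuous.
have cV : {for z, continuous (fun z => (1 - u z 0 ord0)^-1)}.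
  have u1' : 1 - u z 0 ord0 != 0 by rewrite subr_eq0 eq_sym.
  have cD : {for z, continuous (fun z => 1 - u z 0 ord0)}.
    by apply: contD; [exact: cont_cst|apply: contN; exact: cu].
  by apply: contV; [exact: u1'|exact: cD].
have cw j : {for z, continuous (fun z => I * u z 0 (lift ord0 j) / (1 - u z 0 ord0))}.
  by apply: contM; [apply: contM; [exact: cont_cst|exact: cu]|exact: cV].
have cz : {for z, continuous (fun z => I * (1 + u z 0 ord0) / (1 - u z 0 ord0))}.
  apply: contM; last exact: cV.
  by apply: contM; [exact: cont_cst|apply: contD; [exact: cont_cst|exact: cu]].
have c1 : {for z, continuous (fun z => (chart_inv U z).1.1)}.
  apply: cont_row => j; rewrite (_ : (fun _ => _) =
    fun z => complex.Re (I * u z 0 (lift ord0 j) / (1 - u z 0 ord0))).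
    by apply: cont_Re; exact: cw.
  by apply/funext => v; rewrite mxE.
have c2 : {for z, continuous (fun z => (chart_inv U z).1.2)}.
  apply: cont_row => j; rewrite (_ : (fun _ => _) =
    fun z => complex.Im (I * u z 0 (lift ord0 j) / (1 - u z 0 ord0))).
    by apply: cont_Im; exact: cw.
  by apply/funext => v; rewrite mxE.
have c3 : {for z, continuous (fun z => (chart_inv U z).2)}.
  apply: contM; last exact: cont_cst.
  apply: contD; first by apply: cont_Re; exact: cz.
  apply: contM; first exact: cont_cst.
  by apply: cont_sum => j; apply: contM; [apply: cont_Re; exact: cw|apply: cont_Im; exact: cw].
exact: cvg_pair (cvg_pair c1 c2) c3.
Qed.

Lemma contact_of_dotmx n (p v : 'rV[C]_n) : dotmx v p = 0 -> contact_hyperplane p v.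
Proof.
move=> h; split; first by rewrite /tangent_sphere /= h.
exists (- 'i *: v); last by rewrite scalerA mulrN -expr2 sqrCi opprK scale1r.
rewrite /tangent_sphere /= dotmxE.
by rewrite -scalemxAl mxE -dotmxE h mulr0.
Qed.

(** The last hypothesis deals with the pole, which the chart cannot see: to come close to it, the
    line visits nearby points of omega that the chart does contain. *)
Lemma chart_dense_line U omega : U \is unitarymx -> open_in_sphere omega ->
  [set A | omega (chart U A)] !=set0 ->
  (forall A B, omega (chart U A) -> omega (chart U B) ->
     leads [set A | omega (chart U A)] A B) ->
  omega `<=` closure (omega `\ row ord0 U) ->
  exists f, dense_legendrian_line omega f.
Proof.
move=> uU [V oV oE] W0 lW dense.
have oW : openH [set A | omega (chart U A)].
  have -> : [set A | omega (chart U A)] = chart U @^-1` V.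
    apply/seteqP; split=> A /=; rewrite oE; first by case.
    by split=> //; exact: chart_sphere.
  apply/openHP; apply: open_comp => // A _; exact: chart_continuous.
have [x [y [dx [dy [s L]]]]] := exists_legendrian_line oW W0 lW.
have osph q : omega q -> sphere q by rewrite oE => -[].
pose f t := chart U (hpoint x y s t); exists f.
have der t := cayley_derive (fun j => line_dx L j t) (fun j => line_dy L j t) (line_ds L t).
have vel t dz dw : (forall k, cderive (fun r => cayley (hpoint x y s r) 0 k) t
      (dcayley (hpoint x y s t) dz dw 0 k)) ->
    velocity f t = dcayley (hpoint x y s t) dz dw *m U.
  move=> hd; apply: velocityE => j; rewrite mxE /f /chart.
  under eq_fun do rewrite mxE.
  apply: cderive_sum => k.
  have := cderiveM (hd k) (cderive_cst t (U k j)).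
  by rewrite mulr0 addr0.
have visit q V' : omega q -> nbhs q V' -> exists A e, [/\ omega (chart U A), 0 < e &
    forall B, nearH e A B -> V' (chart U B)].
  move=> oq nq; have [q2 [[oq2 q2p] Vq2]] := dense _ oq _ (nbhs_interior nq).
  have q2U : q2 != row ord0 U by apply/eqP.
  have K := chart_invK uU (osph _ oq2) q2U.
  exists (chart_inv U q2).
  have [e e0 he] : exists2 e, 0 < e & forall B, nearH e (chart_inv U q2) B -> V' (chart U B).
    apply/(@nbhs_heisP R m _ (chart U @^-1` V')); apply: (chart_continuous _).
    by rewrite K.
  by exists e; rewrite K.
split.
- by move=> t; exact: (line_in L t).
- apply: canalytic_curve => t j; rewrite /f /chart.
  under eq_fun do rewrite mxE.
  apply: canalytic_sum => k; apply: canalyticM; last exact: canalytic_cst.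
  by apply: cayley_analytic; [move=> i; exact: (line_ax L)|move=> i; exact: (line_ay L)|exact: (line_as L)].
- split.
    by move=> t1 t2 /(can_inj (chartK uU))/(line_inj L).
  move=> t; have [dz [dw [dwE _ hd]]] := der t.
  rewrite (vel t dz dw hd); apply/eqP => /(congr1 (fun u => u *m (U^t*)%sesqui)).
  rewrite unitary_mulK // mul0mx => /dcayley_eq0/(_ ord0); rewrite dwE => h.
  have hx : dx 0 t = 0 by exact: (congr1 (@complex.Re R) h).
  have hy : dy 0 t = 0 by exact: (congr1 (@complex.Im R) h).
  by have [] := line_imm L t; rewrite ?hx ?hy eqxx.
- move=> t; have [dz [dw [_ hz hd]]] := der t; rewrite (vel t dz dw hd).
  by apply: contact_of_dotmx; rewrite dotmx_unitary // dcayley_contact.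
- split.
    apply: cluster_pinfty_closure => [t|q V' T oq nq]; first exact: (line_in L t).
    have [A [e [WA e0 hA]]] := visit q V' oq nq.
    by have [t Tt /hA] := line_dense_right L T WA e0; exists t.
  apply: cluster_ninfty_closure => [t|q V' T oq nq]; first exact: (line_in L t).
  have [A [e [WA e0 hA]]] := visit q V' oq nq.
  by have [t Tt /hA] := line_dense_left L T WA e0; exists t.
Qed.

(** The pole is put at the missing point p, so [chart_inv] is continuous on all of omega and carries
    its connectedness to the group. *)
Lemma dense_line_proper omega p : sphere p -> ~ omega p -> omega !=set0 ->
  open_in_sphere omega -> connected omega -> exists f, dense_legendrian_line omega f.
Proof.
move=> sp np [q oq] open_o conn; have [U uU pE] := unitary_first_row sp.
have osph z : omega z -> sphere z by case: open_o => V _ ->; case.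
have neqp z : omega z -> z != row ord0 U.
  by move=> oz; apply/eqP => h; apply: np; rewrite -pE -h.
have K z : omega z -> chart U (chart_inv U z) = z.
  by move=> oz; apply: chart_invK => //; [exact: osph|exact: neqp].
apply: (chart_dense_line uU open_o).
- by exists (chart_inv U q); rewrite /= K.
- move=> A B oA oB; apply: leads_connected => //.
    case: open_o osph => V oV -> _.
    rewrite (_ : mkset _ = chart U @^-1` V).
      apply: open_comp => // z _; exact: chart_continuous.
    apply/seteqP; split=> z /=; first by case.
    by split=> //; exact: chart_sphere.
  rewrite (_ : mkset _ = chart_inv U @` omega).
    apply: connected_continuous_connected => //; apply: continuous_in_subspaceT.
    move=> z /set_mem oz; apply: chart_inv_continuous => //; [exact: osph|exact: neqp].
  apply/seteqP; split=> [z /= oz|_ [z oz <-]] /=; last by rewrite K.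
  by exists (chart U z) => //; rewrite chartK.
- move=> z oz V /nbhs_singleton Vz; exists z; split=> //; split=> //.
  by apply/eqP; exact: neqp.
Qed.

(** The point p is rotated by (1 - i t) / (1 + i t), a rational parametrisation of unit complex
    numbers. *)
Lemma sphere_no_isolated p : sphere p -> closure (@sphere R m.+2 `\ p) p.
Proof.
move=> sp V Vp.
pose c (t : R) : C := Complex 1 (- t) / Complex 1 t.
have D0 t : Complex 1 t != 0 :> C.
  by apply/eqP => /(congr1 (@complex.Re R)) /= /eqP; rewrite oner_eq0.
have c0 : c 0 = 1 by rewrite /c oppr0 divff.
have cont : {for 0, continuous (fun t => c t *: p)}.
  apply: cont_row => j; rewrite (_ : (fun _ => _) = fun t => c t * p 0 j); last first.
    by apply/funext => t; rewrite mxE.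
  apply: contM; last exact: cont_cst.
  apply: contM.
    by apply: cont_cplx; [exact: cont_cst|apply: contN; exact: cvg_id].
  by apply: contV => //; apply: cont_cplx; [exact: cont_cst|exact: cvg_id].
have /nbhs_ballP[e /= e0 he] : nbhs (0 : R) [set t | V (c t *: p)].
  by apply: cont; rewrite c0 scale1r.
have e20 : 0 < e / 2 by rewrite divr_gt0.
exists (c (e / 2) *: p); split; last first.
  by apply: he; rewrite /ball /= sub0r normrN ger0_norm; lra.
split.
  rewrite /sphere /= dotmx_sum.
  have cc : c (e / 2) * (c (e / 2))^* = 1.
    have -> : (c (e / 2))^* = Complex 1 (e / 2) / Complex 1 (- (e / 2)).
      by rewrite /c conjdiv !conjE /= opprK.
    rewrite /c mulrACA [X in X * _]mulrC -mulrACA !divff ?mulr1 //; exact: D0.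
  rewrite -[RHS]sp dotmx_sum; apply: eq_bigr => k _; rewrite !mxE conjM.
  by rewrite mulrACA cc mul1r.
move=> /= h; have : (c (e / 2) - 1) *: p = 0 by rewrite scalerBl h scale1r subrr.
move/eqP; rewrite scaler_eq0 => /orP[|/eqP p0]; last first.
  have := sp; rewrite /sphere /= p0 dotmx_sum big1 => [/eqP|k _].
    by rewrite eq_sym oner_eq0.
  by rewrite !mxE mul0r.
rewrite subr_eq0 => /eqP c1; have := congr1 (fun w : C => w * Complex 1 (e / 2)) c1.
rewrite /c divfK // mul1r => /(congr1 (@complex.Im R)) /=; lra.
Qed.

(** For any pole the chart domain is the whole group, so [leads_setT] replaces the connectedness
    argument. *)
Lemma dense_line_sphere : exists f, dense_legendrian_line (@sphere R m.+2) f.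
Proof.
pose p : 'rV[C]_m.+2 := delta_mx 0 ord0.
have sp : sphere p.
  rewrite /sphere /= dotmx_sum (bigD1 ord0) //= big1 => [|k /negPf k0].
    by rewrite mxE !eqxx /= addr0 mul1r (conj_nat R 1).
  by rewrite mxE k0 andbF mul0r.
have [U uU pE] := unitary_first_row sp.
have all_W : [set A | sphere (chart U A)] = setT.
  by apply/seteqP; split=> // A _ /=; exact: chart_sphere.
apply: (chart_dense_line uU).
- by exists setT; [exact: openT|rewrite setIT].
- by rewrite all_W; exists 0.
- by move=> A B _ _; rewrite all_W; exact: leads_setT.
- rewrite pE => z sz; have [->|/eqP zp] := eqVneq z p; first exact: sphere_no_isolated.
  by move=> V /nbhs_singleton Vz; exists z.
Qed.

End SphereChart.

Theorem corollary1p4 (R : realType) (n : nat) (n_gt1 : (1 < n)%N) :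
  (forall omega : set 'rV[R[i]]_n,
      omega !=set0 ->
      open_in_sphere omega ->
      connected omega ->
      exists f : R -> 'rV[R[i]]_n, dense_legendrian_line omega f) /\
  (exists f : R -> 'rV[R[i]]_n, dense_legendrian_line (@sphere R n) f).
Proof.
case: n n_gt1 => [//|[//|m]] _; split; last exact: dense_line_sphere.
move=> omega ne op conn.
(* A point of the sphere missed by omega serves as the pole; if there is none, omega is the
   sphere. *)
have [full|/existsNP[p /not_implyP[sp np]]] := pselect (forall p, sphere p -> omega p).
  have -> : omega = @sphere R m.+2 by apply/seteqP; split=> // z; case: op => V _ ->; case.
  exact: dense_line_sphere.
exact: (dense_line_proper sp np).
Qed.
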